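(* Let $m \geq 3$ and let $M$ be a connected orientable real hypersurface in the complex two-plane Grassmannian $G_2(\mathbb{C}^{m+2})$, with shape operator $A$, Reeb vector field $\xi$, and distributions $\mathfrak{D}$, $\mathfrak{D}^\perp$ as defined in the context. If $A\mathfrak{D} \subset \mathfrak{D}$ and $\xi \in \mathfrak{D}^\perp$ at every point of $M$, then $M$ is an open part of a tube around a totally geodesic $G_2(\mathbb{C}^{m+1})$ in $G_2(\mathbb{C}^{m+2})$.
   Context: $G_2(\mathbb{C}^{m+2})$ denotes the set of all complex 2-dimensional linear subspaces of $\mathbb{C}^{m+2}$, a compact irreducible Riemannian symmetric space. It carries a Kähler structure $J$ and a quaternionic Kähler structure $\mathfrak{J}$ not containing $J$ (identifying $T_V G_2(\mathbb{C}^{m+2})$ with $\mathrm{Hom}_{\mathbb{C}}(V,V^\perp)$, $J$ is multiplication by $i$ and $\mathfrak{J}$ is given by precomposition with elements of $\mathfrak{su}(V)$). A canonical local basis of $\mathfrak{J}$ is a local basis $\{J_1,J_2,J_3\}$ of $\mathfrak{J}$ consisting of local almost Hermitian structures with $J_aJ_{a+1}=J_{a+2}=-J_{a+1}J_a$ (indices modulo 3). One has $JJ_a=J_aJ$ and $\mathrm{Trace}(JJ_a)=0$. The Riemannian metric $g$ is normalized so that the curvature tensor is $$\bar R(X,Y)Z = g(Y,Z)X-g(X,Z)Y+g(JY,Z)JX-g(JX,Z)JY-2g(JX,Y)JZ+\sum_{a=1}^3\{g(J_aY,Z)J_aX-g(J_aX,Z)J_aY-2g(J_aX,Y)J_aZ+g(JJ_aY,Z)JJ_aX-g(JJ_aX,Z)JJ_aY\}.$$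 A real hypersurface $M$ is a (real codimension one) isometrically immersed submanifold; $N$ is a unit normal vector field on $M$ and $A$ is the shape operator, $AX=-\bar\nabla_X N$, where $\bar\nabla$ is the Levi-Civita connection of $G_2(\mathbb{C}^{m+2})$. The Reeb vector field is $\xi=-JN$. For a canonical local basis put $\xi_a=-J_aN$, $a=1,2,3$. $\mathfrak{D}^\perp=\mathrm{span}\{\xi_1,\xi_2,\xi_3\}=\mathfrak{J}N$ (independent of the choice of basis), and $\mathfrak{D}$ is the orthogonal complement of $\mathfrak{D}^\perp$ in $TM$. A totally geodesic $G_2(\mathbb{C}^{m+1})$ in $G_2(\mathbb{C}^{m+2})$ is the submanifold of all complex 2-planes contained in a fixed complex hyperplane $\mathbb{C}^{m+1}\subset\mathbb{C}^{m+2}$. The tube of radius $r$ around it is the hypersurface of points at distance $r$ from it, where $r\in(0,\pi/\sqrt{8})$ for the metric $g$ normalized to have curvature tensor $\bar R$ (so that its maximal sectional curvature is $8$). *)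

(* Defs.v *)
From HB Require Import structures.
From mathcomp Require Import all_boot all_order all_algebra.
From mathcomp Require Import all_classical all_reals all_analysis.
From mathcomp Require Import complex.
Set Implicit Arguments.
Unset Strict Implicit.
Unset Printing Implicit Defensive.
Import Order.TTheory GRing.Theory Num.Theory.
Import numFieldNormedType.Exports.
Local Open Scope classical_set_scope.
Local Open Scope ring_scope.
Local Open Scope complex_scope.
Local Open Scope sesquilinear_scope.

(** * Differential calculus *)

(* C^k for a scalar function on an open set U; the total functions involved are
   only constrained on U. *)
Fixpoint Ck (R : realType) (V : normedModType R) (k : nat) (U : set V)
    (h : V -> R) : Prop :=
  if k is k'.+1 then
    (forall x, U x -> differentiable h x) /\
    (forall v, Ck k' U (fun x => 'D_v h x))
  else forall x, U x -> {for x, continuous h}.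

Definition smooth_on (R : realType) (V : normedModType R) (U : set V)
    (h : V -> R) : Prop :=
  forall k, Ck k U h.

Definition re_entry (R : realType) (V : Type) (n : nat) (F : V -> 'M[R[i]]_n)
  (i j : 'I_n) : V -> R := fun x => complex.Re (F x i j).

Definition im_entry (R : realType) (V : Type) (n : nat) (F : V -> 'M[R[i]]_n)
  (i j : 'I_n) : V -> R := fun x => complex.Im (F x i j).

(* 'M[R[i]]_n has no library structure of normed space over R, so regularity and
   derivatives of matrix-valued maps are taken on real and imaginary parts of
   the entries. *)
Definition mx_Ck (R : realType) (V : normedModType R) (n k : nat) (U : set V)
    (F : V -> 'M[R[i]]_n) : Prop :=
  forall i j, Ck k U (re_entry F i j) /\ Ck k U (im_entry F i j).

Definition mx_smooth_on (R : realType) (V : normedModType R) (n : nat)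
    (U : set V) (F : V -> 'M[R[i]]_n) : Prop :=
  forall k, mx_Ck k U F.

Definition mx_derive (R : realType) (V : normedModType R) (n : nat)
    (F : V -> 'M[R[i]]_n) (x v : V) : 'M[R[i]]_n :=
  \matrix_(i, j) ('D_v (re_entry F i j) x +i* 'D_v (im_entry F i j) x).

(** * Smooth manifolds *)

Record chart (R : realType) (d : nat) (M : topologicalType) := Chart {
  chart_dom : set M;
  chart_map : M -> 'rV[R]_d;
  chart_inv : 'rV[R]_d -> M }.

Definition chart_cod (R : realType) (d : nat) (M : topologicalType)
    (c : chart R d M) : set 'rV[R]_d :=
  chart_map c @` chart_dom c.

Definition chart_homeo (R : realType) (d : nat) (M : topologicalType)
    (c : chart R d M) : Prop :=
  [/\ open (chart_dom c), open (chart_cod c),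
      forall p, chart_dom c p -> chart_inv c (chart_map c p) = p,
      forall p, chart_dom c p -> {for p, continuous (chart_map c)} &
      forall x, chart_cod c x -> {for x, continuous (chart_inv c)}].

Definition transition_smooth (R : realType) (d : nat) (M : topologicalType)
    (c c' : chart R d M) : Prop :=
  forall j : 'I_d,
    smooth_on (chart_cod c `&` chart_inv c @^-1` chart_dom c')
      (fun x => chart_map c' (chart_inv c x) 0 j).

Definition smooth_manifold (R : realType) (d : nat) (M : topologicalType)
    (atl : set (chart R d M)) : Prop :=
  [/\ hausdorff_space M, second_countable (T := M),
      forall c, atl c -> chart_homeo c,
      forall p, exists2 c, atl c & chart_dom c p &
      forall c c', atl c -> atl c' -> transition_smooth c c'].

Definition mx_smooth (R : realType) (d : nat) (M : topologicalType)
    (atl : set (chart R d M)) (n : nat) (F : M -> 'M[R[i]]_n) : Prop :=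
  forall c, atl c -> mx_smooth_on (chart_cod c) (F \o chart_inv c).

(* The derivative of F at p in the direction of the tangent vector of M whose
   coordinates in the chart c are u. *)
Definition mx_dir (R : realType) (d : nat) (M : topologicalType) (n : nat)
    (F : M -> 'M[R[i]]_n) (c : chart R d M) (p : M) (u : 'rV[R]_d) :
    'M[R[i]]_n :=
  mx_derive (F \o chart_inv c) (chart_map c p) u.

(** * The Grassmannian G_2(C^n)

   A complex 2-plane V of C^n is encoded by the orthogonal projection P onto V.
   Vectors are rows and matrices act on the right, so V is the row space of P.
   This realizes G_2(C^n) as a submanifold of the real vector space of Hermitian
   matrices. *)

Definition gr2 (R : realType) (n : nat) : set 'M[R[i]]_n :=
  [set P | [/\ P ^t* = P, P *m P = P & \rank P = 2%N]].

Definition gr2_tangent (R : realType) (n : nat) (P : 'M[R[i]]_n) :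
    set 'M[R[i]]_n :=
  [set X | X ^t* = X /\ X *m P + P *m X = X].

(* The identification of T_V with Hom(V, V^perp): X corresponds to
   Z = P X (1 - P), that is v |-> v X for v in V, and X = Z + Z^H, where Z^H is the conjugate transpose of Z. *)
Definition hom_of (R : realType) (n : nat) (P X : 'M[R[i]]_n) : 'M[R[i]]_n :=
  P *m X *m (1%:M - P).

Definition tan_of (R : realType) (n : nat) (Z : 'M[R[i]]_n) : 'M[R[i]]_n :=
  Z + Z ^t*.

(* The metric, induced by the ambient Euclidean inner product Re tr(X Y^H) / 4;
   on Hom(V, V^perp) it reads Re tr(Z W^H) / 2. A line of planes
   span(cos t v + sin t w, v'), with v, v', w orthonormal, then has speed
   1/sqrt 2 and spans a sphere of curvature 8: this is the normalization for
   which the maximal sectional curvature is 8. *)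
Definition gmet (R : realType) (n : nat) (X Y : 'M[R[i]]_n) : R :=
  complex.Re (\tr (X *m Y ^t*)) / 4%:R.

Definition kahlerJ (R : realType) (n : nat) (P X : 'M[R[i]]_n) : 'M[R[i]]_n :=
  tan_of ('i *: hom_of P X).

(* su(V), its elements being extended by 0 on V^perp. *)
Definition su_plane (R : realType) (n : nat) (P : 'M[R[i]]_n) :
    set 'M[R[i]]_n :=
  [set q | [/\ P *m q *m P = q, q ^t* = - q & \tr q = 0]].

(* Precomposition of v |-> v Z with v |-> v q is v |-> v (q Z). *)
Definition quatJ (R : realType) (n : nat) (P q X : 'M[R[i]]_n) :
    'M[R[i]]_n :=
  tan_of (q *m hom_of P X).

(* The orthogonal projection onto the tangent space at P; see tanprojP. *)
Definition tanproj (R : realType) (n : nat) (P X : 'M[R[i]]_n) : 'M[R[i]]_n :=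
  P *m X *m (1%:M - P) + (1%:M - P) *m X *m P.

Lemma tanprojP (R : realType) (n : nat) (P X : 'M[R[i]]_n) :
  gr2 P -> X ^t* = X ->
  gr2_tangent P (tanproj P X) /\
  forall Y, gr2_tangent P Y -> gmet (X - tanproj P X) Y = 0.
Proof.
move=> [PH PP _] XH; rewrite /tanproj.
set Q := 1%:M - P; have PQ1 : P + Q = 1%:M by rewrite addrC subrK.
have PQ : P *m Q = 0 by rewrite mulmxBr mulmx1 PP subrr.
have QP : Q *m P = 0 by rewrite mulmxBl mul1mx PP subrr.
have QH : Q ^t* = Q.
  by rewrite /Q linearB /= map_mxB PH trmx1 map_mx1.
clearbody Q.
have adjM (A B : 'M[R[i]]_n) : (A *m B) ^t* = B ^t* *m A ^t*.
  by rewrite trmx_mul map_mxM.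
split.
  split.
    by rewrite linearD /= map_mxD !adjM PH XH QH addrC -!mulmxA.
  rewrite mulmxDl mulmxDr -!mulmxA QP PP !mulmxA PP PQ.
  by rewrite !mulmx0 !mul0mx add0r addr0 addrC.
move=> Y [YH YT].
have PYP : P *m Y *m P = 0.
  apply: (addrI (P *m Y *m P)); rewrite addr0 -[in RHS]YT.
  by rewrite mulmxDr mulmxDl !mulmxA PP -(mulmxA _ P P) PP.
have QYQ : Q *m Y *m Q = 0.
  by rewrite -YT mulmxDr mulmxDl -!mulmxA PQ !mulmx0 add0r mulmxA QP mul0mx.
have -> : X - (P *m X *m Q + Q *m X *m P) = P *m X *m P + Q *m X *m Q.
  have XE : X = P *m X *m P + P *m X *m Q + (Q *m X *m P + Q *m X *m Q).
    by rewrite -!mulmxDr PQ1 !mulmx1 -mulmxDl PQ1 mul1mx.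
  rewrite [X in X - _]XE.
  by rewrite [P *m X *m P + _]addrC addrACA [LHS]addrC addKr.
have trE A : \tr (A *m X *m A *m Y) = \tr (X *m (A *m Y *m A)).
  by rewrite -!mulmxA mxtrace_mulC -!mulmxA.
rewrite /gmet YH mulmxDl mxtraceD !trE PYP QYQ !mulmx0 !mxtrace0 addr0.
by rewrite mul0r.
Qed.

(** * Riemannian distance and tubes *)

Definition gr2_curve (R : realType) (n : nat) (P Q : 'M[R[i]]_n)
    (gam : R -> 'M[R[i]]_n) : Prop :=
  [/\ mx_Ck 1 [set: R] gam, forall t, 0 <= t <= 1 -> gr2 (gam t),
      gam 0 = P & gam 1 = Q].

Definition curve_length (R : realType) (n : nat) (gam : R -> 'M[R[i]]_n) :
    \bar R :=
  (\int[lebesgue_measure]_(t in `[0%R, 1%R])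
    (Num.sqrt (gmet (mx_derive gam t 1) (mx_derive gam t 1)))%:E)%E.

Definition rdist (R : realType) (n : nat) (P Q : 'M[R[i]]_n) : \bar R :=
  ereal_inf [set curve_length gam | gam in gr2_curve P Q].

Definition rdist_set (R : realType) (n : nat) (P : 'M[R[i]]_n)
    (S : set 'M[R[i]]_n) : \bar R :=
  ereal_inf [set rdist P Q | Q in S].

Definition sub_gr2 (R : realType) (n : nat) (H : 'M[R[i]]_n) :
    set 'M[R[i]]_n :=
  [set P | gr2 P /\ (P <= H)%MS].

Definition tube (R : realType) (n : nat) (S : set 'M[R[i]]_n) (r : R) :
    set 'M[R[i]]_n :=
  [set P | gr2 P /\ rdist_set P S = r%:E].

Definition open_part (R : realType) (n : nat) (T S : set 'M[R[i]]_n) : Prop :=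
  S `<=` T /\
  forall P, S P -> exists2 e : R, 0 < e &
    forall Q, T Q -> (rdist P Q < e%:E)%E -> S Q.

(** * Real hypersurfaces *)

(* The real dimension of G_2(C^(m+2)) is 4m. The induced metric is the only
   Riemannian metric considered on M. *)
Definition real_hypersurface (R : realType) (m : nat) (M : topologicalType)
    (atl : set (chart R (4 * m).-1 M)) (f : M -> 'M[R[i]]_m.+2) : Prop :=
  [/\ smooth_manifold atl, forall p, gr2 (f p), mx_smooth atl f &
      forall c p u, atl c -> chart_dom c p -> mx_dir f c p u = 0 -> u = 0].

Section Hypersurface.
Variables (R : realType) (d n : nat) (M : topologicalType).
Variables (atl : set (chart R d M)) (f N : M -> 'M[R[i]]_n).

(* Tangent spaces of M are identified with their images under df. *)
Definition tangent (p : M) : set 'M[R[i]]_n :=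
  [set X | exists c u, [/\ atl c, chart_dom c p & X = mx_dir f c p u]].

Definition unit_normal : Prop :=
  mx_smooth atl N /\
  forall p, [/\ gr2_tangent (f p) (N p), gmet (N p) (N p) = 1 &
                forall X, tangent p X -> gmet (N p) X = 0].

(* For the metric induced from the Euclidean space of Hermitian matrices, the
   Levi-Civita derivative of a vector field along f is the tangential projection
   of its ambient derivative. *)
Definition nabla (Y : M -> 'M[R[i]]_n) (c : chart R d M) (p : M)
    (u : 'rV[R]_d) : 'M[R[i]]_n :=
  tanproj (f p) (mx_dir Y c p u).

(* A X for X the tangent vector with coordinates u in the chart c. *)
Definition shape_op (c : chart R d M) (p : M) (u : 'rV[R]_d) : 'M[R[i]]_n :=
  - nabla N c p u.

Definition reeb (p : M) : 'M[R[i]]_n := - kahlerJ (f p) (N p).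

Definition Dperp (p : M) : set 'M[R[i]]_n :=
  [set Y | exists2 q, su_plane (f p) q & Y = quatJ (f p) q (N p)].

Definition Ddist (p : M) : set 'M[R[i]]_n :=
  [set X | tangent p X /\ forall Y, Dperp p Y -> gmet X Y = 0].

Definition shape_preserves_D : Prop :=
  forall c p u, atl c -> chart_dom c p ->
    Ddist p (mx_dir f c p u) -> Ddist p (shape_op c p u).

End Hypersurface.

(* Main.v *)
(** Write [P] for the orthogonal projection onto the plane of a point of M and
    [L] for the unit normal divided by sqrt 2. That the Reeb field lies in
    D^perp says that [L] exchanges a unit vector [e] of the plane with a unit
    vector [f] orthogonal to it: P = e^*e + e'^*e' and L = e^*f + f^*e. That A
    preserves D is a linear relation between the first derivatives of [P] and
    [L]; differentiating it and using the symmetry of second derivatives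
    (Codazzi) gives e dL = l f dL modulo e and f, for a real number l <> 0.
    Differentiating this in turn shows that l and the line spanned by f - l e
    are locally constant, hence constant. If w is a unit vector of that line,
    the height h(P) = |w P|^2 is the constant s = l^2 / (1 + l^2).

    Take for H the orthogonal complement of w. The distance from Q to the planes
    contained in H is acos (1 - 2 h(Q)) / (2 sqrt 2) when 0 < h(Q) < 1: the
    derivative of h along a curve is bounded by Cauchy-Schwarz, and rotating the
    projection of w to Q inside the span of w and Q attains the bound.

    Finally M is open in the level set h = s. If Q is a point of it close to a
    point of M and P is the point of M nearest to Q, then Q - P is a multiple of
    the normal up to terms of second order, and h(Q) = h(P) makes the multiple
    of second order as well; so |Q - P| <= C |Q - P|^2 and Q = P. *)
Require Import Defs.
From HB Require Import structures.
From mathcomp Require Import all_boot all_order all_algebra.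
From mathcomp Require Import all_classical all_reals all_analysis.
From mathcomp Require Import complex ring lra.
Set Implicit Arguments.
Unset Strict Implicit.
Unset Printing Implicit Defensive.
Import Order.TTheory GRing.Theory Num.Theory.
Import numFieldNormedType.Exports.
Local Open Scope classical_set_scope.
Local Open Scope ring_scope.
Local Open Scope complex_scope.
Local Open Scope sesquilinear_scope.

(** * Calculus of real and complex matrix-valued maps *)

(** Frames exist only pointwise, as [e] and [f] share a free phase and [e'] has its own. But the
    rank-one projections P L^2 = e^*e and P - P L^2 = e'^*e' are polynomial in [P] and [L]; applied
    to fixed vectors they give twice differentiable frames that are not normalized. In these terms D
    is the common kernel of three real forms, the imaginary part of <de, f> and both parts of <df,
    e'>; the real part of <de, f> vanishes by normality. Invariance of D makes <de, e'> a
    combination of the three. Its coefficients are not known to be differentiable, so the relation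
    is differentiated at vectors of D only, where Cramer's rule asks just for continuity.
    Antisymmetrizing in two directions removes the second derivatives; since [P] and [L] take values
    in a flat space of matrices, no curvature term has to be computed. The resulting identity can be
    solved because de and de' may be prescribed independently in the complement of [e], [e'], [f],
    which is nonzero as m > 1. The number l is found point by point, so its differentiability must
    be recovered from the relation it satisfies. *)

Section RealCalculus.
Context {R : realType} {V : normedModType R}.
Implicit Types (h : V -> R) (x v w : V).

Lemma is_derive_line h a v (s : R) :
  derivable h (a + s *: v) v ->
  is_derive s (1 : R) (fun s : R => h (a + s *: v)) ('D_v h (a + s *: v)).
Proof.
move=> dh.
suff E : (fun t : R => t^-1 *: (h (a + (t *: 1 + s) *: v) - h (a + s *: v))) =
  (fun t => t^-1 *: (h (t *: v + (a + s *: v)) - h (a + s *: v))).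
  by split; rewrite /derivable /derive /= E.
by apply/funext => t; rewrite [t *: 1]mulr1 scalerDl addrCA.
Qed.

Lemma differentiable_near h x : differentiable h x ->
  forall e : R, 0 < e -> exists2 r : R, 0 < r &
    forall y, `|y| < r -> `|h (x + y) - h x - 'D_y h x| <= e * `|y|.
Proof.
move=> dh e e0.
have /eqaddoP := diff_locally dh.
move=> /(_ e e0) /nbhs_normP[r /= r0 H].
exists r => // y yr.
have := H y; rewrite /= sub0r normrN => /(_ yr).
rewrite deriveE// -addrA -opprD [x + y]addrC; exact: id.
Qed.

(* Young's theorem; the second difference of [h] along [v] and [w] is
   symmetric in [v] and [w]. *)
Lemma second_difference (U : set V) h x v w : open U -> U x ->
  (forall z, U z -> differentiable h z) ->
  differentiable (fun z => 'D_v h z) x ->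
  forall e : R, 0 < e -> exists2 r : R, 0 < r & forall t : R, 0 < t < r ->
   `|h (x + t *: v + t *: w) - h (x + t *: v) - (h (x + t *: w) - h x)
     - t ^+ 2 * 'D_w (fun z => 'D_v h z) x| <= e * t ^+ 2.
Proof.
move=> oU Ux dh dk e e0.
set k := fun z => 'D_v h z.
(* Two first-order remainders are taken, at increments of norm at most t S each, hence 2 S; the 1
   keeps C positive and the comparison of t S with t C strict. *)
pose S := `|v| + `|w|; pose C := 2 * S + 1.
have S0 : 0 <= S by rewrite addr_ge0.
have C0 : 0 < C by rewrite ltr_wpDl// mulr_ge0.
have [r r0 Hr] := differentiable_near dk (divr_gt0 e0 C0).
have [r' /= r'0 Hr'] := open_subball oU Ux.
have [r2 r20 Hr2] : exists2 r2, 0 < r2 & forall y, `|y| < r2 -> U (x + y).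
  exists (r' / 2); first by rewrite divr_gt0.
  move=> y yr; apply: (Hr' (r' / 2)) => //=.
  - by rewrite sub0r normrN gtr0_norm ?divr_gt0// ltr_pdivrMr// ltr_pMr// ltr1n.
  - by rewrite divr_gt0.
  - by rewrite -ball_normE /= opprD addrA subrr sub0r normrN.
exists (Num.min r r2 / C).
  by rewrite divr_gt0// lt_min r0 r20.
move=> t /andP[t0]; rewrite ltr_pdivlMr// lt_min => /andP[tr tr2].
have Hb (s q : R) : 0 <= s <= t -> 0 <= q <= t ->
    `|s *: v + q *: w| <= t * S.
  move=> /andP[s0 st] /andP[q0 qt]; rewrite (le_trans (ler_normD _ _))//.
  by rewrite !normrZ !ger0_norm// mulrDr lerD// ler_wpM2r.
have tC : t * S < t * C by rewrite ltr_pM2l// /C; lra.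
have HbU s q : 0 <= s <= t -> 0 <= q <= t -> U (x + (s *: v + q *: w)).
  by move=> hs hq; apply: Hr2; rewrite (le_lt_trans (Hb _ _ hs hq))// (lt_trans tC).
pose g (s : R) := h (x + t *: w + s *: v) - h (x + s *: v).
pose dg (s : R) := k (x + t *: w + s *: v) - k (x + s *: v).
have gD s : 0 <= s <= t -> is_derive s (1 : R) g (dg s).
  move=> hs; apply: is_deriveB; apply: is_derive_line; apply: diff_derivable;
    apply: dh.
  - by rewrite -addrA [t *: w + _]addrC; apply: HbU => //; rewrite lexx ltW.
  - rewrite -[s *: v]addr0 -(scale0r w); apply: HbU => //.
    by rewrite lexx ltW.
have [c] : exists2 c, c \in `]0, t[%R & g t - g 0 = dg c * (t - 0).
  apply: MVT => //.
    by move=> s; rewrite in_itv/= => /andP[s0 st]; apply: gD; rewrite !ltW.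
  apply: derivable_within_continuous => s; rewrite in_itv/= => /gD H.
  by case: H.
rewrite in_itv/= subr0 => /andP[c0 ct] gE.
have -> : h (x + t *: v + t *: w) - h (x + t *: v) - (h (x + t *: w) - h x) =
    dg c * t.
  by rewrite -gE /g scale0r !addr0 [x + t *: v + _]addrAC.
have ct' : 0 <= c <= t by rewrite !ltW.
have t0' : 0 <= t <= t by rewrite lexx ltW.
have z0' : 0 <= (0 : R) <= t by rewrite lexx ltW.
have B1 := Hb _ _ ct' t0'.
have B2 := Hb _ _ ct' z0'.
rewrite scale0r addr0 in B2.
have trC : t * C < r by [].
have H1 := Hr _ (le_lt_trans B1 (lt_trans tC trC)).
have H2 := Hr _ (le_lt_trans B2 (lt_trans tC trC)).
have lin : 'D_(c *: v + t *: w) (fun z => 'D_v h z) x -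
    'D_(c *: v) (fun z => 'D_v h z) x = t * 'D_w (fun z => 'D_v h z) x.
  by rewrite !deriveE// linearD [_ + 'd _ _ (t *: w)]addrC addrK linearZ.
have -> : dg c * t - t ^+ 2 * 'D_w (fun z => 'D_v h z) x =
  t * ((k (x + (c *: v + t *: w)) - k x -
         'D_(c *: v + t *: w) (fun z => 'D_v h z) x)
     - (k (x + c *: v) - k x - 'D_(c *: v) (fun z => 'D_v h z) x)).
  rewrite expr2 -[t * t * _]mulrA -lin /dg [c *: v + _]addrC addrA.
  move: (k _) (k _) (k x) (derive _ _ _) (derive _ _ _) => k1 k2 k3 k4 k5.
  by rewrite mulrC; congr (_ * _ - _) || ring.
rewrite normrM (gtr0_norm t0) expr2 mulrCA ler_pM2l//.
rewrite (le_trans (ler_normB _ _))// (le_trans (lerD H1 H2))//.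
rewrite -mulrDr mulrAC ler_pdivrMr// -mulrA ler_pM2l//.
apply: le_trans (lerD B1 B2) _; have -> : t * C = t * S + t * S + t by rewrite /C; ring.
by rewrite lerDl ltW.
Qed.

Lemma young (U : set V) h x v w : open U -> U x ->
  (forall z, U z -> differentiable h z) ->
  differentiable (fun z => 'D_v h z) x ->
  differentiable (fun z => 'D_w h z) x ->
  'D_w (fun z => 'D_v h z) x = 'D_v (fun z => 'D_w h z) x.
Proof.
move=> oU Ux dh dv dw; apply/eqP; rewrite -subr_eq0 -normr_eq0; apply/eqP.
apply/le_anti; rewrite normr_ge0 andbT; apply/ler_addgt0Pl => e e0.
rewrite addr0.
have e20 : 0 < e / 2 by rewrite divr_gt0.
have [r1 r10 H1] := @second_difference U h x v w oU Ux dh dv _ e20.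
have [r2 r20 H2] := @second_difference U h x w v oU Ux dh dw _ e20.
pose t := Num.min r1 r2 / 2.
have m0 : 0 < Num.min r1 r2 by rewrite lt_min r10.
have t0 : 0 < t by rewrite divr_gt0.
have tm : t < Num.min r1 r2 by rewrite /t; lra.
have /andP[t1 t2] : (t < r1) && (t < r2) by rewrite -lt_min.
have {}H1 := H1 t; have {}H2 := H2 t.
rewrite t0 t1 in H1; rewrite t0 t2 in H2.
have {}H1 := H1 isT; have {}H2 := H2 isT.
have t20 : 0 < t ^+ 2 by rewrite exprn_gt0.
rewrite -(ler_pM2l t20) -[X in X * _](gtr0_norm t20) -normrM.
set a := 'D_w _ _ in H1 *; set b := 'D_v (fun z => 'D_w h z) x in H2 *.
move: H1 H2; rewrite [x + t *: w + _]addrAC.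
set h1 := h (x + t *: v + t *: w); set h2 := h (x + t *: v).
set h3 := h (x + t *: w); set h4 := h x => H1 H2.
have -> : t ^+ 2 * (a - b) = (h1 - h3 - (h2 - h4) - t ^+ 2 * b) -
  (h1 - h2 - (h3 - h4) - t ^+ 2 * a) by ring.
rewrite (le_trans (ler_normB _ _))// (le_trans (lerD H2 H1))//.
by rewrite -mulrDl -splitr mulrC.
Qed.

End RealCalculus.

Lemma cReM (R : realType) (a b : R[i]) :
  complex.Re (a * b) =
  complex.Re a * complex.Re b - complex.Im a * complex.Im b.
Proof. by case: a; case: b. Qed.

Lemma cImM (R : realType) (a b : R[i]) :
  complex.Im (a * b) =
  complex.Re a * complex.Im b + complex.Im a * complex.Re b.
Proof. by case: a; case: b. Qed.

Lemma cRe_sum (R : realType) n (F : 'I_n -> R[i]) :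
  complex.Re (\sum_i F i) = \sum_i complex.Re (F i).
Proof. exact: (raddf_sum (@complex.Re R : Rcomplex R -> R)). Qed.

Lemma cIm_sum (R : realType) n (F : 'I_n -> R[i]) :
  complex.Im (\sum_i F i) = \sum_i complex.Im (F i).
Proof. exact: (raddf_sum (@complex.Im R : Rcomplex R -> R)). Qed.

Lemma cReD (R : realType) (a b : R[i]) :
  complex.Re (a + b) = complex.Re a + complex.Re b.
Proof. by case: a; case: b. Qed.

Lemma cImD (R : realType) (a b : R[i]) :
  complex.Im (a + b) = complex.Im a + complex.Im b.
Proof. by case: a; case: b. Qed.

Lemma cReN (R : realType) (a : R[i]) : complex.Re (- a) = - complex.Re a.
Proof. by case: a. Qed.

Lemma cImN (R : realType) (a : R[i]) : complex.Im (- a) = - complex.Im a.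
Proof. by case: a. Qed.

Lemma cReJ (R : realType) (a : R[i]) : complex.Re (Num.conj a) = complex.Re a.
Proof. by case: a. Qed.

Lemma cImJ (R : realType) (a : R[i]) : complex.Im (Num.conj a) = - complex.Im a.
Proof. by case: a. Qed.

Lemma cReZ (R : realType) (a : R) (b : R[i]) :
  complex.Re (a%:C * b) = a * complex.Re b.
Proof. by rewrite cReM /= mul0r subr0. Qed.

Lemma cImZ (R : realType) (a : R) (b : R[i]) :
  complex.Im (a%:C * b) = a * complex.Im b.
Proof. by rewrite cImM /= mul0r addr0. Qed.

Lemma complex_eq (R : realType) (a b : R[i]) :
  complex.Re a = complex.Re b -> complex.Im a = complex.Im b -> a = b.
Proof. by case: a; case: b => /= ? ? ? ? -> ->. Qed.

Section Adjoint.
Context {C : numClosedFieldType}.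

Lemma hcM p q r (A : 'M[C]_(p, q)) (B : 'M[C]_(q, r)) :
  (A *m B) ^t* = B ^t* *m A ^t*.
Proof. by rewrite trmx_mul map_mxM. Qed.

Lemma hcD p q (A B : 'M[C]_(p, q)) : (A + B) ^t* = A ^t* + B ^t*.
Proof. by rewrite linearD /= map_mxD. Qed.

Lemma hcN p q (A : 'M[C]_(p, q)) : (- A) ^t* = - A ^t*.
Proof. by rewrite linearN /= map_mxN. Qed.

Lemma hcB p q (A B : 'M[C]_(p, q)) : (A - B) ^t* = A ^t* - B ^t*.
Proof. by rewrite hcD hcN. Qed.

Lemma hcK p q (A : 'M[C]_(p, q)) : (A ^t*) ^t* = A.
Proof. exact: trmxCK. Qed.

Lemma hcZ p q (c : C) (A : 'M[C]_(p, q)) :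
  (c *: A) ^t* = Num.conj c *: A ^t*.
Proof. by rewrite linearZ /= map_mxZ. Qed.

Lemma hc1 n : (1%:M : 'M[C]_n) ^t* = 1%:M.
Proof. by rewrite trmx1 map_mx1. Qed.

Lemma hc0 p q : (0 : 'M[C]_(p, q)) ^t* = 0.
Proof. by rewrite trmx0 map_mx0. Qed.

Lemma hcE p q (A : 'M[C]_(p, q)) i j : (A ^t*) i j = Num.conj (A j i).
Proof. by rewrite !mxE. Qed.

End Adjoint.

Section MatrixCalculus.
Context {R : realType} {V : normedModType R}.
Local Notation C := R[i].

(* [dmx F x v] is meaningful only if [mxd F x v F'] holds for some [F']. *)
Definition mxd p q (F : V -> 'M[C]_(p, q)) (x v : V) (F' : 'M[C]_(p, q)) :=
  forall i j,
    is_derive x v (fun z => complex.Re (F z i j)) (complex.Re (F' i j)) /\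
    is_derive x v (fun z => complex.Im (F z i j)) (complex.Im (F' i j)).

Definition dmx p q (F : V -> 'M[C]_(p, q)) (x v : V) : 'M[C]_(p, q) :=
  locked (\matrix_(i, j) ('D_v (fun z => complex.Re (F z i j)) x +i*
                          'D_v (fun z => complex.Im (F z i j)) x)).

Lemma dmxE p q (F : V -> 'M[C]_(p, q)) x v i j :
  dmx F x v i j = 'D_v (fun z => complex.Re (F z i j)) x +i*
                  'D_v (fun z => complex.Im (F z i j)) x.
Proof. by rewrite /dmx -lock mxE. Qed.

Lemma mxd_dmx p q (F : V -> 'M[C]_(p, q)) x v F' :
  mxd F x v F' -> dmx F x v = F'.
Proof.
move=> H; apply/matrixP => i j; have [Hr Hi] := H i j.
by rewrite dmxE !derive_val; case: (F' i j).
Qed.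

Lemma dmxP p q (F : V -> 'M[C]_(p, q)) x v F' :
  mxd F x v F' -> mxd F x v (dmx F x v).
Proof. by move=> H; rewrite (mxd_dmx H). Qed.

Lemma mxd_uniq p q (F : V -> 'M[C]_(p, q)) x v F' F'' :
  mxd F x v F' -> mxd F x v F'' -> F' = F''.
Proof. by move=> /mxd_dmx <- /mxd_dmx <-. Qed.

Lemma mxd_cst p q (A : 'M[C]_(p, q)) x v : mxd (fun=> A) x v 0.
Proof. by move=> i j; rewrite mxE; split; exact: is_derive_cst. Qed.

Lemma mxdD p q (F G : V -> 'M[C]_(p, q)) x v F' G' :
  mxd F x v F' -> mxd G x v G' -> mxd (fun z => F z + G z) x v (F' + G').
Proof.
move=> HF HG i j; have [Fr Fi] := HF i j; have [Gr Gi] := HG i j.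
rewrite mxE cReD cImD; split.
  rewrite (_ : (fun _ => _) = (fun z => complex.Re (F z i j)) + (fun z => complex.Re (G z i j))).
    exact: is_deriveD.
  by apply/funext => z; rewrite mxE cReD.
rewrite (_ : (fun _ => _) = (fun z => complex.Im (F z i j)) + (fun z => complex.Im (G z i j))).
  exact: is_deriveD.
by apply/funext => z; rewrite mxE cImD.
Qed.

Lemma mxdM p q r (F : V -> 'M[C]_(p, q)) (G : V -> 'M[C]_(q, r)) x v F' G' :
  mxd F x v F' -> mxd G x v G' ->
  mxd (fun z => F z *m G z) x v (F' *m G x + F x *m G').
Proof.
move=> HF HG i j.
pose Fr k z := complex.Re (F z i k); pose Fi k z := complex.Im (F z i k).
pose Gr k z := complex.Re (G z k j); pose Gi k z := complex.Im (G z k j).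
pose fr k := complex.Re (F' i k); pose fi k := complex.Im (F' i k).
pose gr k := complex.Re (G' k j); pose gi k := complex.Im (G' k j).
have dFr k : is_derive x v (Fr k) (fr k) by have [] := HF i k.
have dFi k : is_derive x v (Fi k) (fi k) by have [] := HF i k.
have dGr k : is_derive x v (Gr k) (gr k) by have [] := HG k j.
have dGi k : is_derive x v (Gi k) (gi k) by have [] := HG k j.
split.
  have := is_derive_sum (fun k => is_deriveB (is_deriveM (dFr k) (dGr k))
    (is_deriveM (dFi k) (dGi k))).
  have -> : \sum_(k < q) (Fr k * Gr k - Fi k * Gi k) =
      (fun z => complex.Re ((F z *m G z) i j)).
    by apply/funext => z; rewrite fct_sumE mxE cRe_sum; apply: eq_bigr => k _;
      rewrite cReM.
  congr (is_derive _ _ _ _).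
  rewrite !mxE cReD !cRe_sum -big_split; apply: eq_bigr => k _ /=.
  rewrite !cReM -/(Fr k x) -/(Gr k x) -/(Fi k x) -/(Gi k x)
    -/(fr k) -/(fi k) -/(gr k) -/(gi k) /GRing.scale /=.
  move: (Fr k x) (Fi k x) (Gr k x) (Gi k x) (fr k) (fi k) (gr k) (gi k).
  by move=> a b c d a1 b1 c1 d1; ring.
have := is_derive_sum (fun k => is_deriveD (is_deriveM (dFr k) (dGi k))
  (is_deriveM (dFi k) (dGr k))).
have -> : \sum_(k < q) (Fr k * Gi k + Fi k * Gr k) =
    (fun z => complex.Im ((F z *m G z) i j)).
  by apply/funext => z; rewrite fct_sumE mxE cIm_sum; apply: eq_bigr => k _;
    rewrite cImM.
congr (is_derive _ _ _ _).
rewrite !mxE cImD !cIm_sum -big_split; apply: eq_bigr => k _ /=.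
rewrite !cImM -/(Fr k x) -/(Gr k x) -/(Fi k x) -/(Gi k x)
  -/(fr k) -/(fi k) -/(gr k) -/(gi k) /GRing.scale /=.
move: (Fr k x) (Fi k x) (Gr k x) (Gi k x) (fr k) (fi k) (gr k) (gi k).
by move=> a b c d a1 b1 c1 d1; ring.
Qed.

Lemma mxd_hc p q (F : V -> 'M[C]_(p, q)) x v F' :
  mxd F x v F' -> mxd (fun z => (F z) ^t*) x v (F' ^t*).
Proof.
move=> H i j; have [Hr Hi] := H j i; rewrite hcE cReJ cImJ; split.
  rewrite (_ : (fun _ => _) = (fun z => complex.Re (F z j i)))//.
  by apply/funext => z; rewrite hcE cReJ.
rewrite (_ : (fun _ => _) = - (fun z => complex.Im (F z j i))).
  exact: is_deriveN.
by apply/funext => z; rewrite hcE cImJ.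
Qed.

Lemma mxdZ p q (c : C) (F : V -> 'M[C]_(p, q)) x v F' :
  mxd F x v F' -> mxd (fun z => c *: F z) x v (c *: F').
Proof.
move=> /(mxdM (mxd_cst c%:M x v)); rewrite mul0mx add0r mul_scalar_mx.
by rewrite (_ : (fun _ => _) = (fun z => c *: F z))//; apply/funext => z;
  rewrite mul_scalar_mx.
Qed.

Lemma mxdN p q (F : V -> 'M[C]_(p, q)) x v F' :
  mxd F x v F' -> mxd (fun z => - F z) x v (- F').
Proof.
move=> /(mxdZ (-1)); rewrite scaleN1r.
by rewrite (_ : (fun _ => _) = (fun z => - F z))//; apply/funext => z;
  rewrite scaleN1r.
Qed.

Lemma mxdB p q (F G : V -> 'M[C]_(p, q)) x v F' G' :
  mxd F x v F' -> mxd G x v G' -> mxd (fun z => F z - G z) x v (F' - G').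
Proof. by move=> HF /mxdN; exact: mxdD. Qed.

Lemma mxd_near p q (F G : V -> 'M[C]_(p, q)) x v F' :
  (\forall z \near x, F z = G z) -> mxd F x v F' -> mxd G x v F'.
Proof.
move=> FG H i j; have [Hr Hi] := H i j.
by split; [apply: near_eq_is_derive Hr|apply: near_eq_is_derive Hi];
  apply: filterS FG => z ->.
Qed.

(** Directional derivatives instead of Fréchet ones: this is what the argument consumes, and it is
    stable under sums, products and adjoints. Young's theorem is then applied only once, in
    [smooth_twice]. *)
Definition twice p q (U : set V) (F : V -> 'M[C]_(p, q)) :=
  forall x, U x -> [/\
    forall u, mxd F x u (dmx F x u),
    forall u v, mxd (fun z => dmx F z u) x v (dmx (fun z => dmx F z u) x v),
    forall u v, dmx (fun z => dmx F z u) x v = dmx (fun z => dmx F z v) x u &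
    forall (a : R) u v, dmx F x (a *: u + v) = a%:C *: dmx F x u + dmx F x v].

Context (U : set V) (oU : open U).

Lemma near_open x (P : V -> Prop) : U x -> (forall z, U z -> P z) ->
  \forall z \near x, P z.
Proof. by move=> Ux H; apply: filterS (open_nbhs_nbhs (conj oU Ux)). Qed.

Lemma twice_cst p q (A : 'M[C]_(p, q)) : twice U (fun=> A).
Proof.
have E u z : dmx (fun=> A) z u = 0 by exact/mxd_dmx/mxd_cst.
have E' u : (fun z => dmx (fun=> A) z u) = fun=> 0 by apply/funext => z.
have E0 v x : dmx (fun=> 0 : 'M[C]_(p, q)) x v = 0 by exact/mxd_dmx/mxd_cst.
move=> x Ux; split=> [u|u v|u v|a u v]; rewrite ?E' ?E ?E0//.
- exact: mxd_cst.
- exact: mxd_cst.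
- by rewrite scaler0 addr0.
Qed.

Lemma twiceD p q (F G : V -> 'M[C]_(p, q)) :
  twice U F -> twice U G -> twice U (fun z => F z + G z).
Proof.
move=> HF HG.
have E z u : U z -> dmx (fun z => F z + G z) z u = dmx F z u + dmx G z u.
  by move=> Uz; have [HF1 _ _ _] := HF z Uz; have [HG1 _ _ _] := HG z Uz;
    exact/mxd_dmx/mxdD.
have S z u v : U z -> mxd (fun z => dmx (fun z => F z + G z) z u) z v
    (dmx (fun z => dmx F z u) z v + dmx (fun z => dmx G z u) z v).
  move=> Uz; have [_ HF1 _ _] := HF z Uz; have [_ HG1 _ _] := HG z Uz.
  apply: mxd_near (mxdD (HF1 u v) (HG1 u v)).
  by apply: near_open => // t Ut; rewrite E.
move=> x Ux; have [HF1 HF2 HF3 HF4] := HF x Ux.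
have [HG1 HG2 HG3 HG4] := HG x Ux; split=> [u|u v|u v|a u v].
- by rewrite E//; exact: mxdD.
- exact: dmxP (S _ _ _ Ux).
- exact: etrans (mxd_dmx (S x u v Ux)) (etrans (f_equal2 +%R (HF3 u v) (HG3 u v))
    (esym (mxd_dmx (S x v u Ux)))).
- by rewrite !E// HF4 HG4 scalerDr addrACA.
Qed.

Lemma dmxM p q r (F : V -> 'M[C]_(p, q)) (G : V -> 'M[C]_(q, r)) z u :
  twice U F -> twice U G -> U z ->
  dmx (fun z => F z *m G z) z u = dmx F z u *m G z + F z *m dmx G z u.
Proof.
move=> HF HG Uz; have [HF1 _ _ _] := HF z Uz; have [HG1 _ _ _] := HG z Uz.
exact/mxd_dmx/mxdM.
Qed.

Lemma twiceM p q r (F : V -> 'M[C]_(p, q)) (G : V -> 'M[C]_(q, r)) :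
  twice U F -> twice U G -> twice U (fun z => F z *m G z).
Proof.
move=> HF HG.
have swap (a a' f f1 f2 : 'M[C]_(p, q)) (b b' g g1 g2 : 'M[C]_(q, r)) :
    a = a' -> b = b' ->
    (a *m g + f1 *m g2) + (f2 *m g1 + f *m b) =
    (a' *m g + f2 *m g1) + (f1 *m g2 + f *m b').
  by move=> -> ->; rewrite addrACA.
have S z u v : U z -> mxd (fun z => dmx (fun z => F z *m G z) z u) z v
    ((dmx (fun z => dmx F z u) z v *m G z + dmx F z u *m dmx G z v) +
     (dmx F z v *m dmx G z u + F z *m dmx (fun z => dmx G z u) z v)).
  move=> Uz; have [HF0 HF1 _ _] := HF z Uz; have [HG0 HG1 _ _] := HG z Uz.
  apply: mxd_near (mxdD (mxdM (HF1 u v) (HG0 v)) (mxdM (HF0 v) (HG1 u v))).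
  by apply: near_open => // t Ut; rewrite dmxM.
move=> x Ux; have [HF1 HF2 HF3 HF4] := HF x Ux.
have [HG1 HG2 HG3 HG4] := HG x Ux; split=> [u|u v|u v|a u v].
- by rewrite dmxM//; exact: mxdM.
- exact: dmxP (S _ _ _ Ux).
- exact: etrans (mxd_dmx (S x u v Ux)) (etrans (swap _ _ _ _ _ _ _ _ _ _ (HF3 u v) (HG3 u v))
    (esym (mxd_dmx (S x v u Ux)))).
- rewrite !dmxM// HF4 HG4 mulmxDl mulmxDr -scalemxAl -scalemxAr scalerDr.
  by rewrite addrACA.
Qed.

Lemma twice_hc p q (F : V -> 'M[C]_(p, q)) :
  twice U F -> twice U (fun z => (F z) ^t*).
Proof.
move=> HF.
have E z u : U z -> dmx (fun z => (F z) ^t*) z u = (dmx F z u) ^t*.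
  by move=> Uz; have [HF1 _ _ _] := HF z Uz; exact/mxd_dmx/mxd_hc.
have S z u v : U z -> mxd (fun z => dmx (fun z => (F z) ^t*) z u) z v
    ((dmx (fun z => dmx F z u) z v) ^t*).
  move=> Uz; have [_ HF1 _ _] := HF z Uz.
  by apply: mxd_near (mxd_hc (HF1 u v)); apply: near_open => // t Ut; rewrite E.
move=> x Ux; have [HF1 HF2 HF3 HF4] := HF x Ux; split=> [u|u v|u v|a u v].
- by rewrite E//; exact: mxd_hc.
- exact: dmxP (S _ _ _ Ux).
- exact: etrans (mxd_dmx (S x u v Ux)) (etrans (f_equal (fun A => A ^t*) (HF3 u v))
    (esym (mxd_dmx (S x v u Ux)))).
- rewrite !E// HF4 hcD hcZ; congr (_ *: _ + _).
  by apply: complex_eq; rewrite ?cReJ ?cImJ//= oppr0.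
Qed.

Lemma twiceZ p q (c : C) (F : V -> 'M[C]_(p, q)) :
  twice U F -> twice U (fun z => c *: F z).
Proof.
move=> /(twiceM (twice_cst c%:M)).
by rewrite (_ : (fun _ => _) = (fun z => c *: F z))//; apply/funext => z;
  rewrite mul_scalar_mx.
Qed.

Lemma twiceN p q (F : V -> 'M[C]_(p, q)) :
  twice U F -> twice U (fun z => - F z).
Proof.
move=> /(twiceZ (-1)).
by rewrite (_ : (fun _ => _) = (fun z => - F z))//; apply/funext => z;
  rewrite scaleN1r.
Qed.

Lemma twiceB p q (F G : V -> 'M[C]_(p, q)) :
  twice U F -> twice U G -> twice U (fun z => F z - G z).
Proof. by move=> HF /twiceN; exact: twiceD. Qed.

Lemma smooth_twice n (F : V -> 'M[C]_n) : mx_smooth_on U F -> twice U F.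
Proof.
move=> sF.
have dR i j z : U z -> differentiable (fun z => complex.Re (F z i j)) z.
  by move=> Uz; have [[/(_ z Uz)]] := sF 1%N i j.
have dI i j z : U z -> differentiable (fun z => complex.Im (F z i j)) z.
  by move=> Uz; have [_ [/(_ z Uz)]] := sF 1%N i j.
have ddR i j z v : U z ->
    differentiable (fun z => 'D_v (fun z => complex.Re (F z i j)) z) z.
  by move=> Uz; have [[_ /(_ v)[/(_ z Uz)]]] := sF 2%N i j.
have ddI i j z v : U z ->
    differentiable (fun z => 'D_v (fun z => complex.Im (F z i j)) z) z.
  by move=> Uz; have [_ [_ /(_ v)[/(_ z Uz)]]] := sF 2%N i j.
have rE u i j : (fun z => complex.Re (dmx F z u i j)) =
    (fun z => 'D_u (fun z => complex.Re (F z i j)) z).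
  by apply/funext => z; rewrite dmxE.
have iE u i j : (fun z => complex.Im (dmx F z u i j)) =
    (fun z => 'D_u (fun z => complex.Im (F z i j)) z).
  by apply/funext => z; rewrite dmxE.
have E a b x i j : dmx (fun z => dmx F z a) x b i j =
    'D_b (fun z => 'D_a (fun z => complex.Re (F z i j)) z) x +i*
    'D_b (fun z => 'D_a (fun z => complex.Im (F z i j)) z) x.
  by rewrite dmxE (rE a i j) (iE a i j).
move=> x Ux; split=> [u|u v|u v|a u v].
- move=> i j; rewrite dmxE /=; split; apply: derivableP; apply: diff_derivable;
    [exact: dR|exact: dI].
- move=> i j; rewrite (E u v x i j) (rE u i j) (iE u i j) /=; split;
    apply: derivableP; apply: diff_derivable; [exact: ddR|exact: ddI].
- apply/matrixP => i j; apply: etrans (E u v x i j) (etrans _ (esym (E v u x i j))).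
  apply: (f_equal2 (@Complex R)).
    exact: (young oU Ux (dR i j) (ddR i j x u Ux) (ddR i j x v Ux)).
  exact: (young oU Ux (dI i j) (ddI i j x u Ux) (ddI i j x v Ux)).
- apply/matrixP => i j; rewrite !(dmxE, mxE).
  have lin h : differentiable h x ->
      'D_(a *: u + v) h x = a * 'D_u h x + 'D_v h x.
    by move=> dh; rewrite !(deriveE _ dh) linearP.
  rewrite (lin _ (dR i j x Ux)) (lin _ (dI i j x Ux)).
  by apply: complex_eq; rewrite ?cReD ?cImD ?cReZ ?cImZ.
Qed.

End MatrixCalculus.

(** * Frames adapted to the normal *)

Section Projections.
Context {C : numClosedFieldType}.

Lemma normalize n (a : 'rV[C]_n) : a != 0 ->
  exists2 c : C, c != 0 & (c *: a) *m (c *: a) ^t* = 1%:M.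
Proof.
move=> a0; pose s := \sum_j `|a 0 j| ^+ 2.
have s0 : 0 < s.
  rewrite lt_neqAle sumr_ge0 ?andbT; last by move=> j _; rewrite exprn_ge0.
  apply: contra a0; rewrite eq_sym psumr_eq0; last first.
    by move=> j _; rewrite exprn_ge0.
  move=> /allP H; apply/eqP/rowP => j; rewrite mxE; apply/eqP.
  by have := H j (mem_index_enum _); rewrite /= expf_eq0 /= normr_eq0.
have aa : a *m a ^t* = s%:M.
  apply/matrixP => i j; rewrite !ord1 !mxE eqxx mulr1n.
  by apply: eq_bigr => k _; rewrite hcE normCK.
exists (sqrtC s)^-1; first by rewrite invr_eq0 sqrtC_eq0 gt_eqF.
rewrite hcZ -scalemxAl -scalemxAr aa scalerA scale_scalar_mx.
rewrite geC0_conj ?invr_ge0 ?sqrtC_ge0 ?ltW//.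
by rewrite -invfM -expr2 sqrtCK mulVf ?gt_eqF.
Qed.

(** In the rank factorization P = col_base * row_base, idempotence forces row_base * col_base = 1,
    an identity of size the rank. *)
Lemma tr_idem n (P : 'M[C]_n) : P *m P = P -> \tr P = (\rank P)%:R.
Proof.
move=> PP; have E := mulmx_base P.
have H : row_base P *m col_base P = 1%:M.
  have cf := row_base_free P.
  have rf := col_base_full P.
  apply: (row_free_inj cf); apply: (row_full_inj rf).
  by rewrite mul1mx -[_ *m _ *m row_base P]mulmxA E mulmxA E PP.
by rewrite -{1}E mxtrace_mulC H mxtrace1.
Qed.

Lemma rank1_proj n (G : 'M[C]_n) : G ^t* = G -> G *m G = G -> \tr G = 1 ->
  exists2 e : 'rV[C]_n, e *m e ^t* = 1%:M & G = e ^t* *m e.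
Proof.
move=> GH GG Gt.
have r1 : \rank G = 1%N.
  have := tr_idem GG; rewrite Gt => /esym/eqP; rewrite -[1]/(1%:R) eqr_nat.
  by move/eqP.
have [c [a E]] : exists (c : 'cV[C]_n) (a : 'rV[C]_n), G = c *m a.
  have := mulmx_base G; move: (col_base G) (row_base G); rewrite r1 => c a <-.
  by exists c, a.
have a0 : a != 0.
  by apply: contra_eqN r1 => /eqP a0; rewrite E a0 mulmx0 mxrank0.
have [k k0 ke] := normalize a0; set e := _ *: a in ke.
exists e => //.
pose b := k^-1 *: c.
have E' : G = b *m e.
  by rewrite /b /e -scalemxAl -scalemxAr scalerA mulVf// scale1r.
have eb : e *m b = 1%:M.
  have := Gt; rewrite E' mxtrace_mulC => t.
  by rewrite [e *m b]mx11_scalar -trace_mx11 t.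
have be : b ^t* *m e ^t* = 1%:M by rewrite -hcM eb hc1.
have Gb : G *m e ^t* = b by rewrite E' -mulmxA ke mulmx1.
suff <- : b = e ^t* by [].
by rewrite -[LHS]Gb -GH E' hcM -mulmxA be mulmx1.
Qed.

Definition frame n (P L : 'M[C]_n) (e e' f : 'rV[C]_n) : Prop :=
  [/\ [/\ e *m e ^t* = 1%:M, e' *m e' ^t* = 1%:M & f *m f ^t* = 1%:M],
      [/\ e *m e' ^t* = 0, e *m f ^t* = 0 & e' *m f ^t* = 0],
      P = e ^t* *m e + e' ^t* *m e' & L = e ^t* *m f + f ^t* *m e].

Lemma PNP0 n (P N : 'M[C]_n) : P *m P = P -> N *m P + P *m N = N ->
  P *m N *m P = 0.
Proof.
move=> PP NT; apply: (addrI (P *m N *m P)); rewrite addr0 -[in RHS]NT.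
by rewrite mulmxDr mulmxDl !mulmxA PP -(mulmxA _ P P) PP.
Qed.

(** By the last hypothesis A = q + i P kills P L, while tr A = 2i, so A has a nonzero row;
    normalized, it is a vector e' of the plane with e' L = 0. The rest of the plane is a line
    spanned by e, and f = e L has length one because tr (L L) = 2 |f|^2. *)
Lemma frame_exists n (P L q : 'M[C]_n) : P ^t* = P -> P *m P = P ->
  \rank P = 2%N -> L ^t* = L -> L *m P + P *m L = L -> \tr (L *m L) = 2 ->
  P *m q *m P = q -> \tr q = 0 -> q *m (P *m L) = - ('i *: (P *m L)) ->
  exists e e' f, frame P L e e' f.
Proof.
move=> PH PP Pr LH LT L2 Pq qt qL.
have PLP := PNP0 PP LT.
have trP : \tr P = 2 by rewrite tr_idem// Pr.
pose A := q + 'i *: P.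
have AL : A *m (P *m L) = 0.
  by rewrite mulmxDl qL -scalemxAl mulmxA PP addNr.
have AP : A *m P = A.
  by rewrite mulmxDl -scalemxAl PP -{1}Pq -mulmxA PP Pq.
have A0 : A != 0.
  apply/eqP => A0; have : \tr A = 0 by rewrite A0 mxtrace0.
  rewrite mxtraceD mxtraceZ qt trP add0r => /eqP.
  by rewrite mulf_eq0 pnatr_eq0 orbF (negbTE (neq0Ci _)).
have [i a0] : exists i, row i A != 0.
  apply/existsP; apply: contraNT A0; rewrite negb_exists => /forallP H.
  by apply/eqP/row_matrixP => i; rewrite row0; apply/eqP; have := H i; rewrite negbK.
have [k k0 ke] := normalize a0; set e' := _ *: row i A in ke.
have e'P : e' *m P = e' by rewrite -scalemxAl -row_mul AP.
have e'L : e' *m L = 0.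
  by rewrite -e'P -mulmxA -scalemxAl -row_mul AL row0 scaler0.
have Pe' : P *m e' ^t* = e' ^t* by rewrite -{1}PH -hcM e'P.
pose G := P - e' ^t* *m e'.
have Gt : \tr G = 1.
  rewrite raddfB /= trP mxtrace_mulC ke mxtrace1 //.
  by apply/eqP; rewrite subr_eq.
have GH : G ^t* = G by rewrite hcB PH hcM hcK.
have Ge' : G *m e' ^t* = 0 by rewrite mulmxBl Pe' -mulmxA ke mulmx1 subrr.
have GG : G *m G = G.
  rewrite {2}/G mulmxBr mulmxA Ge' mul0mx subr0 mulmxBl PP.
  by rewrite -mulmxA e'P.
have [e ee Ge] := rank1_proj GH GG Gt.
have eG : e *m G = e by rewrite Ge mulmxA ee mul1mx.
have ee' : e *m e' ^t* = 0 by rewrite -eG -mulmxA Ge' mulmx0.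
have PE : P = e ^t* *m e + e' ^t* *m e' by rewrite -Ge subrK.
have eP : e *m P = e.
  by rewrite PE mulmxDr !mulmxA ee ee' mul1mx mul0mx addr0.
pose f := e *m L; exists e, e', f.
have fP : f *m P = 0.
  by rewrite /f -eP -!mulmxA (mulmxA P) PLP mulmx0.
have orth b : b *m P = b -> b *m f ^t* = 0.
  by move=> bP; rewrite -bP -mulmxA -PH -hcM fP hc0 mulmx0.
have PL : P *m L = e ^t* *m f.
  by rewrite {1}PE mulmxDl -!mulmxA e'L mulmx0 addr0.
have LP : L *m P = f ^t* *m e.
  by rewrite -[LHS]hcK hcM PH LH PL hcM hcK.
have LE : L = e ^t* *m f + f ^t* *m e by rewrite -PL -LP addrC.
have fe : f *m e ^t* = 0 by rewrite -[LHS]hcK hcM hcK orth ?hc0.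
have ef : e *m f ^t* = 0 by exact: orth.
clearbody f.
have ff : f *m f ^t* = 1%:M.
  have : L *m L = e ^t* *m (f *m f ^t*) *m e + f ^t* *m f.
    rewrite {1 2}LE !(mulmxDl, mulmxDr) !mulmxA.
    rewrite -(mulmxA _ f (e ^t*)) fe mulmx0 mul0mx add0r.
    rewrite -(mulmxA _ e (e ^t*)) ee mulmx1.
    by rewrite -(mulmxA _ e (f ^t*)) ef mulmx0 mul0mx addr0.
  move=> /(congr1 mxtrace); rewrite L2 mxtraceD [X in X + _]mxtrace_mulC.
  rewrite [X in _ + X]mxtrace_mulC [e *m _]mulmxA ee mul1mx.
  rewrite [f *m f ^t*]mx11_scalar mxtrace_scalar mulr1n -mulr2n => H.
  congr (_%:M); apply: (@mulIf _ 2); first by rewrite pnatr_eq0.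
  by rewrite mul1r mulr_natr -H.
by split=> //; split=> //; apply: orth.
Qed.

End Projections.

(** * Differentiating a linear form that vanishes on a moving kernel *)

Section KernelDerivative.
Context {R : realType}.

Lemma continuous_bigprod (I : Type) (r : seq I) (F : I -> R -> R) t :
  (forall i, {for t, continuous (F i)}) ->
  {for t, continuous (fun s => \prod_(i <- r) F i s)}.
Proof.
move=> cF; elim: r => [|i r IH].
  rewrite (_ : (fun _ => _) = fun=> 1); first exact: cst_continuous.
  by apply/funext => s; rewrite big_nil.
rewrite (_ : (fun _ => _) = (fun s => F i s * \prod_(i <- r) F i s)).
  by apply: continuousM; [exact: cF|exact: IH].
by apply/funext => s; rewrite big_cons.
Qed.

Lemma continuous_bigsum (I : Type) (r : seq I) (F : I -> R -> R) t :
  (forall i, {for t, continuous (F i)}) ->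
  {for t, continuous (fun s => \sum_(i <- r) F i s)}.
Proof.
move=> cF; elim: r => [|i r IH].
  rewrite (_ : (fun _ => _) = fun=> 0); first exact: cst_continuous.
  by apply/funext => s; rewrite big_nil.
rewrite (_ : (fun _ => _) = (fun s => F i s + \sum_(i <- r) F i s)).
  by apply: continuousD; [exact: cF|exact: IH].
by apply/funext => s; rewrite big_cons.
Qed.

Lemma continuous_det k (M : R -> 'M[R]_k) t :
  (forall i j, {for t, continuous (fun s => M s i j)}) ->
  {for t, continuous (fun s => \det (M s))}.
Proof.
move=> cM; apply: continuous_bigsum => s.
apply: continuousM; first exact: cst_continuous.
by apply: continuous_bigprod => i; exact: cM.
Qed.

(** As f vanishes at 0, the difference quotient of the product is that of f times g, so continuity
    of g suffices. This is what makes undifferentiated Cramer coefficients harmless. *)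
Lemma is_derive_mul0 (f g : R -> R) f' :
  is_derive (0 : R) (1 : R) f f' -> f 0 = 0 -> {for 0, continuous g} ->
  is_derive (0 : R) (1 : R) (fun t => f t * g t) (f' * g 0).
Proof.
move=> [df <-] f0 cg.
have H : (fun h : R => h^-1 *: (f (h *: 1 + 0) * g (h *: 1 + 0) - f 0 * g 0))
    @ 0^' --> 'D_1 f 0 * g 0.
  have -> : (fun h : R => h^-1 *: (f (h *: 1 + 0) * g (h *: 1 + 0) - f 0 * g 0))
    = (fun h : R => h^-1 *: (f (h *: 1 + 0) - f 0) * g h).
    apply/funext => h; rewrite f0 mul0r !subr0 -scalerAl.
    by rewrite [h *: 1]mulr1 addr0.
  apply: cvgM; first exact: df.
  exact: cvg_within_filter cg.
split; first by apply/cvg_ex; eexists; exact: H.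
exact: cvg_lim H.
Qed.

(* Cramer's rule: [psi t u * \det (M t)], where [M t] has entries
   [phi j t (w i)], is a combination of the [phi j t u], and these vanish at
   [t = 0]. *)
Lemma kernel_derive (V : lmodType R) k (phi : 'I_k -> R -> V -> R)
    (psi : R -> V -> R) (w : 'I_k -> V) (u : V) (dphi : 'I_k -> R) (dpsi : R) :
  (\forall t \near (0 : R), [/\
     forall j a x y, phi j t (a *: x + y) = a * phi j t x + phi j t y,
     forall a x y, psi t (a *: x + y) = a * psi t x + psi t y &
     forall x, (forall j, phi j t x = 0) -> psi t x = 0]) ->
  (forall i j, phi j 0 (w i) = (i == j)%:R) ->
  (forall i j, {for 0, continuous (fun t => phi j t (w i))}) ->
  (forall i, {for 0, continuous (fun t => psi t (w i))}) ->
  (forall j, phi j 0 u = 0) ->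
  (forall j, is_derive (0 : R) (1 : R) (fun t => phi j t u) (dphi j)) ->
  is_derive (0 : R) (1 : R) (fun t => psi t u) dpsi ->
  dpsi = \sum_j dphi j * psi 0 (w j).
Proof.
move=> H phiw cphi cpsi phiu dph dps.
pose M t : 'M[R]_k := \matrix_(i, j) phi j t (w i).
have M0 : M 0 = 1%:M by apply/matrixP => i j; rewrite !mxE phiw.
have cM i j : {for 0, continuous (fun t => M t i j)}.
  rewrite (_ : (fun _ => _) = (fun t => phi j t (w i))); first exact: cphi.
  by apply/funext => t; rewrite mxE.
have cadj i j : {for 0, continuous (fun t => (\adj (M t)) i j)}.
  rewrite (_ : (fun _ => _) = (fun t => (-1) ^+ (j + i) *
      \det (row' j (col' i (M t))))); last first.
    by apply/funext => t; rewrite mxE.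
  apply: continuousM; first exact: cst_continuous.
  apply: continuous_det => i' j'.
  rewrite (_ : (fun _ => _) = (fun t => M t (lift j i') (lift i j')))//.
  by apply/funext => t; rewrite !mxE.
have psiu : psi 0 u = 0.
  by have [_ _] := nbhs_singleton H; apply.
have L : is_derive (0 : R) (1 : R) (fun t => psi t u * \det (M t)) dpsi.
  have := is_derive_mul0 dps psiu (continuous_det cM).
  by rewrite M0 det1 mulr1.
pose F j t := phi j t u * (\sum_i (\adj (M t)) j i * psi t (w i)).
have Fd j : is_derive (0 : R) (1 : R) (F j) (dphi j * psi 0 (w j)).
  have cg : {for 0, continuous (fun t => \sum_i (\adj (M t)) j i * psi t (w i))}.
    apply: continuous_bigsum => i.
    by apply: continuousM; [exact: cadj|exact: cpsi].
  have := is_derive_mul0 (dph j) (phiu j) cg.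
  rewrite M0 (bigD1 j)//= big1 ?addr0; last first.
    by move=> i ij; rewrite adj1 mxE eq_sym (negbTE ij) mul0r.
  by rewrite adj1 mxE eqxx mul1r.
have E : \forall t \near (0 : R), psi t u * \det (M t) = (\sum_j F j) t.
  apply: filterS H => t [lphi lpsi ker].
  pose c := (\row_j phi j t u) *m \adj (M t).
  have zphi j : phi j t 0 = 0.
    by have := lphi j 1 0 0; rewrite scaler0 addr0 mul1r -[LHS]addr0 => /addrI/esym.
  have zpsi : psi t 0 = 0.
    by have := lpsi 1 0 0; rewrite scaler0 addr0 mul1r -[LHS]addr0 => /addrI/esym.
  have sphi j s : phi j t (\sum_(i <- s) c 0 i *: w i) =
      \sum_(i <- s) c 0 i * phi j t (w i).
    elim: s => [|i s IH]; first by rewrite !big_nil.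
    by rewrite !big_cons lphi IH.
  have spsi s : psi t (\sum_(i <- s) c 0 i *: w i) =
      \sum_(i <- s) c 0 i * psi t (w i).
    elim: s => [|i s IH]; first by rewrite !big_nil.
    by rewrite !big_cons lpsi IH.
  (* Cramer's rule without division: the coefficients [c] are chosen so that every [phi j t]
     vanishes at [x], whether or not the determinant does. *)
  pose x := (- \det (M t)) *: u + \sum_i c 0 i *: w i.
  have : psi t x = 0.
    apply: ker => j; rewrite lphi sphi.
    have : (c *m M t) 0 j = \det (M t) * phi j t u.
      by rewrite /c -mulmxA mul_adj_mx mul_mx_scalar !mxE.
    rewrite !mxE => H'.
    under eq_bigr => i _ do rewrite -[phi j t (w i)](mxE matrix_key (fun i j => phi j t (w i)) i j).
    by rewrite H' mulNr addNr.
  rewrite lpsi spsi mulNr => /eqP; rewrite addrC subr_eq0 => /eqP H'.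
  rewrite mulrC -H' fct_sumE /F.
  under eq_bigr => i _ do rewrite mxE mulr_suml.
  rewrite exchange_big; apply: eq_bigr => j _; rewrite mulr_sumr.
  by apply: eq_bigr => i _; rewrite mxE mulrA.
have := near_eq_is_derive E L => L'.
have S := is_derive_sum Fd.
by rewrite -(@derive_val _ _ _ _ _ _ _ L') -(@derive_val _ _ _ _ _ _ _ S).
Qed.

Definition real_form (V : lmodType R) (g : V -> R) :=
  forall a x y, g (a *: x + y) = a * g x + g y.

Lemma real_formD (V : lmodType R) (g : V -> R) a x : real_form g ->
  forall y, g (y + a *: x) = g y + a * g x.
Proof. by move=> lg y; rewrite addrC lg addrC. Qed.

(** Subtracting from [u] its components along the dual vectors leaves a vector of the common
    kernel. *)
Lemma kernel_combination3 (V : lmodType R) (a b c psi : V -> R) (w0 w1 w2 u : V) :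
  [/\ real_form a, real_form b, real_form c & real_form psi] ->
  (forall x, a x = 0 -> b x = 0 -> c x = 0 -> psi x = 0) ->
  [/\ a w0 = 1, b w0 = 0 & c w0 = 0] -> [/\ a w1 = 0, b w1 = 1 & c w1 = 0] ->
  [/\ a w2 = 0, b w2 = 0 & c w2 = 1] ->
  psi u = a u * psi w0 + b u * psi w1 + c u * psi w2.
Proof.
move=> [la lb lc lp] ker [a0 b0 c0] [a1 b1 c1] [a2 b2 c2].
have := ker (u + (- a u) *: w0 + (- b u) *: w1 + (- c u) *: w2).
rewrite !real_formD // a0 b0 c0 a1 b1 c1 a2 b2 c2.
move=> H; have {}H : psi u + - a u * psi w0 + - b u * psi w1 + - c u * psi w2 = 0.
  by apply: H; lra.
move: H; move: (psi u) (psi w0) (psi w1) (psi w2) (a u) (b u) (c u).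
by move=> p p0 p1 p2 x y z H; apply/eqP; rewrite -subr_eq0 -H; apply/eqP; ring.
Qed.

(** The case needed below: D has codimension three, so three real forms cut it out of the tangent
    space. *)
Lemma kernel_derive3 (V : lmodType R) (a b c psi : R -> V -> R)
    (w0 w1 w2 u : V) (da db dc dpsi : R) :
  (\forall t \near (0 : R),
     [/\ real_form (a t), real_form (b t), real_form (c t) & real_form (psi t)] /\
     forall x, a t x = 0 -> b t x = 0 -> c t x = 0 -> psi t x = 0) ->
  [/\ a 0 w0 = 1, b 0 w0 = 0 & c 0 w0 = 0] ->
  [/\ a 0 w1 = 0, b 0 w1 = 1 & c 0 w1 = 0] ->
  [/\ a 0 w2 = 0, b 0 w2 = 0 & c 0 w2 = 1] ->
  (forall w, [/\ {for 0, continuous (a^~ w)}, {for 0, continuous (b^~ w)},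
     {for 0, continuous (c^~ w)} & {for 0, continuous (psi^~ w)}]) ->
  [/\ a 0 u = 0, b 0 u = 0 & c 0 u = 0] ->
  is_derive (0 : R) (1 : R) (a^~ u) da -> is_derive (0 : R) (1 : R) (b^~ u) db ->
  is_derive (0 : R) (1 : R) (c^~ u) dc -> is_derive (0 : R) (1 : R) (psi^~ u) dpsi ->
  dpsi = da * psi 0 w0 + db * psi 0 w1 + dc * psi 0 w2.
Proof.
move=> H [a0 b0 c0] [a1 b1 c1] [a2 b2 c2] cont [au bu cu] Da Db Dc Dp.
pose sel (T : Type) (p q r : T) (j : 'I_3) := match val j with 0%N => p | 1%N => q | _ => r end.
have selP (P : 'I_3 -> Prop) : P ord0 -> P (inord 1) -> P (inord 2) -> forall j, P j.
  move=> h0 h1 h2 j; have [/eqP|/eqP|/eqP] : [\/ j == 0%N :> nat, j == 1%N :> nat | j == 2%N :> nat].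
    by case: j => [[|[|[|//]]] ?]; [constructor 1|constructor 2|constructor 3].
  - by move=> E; rewrite (_ : j = ord0)//; apply: val_inj.
  - by move=> E; rewrite (_ : j = inord 1)//; apply: val_inj; rewrite /= inordK.
  - by move=> E; rewrite (_ : j = inord 2)//; apply: val_inj; rewrite /= inordK.
have s0 T p q r : sel T p q r ord0 = p by [].
have s1 T p q r : sel T p q r (inord 1) = q by rewrite /sel /= inordK.
have s2 T p q r : sel T p q r (inord 2) = r by rewrite /sel /= inordK.
pose phi j t := sel _ (a t) (b t) (c t) j.
have p0 t x : phi ord0 t x = a t x by rewrite /phi s0.
have p1 t x : phi (inord 1) t x = b t x by rewrite /phi s1.
have p2 t x : phi (inord 2) t x = c t x by rewrite /phi s2.
have f0 x : phi ord0 ^~ x = a^~ x by [].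
have f1 x : phi (inord 1) ^~ x = b^~ x by apply/funext => t; rewrite p1.
have f2 x : phi (inord 2) ^~ x = c^~ x by apply/funext => t; rewrite p2.
have i01 : (inord 1 == ord0 :> 'I_3) = false by rewrite -val_eqE /= inordK.
have i02 : (inord 2 == ord0 :> 'I_3) = false by rewrite -val_eqE /= inordK.
have i12 : (inord 1 == inord 2 :> 'I_3) = false by rewrite -val_eqE /= !inordK.
have -> : da * psi 0 w0 + db * psi 0 w1 + dc * psi 0 w2 =
    \sum_j sel _ da db dc j * psi 0 (sel _ w0 w1 w2 j).
  rewrite !big_ord_recl big_ord0 addr0.
  rewrite (_ : lift ord0 ord0 = inord 1); last by apply: val_inj; rewrite /= inordK.
  rewrite (_ : lift ord0 (lift ord0 ord0) = inord 2); last by apply: val_inj; rewrite /= inordK.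
  by rewrite !s0 !s1 !s2 addrA.
apply: (@kernel_derive V 3 phi psi (sel _ w0 w1 w2) u (sel _ da db dc) dpsi).
- apply: filterS H => t [[la lb lc lp] ker]; split => //.
  + by apply: selP => k x y; rewrite ?p0 ?p1 ?p2.
  + by move=> x h; apply: ker; rewrite -?(p0 t x) -?(p1 t x) -?(p2 t x).
- apply: (selP); apply: (selP); rewrite ?s0 ?s1 ?s2 ?p0 ?p1 ?p2 ?eqxx ?i01 ?i02 ?i12 //;
    by rewrite eq_sym ?i01 ?i02 ?i12.
- by move=> i; apply: selP; rewrite ?f0 ?f1 ?f2; have [] := cont (sel _ w0 w1 w2 i).
- by move=> i; have [] := cont (sel _ w0 w1 w2 i).
- by apply: selP; rewrite ?p0 ?p1 ?p2.
- by apply: selP; rewrite ?f0 ?f1 ?f2 ?s0 ?s1 ?s2.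
Qed.

End KernelDerivative.

(** * The tangent space of the hypersurface by a dimension count *)

Section TangentDimension.
Context {R : realType}.
Local Notation C := R[i].

(** Real coordinates, so that ranks of real-linear maps between complex matrices can be counted. *)
Definition realify p q (A : 'M[C]_(p, q)) : 'rV[R]_(p * q + p * q) :=
  row_mx (mxvec (map_mx (@complex.Re R) A)) (mxvec (map_mx (@complex.Im R) A)).

Lemma realify_linear p q (a : R) (A B : 'M[C]_(p, q)) :
  realify (a%:C *: A + B) = a *: realify A + realify B.
Proof.
rewrite /realify scale_row_mx add_row_mx -!linearZ -!linearD.
by congr (row_mx (mxvec _) (mxvec _)); apply/matrixP => i j;
  rewrite !mxE ?cReD ?cImD ?cReZ ?cImZ.
Qed.

Lemma realify_inj p q (A B : 'M[C]_(p, q)) : realify A = realify B -> A = B.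
Proof.
move=> /eq_row_mx[/(can_inj mxvecK)/matrixP Hr /(can_inj mxvecK)/matrixP Hi].
apply/matrixP => i j; apply: complex_eq.
  by have := Hr i j; rewrite !mxE.
by have := Hi i j; rewrite !mxE.
Qed.

Lemma realify0 p q : realify (0 : 'M[C]_(p, q)) = 0.
Proof.
have := @realify_linear p q 1 0 0.
by rewrite scaler0 addr0 scale1r -[LHS]addr0 => /addrI.
Qed.

(** The image of T together with the line of L is the injective image of a real space of dimension
    (4m - 1) + 1, inside the tangent space of the Grassmannian, which has real dimension 4m; hence
    it is everything, and a vector orthogonal to L has no component along L. *)
Lemma tangent_image m (P L : 'M[C]_m.+2)
    (T : 'rV[R]_(4 * m).-1 -> 'M[C]_m.+2) :
  (0 < m)%N -> gr2 P -> gr2_tangent P L -> complex.Re (\tr (L *m L)) != 0 ->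
  (forall (a : R) u v, T (a *: u + v) = a%:C *: T u + T v) ->
  (forall u, gr2_tangent P (T u)) ->
  (forall u, complex.Re (\tr (L *m T u)) = 0) ->
  (forall u, T u = 0 -> u = 0) ->
  forall X, gr2_tangent P X -> complex.Re (\tr (L *m X)) = 0 ->
  exists u, T u = X.
Proof.
move=> m0 [PH PP Pr] [LH LT] L0 Tlin Ttan TL Tinj X [XH XT] XL.
pose Q := 1%:M - P; pose A := row_base P; pose B := row_base Q.
have PQ : P *m Q = 0 by rewrite mulmxBr mulmx1 PP subrr.
have QQ : Q *m Q = Q by rewrite {1}/Q mulmxBl mul1mx PQ subr0.
have QH : Q ^t* = Q by rewrite hcB hc1 PH.
have rQ : \rank Q = m.
  have := tr_idem QQ; rewrite raddfB /= mxtrace1 tr_idem// Pr -natrB// => /esym/eqP.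
  by rewrite eqr_nat subn2 => /eqP.
(* The block of Y in Hom(V, V^perp), written in bases of V and of V^perp: 2 * m complex numbers,
   that is 4m real ones. *)
pose phi (Y : 'M[C]_m.+2) := realify (A *m Y *m B ^t*).
have phi_inj Y : Y ^t* = Y -> Y *m P + P *m Y = Y -> phi Y = 0 -> Y = 0.
  move=> YH YT.
  rewrite -(@realify0 (\rank P) (\rank Q)).
  move=> /realify_inj H.
  have H0 : P *m Y *m Q = 0.
    rewrite -[P in P *m Y](mulmx_base P) -QH -[Q in Q ^t*](mulmx_base Q) hcM.
    rewrite -/A -/B.
    have -> : col_base P *m A *m Y *m (B ^t* *m col_base Q ^t*) =
      col_base P *m (A *m Y *m B ^t*) *m col_base Q ^t* by rewrite !mulmxA.
    by rewrite H mulmx0 mul0mx.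
  have PY : P *m Y = 0.
    have := H0; rewrite /Q mulmxBr mulmx1 (PNP0 PP YT) subr0 //.
  have YP : Y *m P = 0 by rewrite -[LHS]hcK hcM PH YH PY hc0.
  by rewrite -YT PY YP addr0.
(* The extra coordinate multiplies [L] and supplies the one missing direction. *)
pose Y (v : 'rV[R]_((4 * m).-1 + 1)) := T (lsubmx v) + (rsubmx v 0 0)%:C *: L.
have Ylin (a : R) u v : Y (a *: u + v) = a%:C *: Y u + Y v.
  have El : lsubmx (a *: u + v) = a *: lsubmx u + lsubmx v.
    by apply/rowP => i; rewrite !mxE.
  have Er : (rsubmx (a *: u + v) 0 0)%:C =
      a%:C * (rsubmx u 0 0)%:C + (rsubmx v 0 0)%:C.
    by rewrite !mxE rmorphD rmorphM.
  rewrite /Y El Er Tlin [in RHS]scalerDr [in LHS]scalerDl -scalerA.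
  exact: addrACA.
have Yherm v : (Y v) ^t* = Y v.
  have [TH _] := Ttan (lsubmx v).
  rewrite hcD hcZ LH TH; congr (_ + _ *: _).
  by apply: complex_eq; rewrite ?cReJ ?cImJ//= oppr0.
have Ytan v : Y v *m P + P *m Y v = Y v.
  have [_ TT] := Ttan (lsubmx v).
  rewrite mulmxDl mulmxDr addrACA TT -scalemxAl -scalemxAr -scalerDr LT //.
have YL v : complex.Re (\tr (L *m Y v)) =
    rsubmx v 0 0 * complex.Re (\tr (L *m L)).
  by rewrite mulmxDr mxtraceD cReD TL add0r -scalemxAr mxtraceZ cReZ.
pose g v := phi (Y v).
have glin : linear g.
  move=> a u v; rewrite /g Ylin /phi mulmxDr mulmxDl -scalemxAr -scalemxAl.
  exact: realify_linear.
pose gL : {linear _ -> _} := HB.pack g (GRing.isLinear.Build _ _ _ _ g glin).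
pose G := lin1_mx gL.
have GE v : v *m G = g v by rewrite mul_rV_lin1.
have ginj v : g v = 0 -> v = 0.
  move=> /(phi_inj _ (Yherm v) (Ytan v)) Yv.
  have c0 : rsubmx v 0 0 = 0.
    apply/eqP; have := YL v; rewrite Yv mulmx0 mxtrace0 => /esym/eqP.
    by rewrite mulf_eq0 (negbTE L0) orbF.
  rewrite -[v]hsubmxK; have -> : rsubmx v = 0.
    by apply/rowP => i; rewrite (ord1 i) c0 mxE.
  have -> : lsubmx v = 0.
    by apply: Tinj; move: Yv; rewrite /Y c0 scale0r addr0.
  exact: row_mx0.
have Gfree : row_free G.
  rewrite -kermx_eq0; apply/eqP/row_matrixP => i; rewrite row0; apply: ginj.
  by rewrite -GE -row_mul mulmx_ker row0.
have Gfull : row_full G.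
  rewrite /row_full (eqP Gfree) Pr rQ addn1 prednK ?muln_gt0//.
  by rewrite addnn -mul2n mulnA.
have /submxP[v vE] : (phi X <= G)%MS by exact: submx_full.
have XY : X = Y v.
  apply/eqP; rewrite -subr_eq0; apply/eqP/phi_inj.
  - by rewrite hcB XH Yherm.
  - by rewrite mulmxBl mulmxBr addrACA -opprD XT Ytan.
  - rewrite /phi mulmxBr mulmxBl -[_ - _]addrC -scaleN1r.
    have -> : -1 = (-1 : R)%:C by rewrite rmorphN1.
    by rewrite realify_linear -/(phi X) vE GE scaleN1r addNr.
have c0 : rsubmx v 0 0 = 0.
  apply/eqP; have := YL v; rewrite -XY XL => /esym/eqP.
  by rewrite mulf_eq0 (negbTE L0) orbF.
by exists (lsubmx v); rewrite XY /Y c0 scale0r addr0.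
Qed.

End TangentDimension.

(** * Hermitian products and the pointwise algebra behind umbilicity *)

Section HermitianForm.
Context {C : numClosedFieldType}.
Implicit Types (c : C).

Definition dot n (a b : 'rV[C]_n) : C := locked ((a *m b ^t*) 0 0).

Lemma dotE n (a b : 'rV[C]_n) : dot a b = (a *m b ^t*) 0 0.
Proof. by rewrite /dot -lock. Qed.

Lemma dotDl n (a a' b : 'rV[C]_n) : dot (a + a') b = dot a b + dot a' b.
Proof. by rewrite !dotE mulmxDl mxE. Qed.

Lemma dotZl n c (a b : 'rV[C]_n) : dot (c *: a) b = c * dot a b.
Proof. by rewrite !dotE -scalemxAl mxE. Qed.

Lemma dotC n (a b : 'rV[C]_n) : dot b a = Num.conj (dot a b).
Proof. by rewrite !dotE -hcE hcM hcK. Qed.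

Lemma dotZr n c (a b : 'rV[C]_n) : dot a (c *: b) = Num.conj c * dot a b.
Proof. by rewrite dotC dotZl rmorphM /= -dotC. Qed.

Lemma dotDr n (a b b' : 'rV[C]_n) : dot a (b + b') = dot a b + dot a b'.
Proof. by rewrite dotC dotDl rmorphD /= -!dotC. Qed.

Lemma dot0l n (b : 'rV[C]_n) : dot 0 b = 0.
Proof. by rewrite -(scale0r 0) dotZl mul0r. Qed.

Lemma dot0r n (b : 'rV[C]_n) : dot b 0 = 0.
Proof. by rewrite dotC dot0l rmorph0. Qed.

Lemma dot_ge0 n (a : 'rV[C]_n) : 0 <= dot a a.
Proof.
rewrite !dotE mxE sumr_ge0// => j _; rewrite hcE -normCK; exact: exprn_ge0.
Qed.

Lemma dot_eq0 n (a : 'rV[C]_n) : (dot a a == 0) = (a == 0).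
Proof.
apply/eqP/eqP => [|->]; last exact: dot0l.
rewrite !dotE mxE => /eqP; rewrite psumr_eq0; last first.
  by move=> j _; rewrite hcE -normCK exprn_ge0.
move=> /allP H; apply/rowP => j; rewrite mxE; apply/eqP.
have := H j (mem_index_enum _); rewrite /= hcE -normCK.
by rewrite expf_eq0 /= normr_eq0.
Qed.

End HermitianForm.

Section ShapeOperatorAlgebra.
Context {R : realType}.
Local Notation C := R[i].
Local Notation Re := (@complex.Re R).
Local Notation Im := (@complex.Im R).

Lemma conj_real (a : R) : Num.conj (a%:C) = a%:C :> C.
Proof. by apply: complex_eq; rewrite ?cReJ ?cImJ //= oppr0. Qed.

Lemma dot_Re0 n (a : 'rV[C]_n) : Re (dot a a) = 0 -> a = 0.
Proof.
move=> H; apply/eqP; rewrite -dot_eq0; apply/eqP.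
by apply: complex_eq => //=; rewrite ger0_Im// dot_ge0.
Qed.

(** In the application [X], [B], [Y] are the components of de, de', df orthogonal to the frame,
    [sym] is the symmetry of the shape operator and [main] the antisymmetrized derivative of the
    relation that expresses invariance of D. As X u and B u are arbitrary and independent on D,
    special choices of u and v determine all coefficients. *)
Lemma umbilic_of_codazzi n (Q : 'M[C]_n) (q : 'rV[C]_n) (V : lmodType R)
    (D : V -> Prop) (X B Y : V -> 'rV[C]_n) (c1 c2 c3 : C) :
  q != 0 -> q *m Q = q ->
  (forall u, Y u *m Q = Y u) -> (forall u, X u *m Q = X u) ->
  (forall u v, D u -> D v -> D (u - v)) ->
  (forall u v, X (u - v) = X u - X v) ->
  (forall u v, Y (u - v) = Y u - Y v) ->
  (forall a b, a *m Q = a -> b *m Q = b -> exists u, [/\ D u, X u = a & B u = b]) ->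
  (forall u v, D v -> Re (dot (Y u) (X v)) = Re (dot (X u) (Y v))) ->
  (forall u v, D u -> D v -> dot (X u) (B v) - dot (X v) (B u) =
     c1 * (Im (dot (X u) (Y v) - dot (X v) (Y u)))%:C +
     c2 * (Re (dot (Y u) (B v) - dot (Y v) (B u)))%:C +
     c3 * (Im (dot (Y u) (B v) - dot (Y v) (B u)))%:C) ->
  exists l : R, [/\ l != 0, forall u, Y u = l%:C *: X u &
    [/\ c1 = 0, c2 = l^-1%:C & c3 = 'i * c2]].
Proof.
move=> + + YQ XQ DB XB YB surj sym main.
wlog qq : q / dot q q = 1 => [wq q0 qQ|q0 qQ].
  have [k k0 kq] := normalize q0; apply: (wq (k *: q)).
  - by rewrite !dotE kq mxE.
  - by rewrite scaler_eq0 negb_or k0.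
  - by rewrite -scalemxAl qQ.
(* Testing the symmetry against a v with X v = Y u gives |Y u|^2 = 0. *)
have YX0 u : D u -> X u = 0 -> Y u = 0.
  move=> Du Xu; have [v [Dv Xv _]] := surj _ 0 (YQ u) (mul0mx _ _).
  by apply: dot_Re0; have := sym u v Dv; rewrite Xv Xu dot0l.
have ZQ c (a : 'rV[C]_n) : a *m Q = a -> c *: a *m Q = c *: a.
  by move=> aQ; rewrite -scalemxAl aQ.
(* A v with X v = 0, hence Y v = 0, and B v = b isolates the product <X u, b>. *)
have key u b : D u -> B u = 0 -> b *m Q = b ->
    dot (X u) b = c2 * (Re (dot (Y u) b))%:C + c3 * (Im (dot (Y u) b))%:C.
  move=> Du Bu bQ; have [v [Dv Xv Bv]] := surj 0 b (mul0mx _ _) bQ.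
  have := main u v Du Dv; rewrite Xv Bv Bu (YX0 v)// !dot0l !dot0r !subr0 //=.
  by rewrite mulr0 add0r.
have conji : Num.conj ('i : C) = - 'i by apply: complex_eq; rewrite ?cReJ ?cImJ ?cReN ?cImN //= oppr0.
have ii : 'i * 'i = -1 :> C by exact: sqr_i.
have [u1 [Du1 Xu1 Bu1]] := surj q 0 qQ (mul0mx _ _).
(* [key] is used at q and at i q: its left side is conjugate-linear in b, and the right side can be
   so only if c3 = i c2. The product <Y u1, q> that has to be cancelled is nonzero, as [E1] would
   otherwise read 1 = 0. *)
have [c30 c20] : c3 = 'i * c2 /\ c2 != 0.
  set z := dot (Y u1) q.
  have E1 := key u1 q Du1 Bu1 qQ.
  have E2 := key u1 ('i *: q) Du1 Bu1 (ZQ 'i _ qQ).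
  rewrite !dotZr Xu1 qq mulr1 conji mulNr -/z cReN cImN cReM cImM /= !mul0r !mul1r in E2.
  rewrite Xu1 qq -/z in E1.
  rewrite !add0r opprK in E2.
  set a := (Re z)%:C in E1 E2; set b := (Im z)%:C in E1 E2.
  have E3 : (c3 - 'i * c2) * (a - 'i * b) = 0.
    rewrite rmorphN /= -/a in E2.
    have -> : (c3 - 'i * c2) * (a - 'i * b) =
       c3 * a + ('i * 'i) * (c2 * b) - 'i * (c2 * a + c3 * b) by ring.
    rewrite -E1 ii mulr1 E2; ring.
  have ab0 : a - 'i * b != 0.
    apply/eqP => ab.
    have a0 : Re z = 0.
      by move: ab => /(congr1 Re); rewrite cReD cReN cReM /= !mul0r mulr0 subr0 subr0.
    have b0 : Im z = 0.
      by move: ab => /(congr1 Im); rewrite cImD cImN cImM /= => H; lra.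
    move: E1; rewrite /a /b a0 b0 !mulr0 addr0 => /eqP.
    by rewrite oner_eq0.
  move/eqP: E3; rewrite mulf_eq0 (negbTE ab0) orbF subr_eq0 => /eqP c3E.
  split=> //; apply: contra_eq_neq E1 => c2E.
  by rewrite c3E c2E mulr0 !mul0r addr0 oner_neq0.
have lem u b : D u -> b *m Q = b -> dot (X u) b = c2 * dot (Y u) b.
  move=> Du bQ.
  have [u' [Du' Xu' Bu']] := surj (X u) 0 (XQ u) (mul0mx _ _).
  have YE : Y u = Y u'.
    apply/eqP; rewrite -subr_eq0 -YB; apply/eqP/YX0; first exact: DB.
    by rewrite XB Xu' subrr.
  rewrite YE -Xu' (key _ _ Du' Bu' bQ) c30.
  by rewrite [dot _ _ in RHS]complexE mulrDr [c2 * ('i * _)]mulrCA mulrA.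
have XcY u : D u -> X u = c2 *: Y u.
  move=> Du; apply/eqP; rewrite -subr_eq0 -dot_eq0; set b := _ - _.
  have bQ : b *m Q = b by rewrite mulmxBl -scalemxAl XQ YQ.
  by rewrite {1}/b -scaleNr dotDl dotZl lem// mulNr subrr.
pose l := c2^-1.
have YlX u : D u -> Y u = l *: X u.
  by move=> Du; rewrite (XcY u Du) scalerA mulVf// scale1r.
have [u2 [Du2 Xu2 Bu2]] := surj ('i *: q) 0 (ZQ 'i _ qQ) (mul0mx _ _).
(* The symmetry applied to the values q and i q of X forces the factor to be real. *)
have Iml : Im l = 0.
  have := sym u1 u2 Du2; rewrite !YlX// Xu1 Xu2 dotZl !dotZr qq conji !mulr1.
  rewrite !mulrN !cReN !cReM cImJ /=.
  by move: (Re l) (Im l) => *; lra.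
have lE : l = (Re l)%:C by apply: complex_eq.
have l0 : Re l != 0.
  apply: contraNneq (invr_neq0 c20) => H.
  by rewrite -/l lE H.
exists (Re l); split=> //.
  (* Here u may lie outside D: [sym] wants only its second vector in D, and X takes every admissible
     value there. *)
  move=> u; apply/eqP; rewrite -subr_eq0; apply/eqP/dot_Re0; set b := _ - _.
  have bQ : b *m Q = b by rewrite mulmxBl -scalemxAl XQ YQ.
  have [v [Dv Xv _]] := surj b 0 bQ (mul0mx _ _).
  have := sym u v Dv; rewrite (YlX v Dv) Xv dotZr {1}lE conj_real => H.
  by rewrite {1}/b -scaleNr dotDl dotZl cReD H mulNr cReN subrr.
split=> //; last by rewrite fmorphV /= -lE invrK.
(* With B u1 = B u2 = 0 only the [c1] term survives, and its factor is a nonzero multiple of l. *)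
have := main u1 u2 Du1 Du2; rewrite Bu1 Bu2 !dot0r !subrr /=.
rewrite !mulr0 !addr0 !YlX// Xu1 Xu2 lE !dotZr !dotZl qq conji !mulr1.
rewrite !(cReM, cImM, cReN, cImN, cReD, cImD, cReJ, cImJ) /=.
move=> /esym/eqP; rewrite mulf_eq0 => /orP[/eqP //|].
move=> /eqP/(congr1 Re) /= H; exfalso; move/eqP: l0; apply; lra.
Qed.

End ShapeOperatorAlgebra.

(** * Algebra of the plane and the normal in an adapted frame *)

Section FrameAlgebra.
Context {C : numClosedFieldType}.

Lemma dotM n (a b : 'rV[C]_n) (A : 'M[C]_n) :
  dot (a *m A) b = dot a (b *m A ^t*).
Proof. by rewrite !dotE hcM hcK mulmxA. Qed.

Lemma row_dot n (a b c : 'rV[C]_n) : a *m b ^t* *m c = dot a b *: c.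
Proof. by rewrite dotE {1}[a *m _]mx11_scalar mul_scalar_mx. Qed.

Lemma dot_tr n (a b : 'rV[C]_n) (A : 'M[C]_n) :
  \tr (a ^t* *m b *m A) = dot (b *m A) a.
Proof. by rewrite -mulmxA mxtrace_mulC dotE [X in \tr X]mx11_scalar mxtrace_scalar. Qed.

Lemma dot_scale_mul n (a b : C) (r s : 'rV[C]_n) (A : 'M[C]_n) :
  dot (a *: r *m A) (b *: s) = a * Num.conj b * dot (r *m A) s.
Proof. by rewrite -scalemxAl dotZl dotZr mulrA. Qed.

Lemma mul_conj_gt0 (a : C) : a != 0 -> 0 < a * Num.conj a.
Proof. by move=> a0; rewrite -normCK exprn_gt0// normr_gt0. Qed.

Lemma mul_conj_eq0 (a b c : C) : a != 0 -> b != 0 -> a * Num.conj b * c = 0 ->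
  c = 0.
Proof.
move=> a0 b0 /eqP; rewrite !mulf_eq0 conjC_eq0 (negbTE a0) (negbTE b0).
by move=> /eqP.
Qed.

Lemma scale_neq0 n (a : C) (r : 'rV[C]_n) : a *: r != 0 -> a != 0.
Proof. by apply: contra_neq => ->; rewrite scale0r. Qed.

Context (n : nat) (P L : 'M[C]_n) (e e' f : 'rV[C]_n) (PL : frame P L e e' f).

Let Q := 1%:M - P - f ^t* *m f.

Lemma frame_dot : [/\ dot e e = 1, dot e' e' = 1 & dot f f = 1] /\
  [/\ [/\ dot e e' = 0, dot e f = 0 & dot e' f = 0],
      dot e' e = 0, dot f e = 0 & dot f e' = 0].
Proof.
have [[ee e'e' ff] [ee' ef e'f] _ _] := PL.
have z (a b : 'rV[C]_n) : dot a b = 0 -> dot b a = 0.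
  by move=> ab; rewrite dotC ab rmorph0.
have H : [/\ dot e e' = 0, dot e f = 0 & dot e' f = 0].
  by rewrite !dotE ee' ef e'f mxE.
split; first by rewrite !dotE ee e'e' ff !mxE.
by have [? ? ?] := H; split=> //; apply: z.
Qed.

Lemma frame_act : [/\ e *m P = e, e' *m P = e' & f *m P = 0] /\
  [/\ e *m L = f, e' *m L = 0 & f *m L = e].
Proof.
have [_ _ PE LE] := PL.
have [[ee e'e' ff] [[ee' ef e'f] e'e fe fe']] := frame_dot.
rewrite PE LE !mulmxDr !mulmxA !row_dot ee e'e' ff ee' ef e'f e'e fe fe'.
by rewrite !scale0r !scale1r !addr0 !add0r.
Qed.

Lemma frame_herm : P ^t* = P /\ L ^t* = L.
Proof.
have [_ _ -> ->] := PL; rewrite !hcD !hcM !hcK; split=> //; exact: addrC.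
Qed.

(** Although [e] is defined only up to a phase, its projection is a polynomial in [P] and [L] and is
    therefore as smooth as they are; the moving frames rest on this. *)
Lemma frame_E : P *m (L *m L) = e ^t* *m e.
Proof.
have [_ _ PE LE] := PL; have [_ [eL e'L fL]] := frame_act.
rewrite PE mulmxDl -!mulmxA (mulmxA e) (mulmxA e') eL e'L fL mul0mx mulmx0.
exact: addr0.
Qed.

Lemma frame_K : L *m L = e ^t* *m e + f ^t* *m f.
Proof.
have [_ _ PE LE] := PL; have [_ [eL e'L fL]] := frame_act.
by rewrite {1}LE mulmxDl -!mulmxA eL fL.
Qed.

Lemma frame_E' : P - P *m (L *m L) = e' ^t* *m e'.
Proof. by rewrite frame_E; have [_ _ -> _] := PL; rewrite addrC addKr. Qed.

Lemma frame_Q : [/\ Q ^t* = Q, Q *m Q = Q & P *m Q = 0] /\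
  [/\ e *m Q = 0, e' *m Q = 0, f *m Q = 0 & L *m Q = 0].
Proof.
have [PH LH] := frame_herm.
have [[eP e'P fP] [eL e'L fL]] := frame_act.
have [[ee e'e' ff] [[ee' ef e'f] e'e fe fe']] := frame_dot.
have [_ _ PE LE] := PL.
have z r : r *m P = r -> dot r f = 0 -> r *m Q = 0.
  by move=> rP rf; rewrite !mulmxBr mulmx1 rP mulmxA row_dot rf scale0r !subrr.
have fQ : f *m Q = 0.
  by rewrite !mulmxBr mulmx1 fP mulmxA row_dot ff scale1r subr0 subrr.
have eQ := z _ eP ef; have e'Q := z _ e'P e'f.
have PQ : P *m Q = 0 by rewrite PE mulmxDl -!mulmxA eQ e'Q !mulmx0 addr0.
split; split=> //.
- by rewrite !hcB hc1 PH hcM hcK.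
- by rewrite {1}/Q !mulmxBl mul1mx PQ -mulmxA fQ mulmx0 !subr0.
- by rewrite LE mulmxDl -!mulmxA eQ fQ !mulmx0 addr0.
Qed.

Lemma frame_Q' : 1%:M - L *m L = e' ^t* *m e' + Q.
Proof.
rewrite frame_K /Q; have [_ _ -> _] := PL.
move: (_ *m e) (_ *m e') (_ *m f) => a b c.
have -> : b + (1%:M - (a + b) - c) = (b + (1%:M - (a + b))) - c by rewrite addrA.
have -> : b + (1%:M - (a + b)) = 1%:M - a.
  by rewrite addrCA [a + b]addrC opprD [b + _]addrA subrr add0r.
by rewrite opprD addrA.
Qed.

Lemma frame_LQ' : L *m (1%:M - L *m L) = 0.
Proof.
have [_ [_ _ _ LQ]] := frame_Q; have [_ [_ e'L _]] := frame_act.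
have [_ LH] := frame_herm.
by rewrite frame_Q' mulmxDr LQ addr0 mulmxA -{1}LH -hcM e'L hc0 mul0mx.
Qed.

Lemma dot_res r s : dot r s = dot r e * Num.conj (dot s e) +
  dot r e' * Num.conj (dot s e') + dot r f * Num.conj (dot s f) +
  dot (r *m Q) (s *m Q).
Proof.
have [[QH QQ _] _] := frame_Q.
have t a : dot r a * Num.conj (dot s a) = dot (r *m (a ^t* *m a)) s.
  by rewrite mulmxA row_dot dotZl -dotC.
have -> : dot (r *m Q) (s *m Q) = dot (r *m Q) s.
  by rewrite -{2}QH -dotM -mulmxA QQ.
rewrite !t -!dotDl -!mulmxDr; have [_ _ PE _] := PL; rewrite -PE /Q.
by rewrite [_ - _ - _]addrC addrA addrK addrC subrK mulmx1.
Qed.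

Lemma dot_res0 r s : dot r e = 0 \/ dot s e = 0 ->
  dot r e' = 0 \/ dot s e' = 0 -> dot r f = 0 \/ dot s f = 0 ->
  dot r s = dot (r *m Q) (s *m Q).
Proof.
have z (a b : C) : a = 0 \/ b = 0 -> a * Num.conj b = 0.
  by case=> ->; rewrite ?rmorph0 ?mulr0 ?mul0r.
by move=> /z h1 /z h2 /z h3; rewrite {1}dot_res h1 h2 h3 !add0r.
Qed.

Lemma row_res r : r = dot r e *: e + dot r e' *: e' + dot r f *: f + r *m Q.
Proof.
rewrite -!row_dot -!mulmxA -!mulmxDr; have [_ _ PE _] := PL; rewrite -PE /Q.
by rewrite [_ - _ - _]addrC addrA addrK addrC subrK mulmx1.
Qed.

(** Splitting B = B P + P B gives two traces that are conjugate to each other, each computed over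
    [e] and [e']. *)
Lemma tr_res (A B : 'M[C]_n) : A ^t* = A -> B ^t* = B ->
  B *m P + P *m B = B ->
  \tr (A *m B) = (dot (e *m A) (e *m B) + dot (e' *m A) (e' *m B)) +
    Num.conj (dot (e *m A) (e *m B) + dot (e' *m A) (e' *m B)).
Proof.
move=> AH BH BT; have [_ _ PE _] := PL.
have trP (M : 'M[C]_n) : \tr (P *m M) = dot (e *m M) e + dot (e' *m M) e'.
  by rewrite PE mulmxDl mxtraceD !dot_tr.
rewrite -{1}BT mulmxDr mxtraceD rmorphD /= -!dotC; congr (_ + _).
  by rewrite mulmxA mxtrace_mulC trP !mulmxA !dotM BH.
by rewrite mxtrace_mulC -mulmxA trP !mulmxA !dotM AH.
Qed.

Lemma frame_multiples (a b : C) :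
  [/\ [/\ a *: e *m P = a *: e, a *: f *m L = a *: e & a *: f *m P = 0],
      [/\ b *: e' *m P = b *: e' & b *: e' *m L = 0] &
      [/\ dot (a *: e) (a *: f) = 0, dot (a *: e) (b *: e') = 0,
          dot (a *: f) (b *: e') = 0, dot (b *: e') (a *: e) = 0 &
          dot (a *: f) (a *: f) = dot (a *: e) (a *: e)]].
Proof.
have [[eP e'P fP] [eL e'L fL]] := frame_act.
have [[ee e'e' ff] [[ee' ef e'f] e'e fe fe']] := frame_dot.
rewrite -!scalemxAl eP fP e'P fL e'L !scaler0 !dotZl !dotZr ee' ef fe' e'e ee ff.
by rewrite !mulr0.
Qed.

Lemma frame_proj : [/\ P *m P = P, \rank P = 2%N, L *m P + P *m L = L &
  \tr (L *m L) = 2].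
Proof.
have [[eP e'P fP] [eL e'L fL]] := frame_act.
have [[ee e'e' ff] _] := frame_dot.
have [PH LH] := frame_herm; have [_ _ PE LE] := PL.
have PP : P *m P = P by rewrite {1}PE mulmxDl -!mulmxA eP e'P -PE.
have t v : \tr (v ^t* *m v) = dot v v.
  by rewrite mxtrace_mulC dotE [X in \tr X]mx11_scalar mxtrace_scalar.
have PL' : P *m L = e ^t* *m f.
  by rewrite {1}PE mulmxDl -!mulmxA eL e'L mulmx0 addr0.
split=> //.
- have := tr_idem PP; rewrite {1}PE mxtraceD !t ee e'e' -mulr2n => /esym/eqP.
  by rewrite eqr_nat => /eqP.
- have -> : L *m P = (P *m L) ^t* by rewrite hcM PH LH.
  by rewrite PL' hcM hcK LE addrC.
- by rewrite frame_K mxtraceD !t ee ff -mulr2n.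
Qed.

(** A tangent vector is determined by the images of [e] and [e'] in the complement of the plane,
    called [r] and [r'] below, and these are arbitrary: each has a component along [f] and a
    [Q]-part. The sign of [t] is the one of [jet_dots], and [r'] carries its conjugate because the
    product tested has [f] and [e'] interchanged. *)
Lemma frame_tangent (s t : C) a b : a *m Q = a -> b *m Q = b ->
  exists X, [/\ X ^t* = X, X *m P + P *m X = X & \tr (L *m X) = s + Num.conj s] /\
    [/\ dot (e *m X) f = s, dot (f *m X) e' = - t, e *m X *m Q = a &
      e' *m X *m Q = b].
Proof.
move=> aQ bQ.
have [[eP e'P fP] [eL e'L fL]] := frame_act.
have [[ee e'e' ff] [[ee' ef e'f] e'e fe fe']] := frame_dot.
have [PH LH] := frame_herm.
have [[QH QQ PQ] [eQ e'Q fQ LQ]] := frame_Q.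
have QP : Q *m P = 0 by rewrite -[LHS]hcK hcM PH QH PQ hc0.
have aP : a *m P = 0 by rewrite -aQ -mulmxA QP mulmx0.
have bP : b *m P = 0 by rewrite -bQ -mulmxA QP mulmx0.
have az v : v *m Q = 0 -> dot a v = 0.
  by move=> vQ; rewrite -aQ dotM QH vQ dot0r.
have bz v : v *m Q = 0 -> dot b v = 0.
  by move=> vQ; rewrite -bQ dotM QH vQ dot0r.
pose r := s *: f + a; pose r' := - Num.conj t *: f + b.
have rP : r *m P = 0 by rewrite mulmxDl -scalemxAl fP aP scaler0 addr0.
have r'P : r' *m P = 0 by rewrite mulmxDl -scalemxAl fP bP scaler0 addr0.
have er : dot e r = 0 by rewrite dotC dotDl dotZl fe mulr0 az// addr0 rmorph0.
have er' : dot e r' = 0.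
  by rewrite dotC dotDl dotZl fe mulr0 bz// addr0 rmorph0.
have e'r : dot e' r = 0 by rewrite dotC dotDl dotZl fe' mulr0 az// addr0 rmorph0.
have e'r' : dot e' r' = 0.
  by rewrite dotC dotDl dotZl fe' mulr0 bz// addr0 rmorph0.
have rf : dot r f = s by rewrite dotDl dotZl ff mulr1 az// addr0.
have r'f : dot r' f = - Num.conj t by rewrite dotDl dotZl ff mulr1 bz// addr0.
have rQ : r *m Q = a by rewrite mulmxDl -scalemxAl fQ aQ scaler0 add0r.
have r'Q : r' *m Q = b by rewrite mulmxDl -scalemxAl fQ bQ scaler0 add0r.
clearbody r r'.
pose M := e ^t* *m r + e' ^t* *m r'.
have MP : M *m P = 0 by rewrite mulmxDl -!mulmxA rP r'P !mulmx0 addr0.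
have PM : P *m M = M by rewrite mulmxDr !mulmxA -{1 2}PH -!hcM eP e'P.
have MH : M ^t* = r ^t* *m e + r' ^t* *m e' by rewrite hcD !hcM !hcK.
pose X := M + M ^t*.
have XH : X ^t* = X by rewrite hcD hcK addrC.
have XT : X *m P + P *m X = X.
  rewrite mulmxDl mulmxDr MP PM add0r.
  have -> : P *m M ^t* = 0 by rewrite -{1}PH -hcM MP hc0.
  have -> : M ^t* *m P = M ^t* by rewrite -{1}PH -hcM PM.
  by rewrite addr0 addrC.
have eX : e *m X = r.
  rewrite mulmxDr MH !mulmxDr !mulmxA !row_dot ee ee' er er'.
  by rewrite scale1r !scale0r !addr0.
have e'X : e' *m X = r'.
  rewrite mulmxDr MH !mulmxDr !mulmxA !row_dot e'e e'e' e'r e'r'.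
  by rewrite scale1r !scale0r add0r !addr0.
exists X; split; split=> //.
- rewrite (tr_res LH XH XT) eL e'L dot0l addr0 eX -dotC rf.
  by rewrite dotC rf addrC.
- by rewrite eX.
- by rewrite dotM XH e'X [dot f _]dotC r'f rmorphN /= conjCK.
- by rewrite eX.
- by rewrite e'X.
Qed.

Lemma dot_mid0 (A : 'M[C]_n) r s : P *m A *m P = 0 -> r *m P = r -> s *m P = s ->
  dot (r *m A) s = 0.
Proof.
move=> PAP rP sP; have [PH _] := frame_herm.
rewrite -rP -sP -{2}PH -dotM -(mulmxA r) -(mulmxA r) PAP.
by rewrite mulmx0 dot0l.
Qed.

End FrameAlgebra.

Section MoreCalculus.
Context {R : realType} {V : normedModType R} (U : set V) (oU : open U).
Local Notation C := R[i].

Lemma dmx_ext p q (F G : V -> 'M[C]_(p, q)) z u :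
  twice U F -> (forall z, U z -> F z = G z) -> U z -> dmx G z u = dmx F z u.
Proof.
move=> tF FG Uz; apply: mxd_dmx; have [dF _ _ _] := tF z Uz.
by apply: mxd_near (dF u); exact: (near_open oU).
Qed.

Lemma dmx_cst p q (A : 'M[C]_(p, q)) z u : dmx (fun _ : V => A) z u = 0.
Proof. exact/mxd_dmx/mxd_cst. Qed.

Lemma dmx_hc p q (F : V -> 'M[C]_(p, q)) z u : twice U F -> U z ->
  dmx (fun z => (F z) ^t*) z u = (dmx F z u) ^t*.
Proof. by move=> tF Uz; have [dF _ _ _] := tF z Uz; exact/mxd_dmx/mxd_hc. Qed.

Lemma dmx_mul_eq p q r (F : V -> 'M[C]_(p, q)) (G : V -> 'M[C]_(q, r))
    (H : V -> 'M[C]_(p, r)) z u : twice U F -> twice U G -> U z ->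
  (forall z, U z -> F z *m G z = H z) ->
  dmx H z u = dmx F z u *m G z + F z *m dmx G z u.
Proof.
move=> tF tG Uz FG; rewrite -(dmxM u tF tG Uz).
exact: (dmx_ext u (twiceM oU tF tG) FG Uz).
Qed.

Lemma dmx_dot0 n (a b : V -> 'rV[C]_n) z u : twice U a -> twice U b -> U z ->
  (forall z, U z -> dot (a z) (b z) = 0) ->
  dot (dmx a z u) (b z) + dot (a z) (dmx b z u) = 0.
Proof.
move=> ta tb Uz ab0.
have H : forall z, U z -> a z *m (b z) ^t* = 0.
  by move=> t Ut; rewrite [LHS]mx11_scalar -dotE ab0// raddf0.
have := @dmx_mul_eq _ _ _ a (fun z => (b z) ^t*) (fun=> 0) z u ta (twice_hc oU tb) Uz H.
rewrite dmx_cst dmx_hc// => /(congr1 (fun M : 'M[C]_1 => M 0 0)).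
by rewrite mxE [in RHS]mxE !dotE => <-.
Qed.

Lemma mxd_dot n (a b : V -> 'rV[C]_n) z v a' b' : mxd a z v a' -> mxd b z v b' ->
  is_derive z v (fun z => complex.Re (dot (a z) (b z)))
    (complex.Re (dot a' (b z) + dot (a z) b')) /\
  is_derive z v (fun z => complex.Im (dot (a z) (b z)))
    (complex.Im (dot a' (b z) + dot (a z) b')).
Proof.
move=> da db; have := mxdM da (mxd_hc db) 0 0.
have -> : (fun z => complex.Re (dot (a z) (b z))) =
    (fun z => complex.Re ((a z *m (b z) ^t*) 0 0)).
  by apply/funext => t; rewrite dotE.
have -> : (fun z => complex.Im (dot (a z) (b z))) =
    (fun z => complex.Im ((a z *m (b z) ^t*) 0 0)).
  by apply/funext => t; rewrite dotE.
by rewrite [in X in X -> _]mxE !dotE.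
Qed.

Lemma mxd_tr n (F : V -> 'M[C]_n) z v F' : mxd F z v F' ->
  is_derive z v (fun z => complex.Re (\tr (F z))) (complex.Re (\tr F')).
Proof.
move=> dF.
have -> : (fun z => complex.Re (\tr (F z))) =
    \sum_(i < n) (fun z => complex.Re (F z i i)).
  by apply/funext => t; rewrite fct_sumE /mxtrace cRe_sum.
rewrite /mxtrace cRe_sum; apply: is_derive_sum => i; by have [] := dF i i.
Qed.

Lemma is_derive_onto_line (h : V -> R) z v h' : is_derive z v h h' ->
  is_derive (0 : R) (1 : R) (fun t : R => h (z + t *: v)) h'.
Proof.
move=> [dh <-].
have E : z + (0 : R) *: v = z by rewrite scale0r addr0.
have H := @is_derive_line R V h z v 0.
by rewrite E in H; exact: H.
Qed.

Lemma is_derive_continuous (f : R -> R) t f' : is_derive t (1 : R) f f' ->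
  {for t, continuous f}.
Proof. by move=> [df _]; exact/differentiable_continuous/derivable1_diffP. Qed.

Lemma line_near z v : U z -> \forall t \near (0 : R), U (z + t *: v).
Proof.
move=> Uz; have c : {for (0 : R), continuous (fun t : R => z + t *: v)}.
  apply: continuousD; first exact: cst_continuous.
  exact: scalel_continuous.
have := c U; rewrite scale0r addr0; apply; exact: open_nbhs_nbhs.
Qed.

End MoreCalculus.

(* A hypersurface in a chart, with [L] the unit normal divided by sqrt 2; the
   last field says that the shape operator preserves D. *)
Record hypersurface_data (R : realType) (m : nat)
    (U : set 'rV[R]_(4 * m).-1) (P L : 'rV[R]_(4 * m).-1 -> 'M[R[i]]_m.+2) :
    Prop := HypersurfaceData {
  hd_open : open U;
  hd_P : twice U P;
  hd_L : twice U L;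
  hd_frame : forall z, U z -> exists e e' f, frame (P z) (L z) e e' f;
  hd_normal : forall z u, U z -> complex.Re (\tr (L z *m dmx P z u)) = 0;
  hd_immersion : forall z u, U z -> dmx P z u = 0 -> u = 0;
  hd_shape : forall z u e e' f, U z -> frame (P z) (L z) e e' f ->
    dot (e *m dmx P z u) f = 0 -> dot (e' *m dmx P z u) f = 0 ->
    dot (e *m dmx L z u) f = 0 /\ dot (e' *m dmx L z u) f = 0 }.

(** * Umbilicity *)

Section MovingFrame.
Context {R : realType} (m : nat).
Local Notation C := R[i].
Local Notation n := m.+2.
Local Notation V := 'rV[R]_(4 * m).-1.
Context (U : set V) (P L : V -> 'M[C]_n) (hd : hypersurface_data U P L).
Context (e e' : 'rV[C]_n).

Let oU := hd_open hd.
Let tP := hd_P hd.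
Let tL := hd_L hd.

(* The components of [e] along the frame vectors [g], [g'] of the point [z]
   extend [e], [e'] to a neighbourhood; see [moving_frame]. *)
Definition moving_e (z : V) := locked (e *m (P z *m (L z *m L z))).
Definition moving_e' (z : V) := locked (e' *m (P z - P z *m (L z *m L z))).
Definition moving_f (z : V) := locked (moving_e z *m L z).

Let moving_eE : moving_e = (fun z => e *m (P z *m (L z *m L z))).
Proof. by apply/funext => z; rewrite /moving_e -lock. Qed.

Let moving_e'E : moving_e' = (fun z => e' *m (P z - P z *m (L z *m L z))).
Proof. by apply/funext => z; rewrite /moving_e' -lock. Qed.

Let moving_fE : moving_f = (fun z => moving_e z *m L z).
Proof. by apply/funext => z; rewrite /moving_f -lock. Qed.

Lemma twice_PLL : twice U (fun z => P z *m (L z *m L z)).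
Proof. exact: (twiceM oU tP (twiceM oU tL tL)). Qed.

Lemma twice_moving_e : twice U moving_e.
Proof. by rewrite moving_eE; exact: (twiceM oU (twice_cst e) twice_PLL). Qed.

Lemma twice_moving_e' : twice U moving_e'.
Proof. by rewrite moving_e'E; exact: (twiceM oU (twice_cst e') (twiceB oU tP twice_PLL)). Qed.

Lemma twice_moving_f : twice U moving_f.
Proof. by rewrite moving_fE; exact: (twiceM oU twice_moving_e tL). Qed.

Lemma moving_frame z g g' h : frame (P z) (L z) g g' h ->
  [/\ moving_e z = dot e g *: g, moving_f z = dot e g *: h & moving_e' z = dot e' g' *: g'].
Proof.
move=> F; have [_ [gL _ _]] := frame_act F.
by rewrite moving_fE moving_eE moving_e'E (frame_E' F) (frame_E F) !mulmxA !row_dot -scalemxAl gL.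
Qed.

(** Only relations that survive rescaling the frame are available, since the moving frame is not
    normalized. *)
Lemma moving_frame_id z : U z ->
  [/\ [/\ moving_e z *m P z = moving_e z, moving_f z *m L z = moving_e z & moving_f z *m P z = 0],
      [/\ moving_e' z *m P z = moving_e' z & moving_e' z *m L z = 0] &
      [/\ dot (moving_e z) (moving_f z) = 0, dot (moving_e z) (moving_e' z) = 0,
          dot (moving_f z) (moving_e' z) = 0, dot (moving_e' z) (moving_e z) = 0 &
          dot (moving_f z) (moving_f z) = dot (moving_e z) (moving_e z)]].
Proof.
move=> /(hd_frame hd)[g [g' [h F]]].
have [-> -> ->] := moving_frame F; exact: frame_multiples.
Qed.

Lemma herm_dP z u : U z -> (dmx P z u) ^t* = dmx P z u.
Proof.
move=> Uz; rewrite -(dmx_hc u tP Uz).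
have FG t : U t -> P t = (P t) ^t*.
  by move=> Ut; have [g [g' [h F]]] := hd_frame hd Ut; have [E _] := frame_herm F.
exact: (dmx_ext oU u tP FG Uz).
Qed.

Lemma herm_dL z u : U z -> (dmx L z u) ^t* = dmx L z u.
Proof.
move=> Uz; rewrite -(dmx_hc u tL Uz).
have FG t : U t -> L t = (L t) ^t*.
  by move=> Ut; have [g [g' [h F]]] := hd_frame hd Ut; have [_ E] := frame_herm F.
exact: (dmx_ext oU u tL FG Uz).
Qed.

Lemma tan_dP z u : U z -> dmx P z u *m P z + P z *m dmx P z u = dmx P z u.
Proof.
move=> Uz; apply/esym/(dmx_mul_eq oU u tP tP Uz) => t Ut.
have [g [g' [h F]]] := hd_frame hd Ut; have [[gP g'P _] _] := frame_act F.
have [_ _ PE _] := F.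
by rewrite [X in X *m _]PE mulmxDl -!mulmxA gP g'P -PE.
Qed.

Lemma moving_frame_derive z u : U z ->
  [/\ dmx moving_e z u = dmx moving_e z u *m P z + moving_e z *m dmx P z u,
      dmx moving_e z u = dmx moving_f z u *m L z + moving_f z *m dmx L z u &
      dmx moving_f z u = dmx moving_e z u *m L z + moving_e z *m dmx L z u] /\
  [/\ dmx moving_f z u *m P z = - (moving_f z *m dmx P z u),
      dmx moving_e' z u = dmx moving_e' z u *m P z + moving_e' z *m dmx P z u &
      dmx moving_e' z u *m L z = - (moving_e' z *m dmx L z u)].
Proof.
move=> Uz; split; split.
- by apply: (dmx_mul_eq oU u twice_moving_e tP Uz) => t /moving_frame_id[[]].
- by apply: (dmx_mul_eq oU u twice_moving_f tL Uz) => t /moving_frame_id[[]].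
- by apply: (dmx_mul_eq oU u twice_moving_e tL Uz) => t _; rewrite moving_fE.
- apply/eqP; rewrite -addr_eq0; apply/eqP.
  have H t : U t -> moving_f t *m P t = 0 by move=> /moving_frame_id[[]].
  by rewrite -(dmx_mul_eq oU u twice_moving_f tP Uz H) dmx_cst.
- by apply: (dmx_mul_eq oU u twice_moving_e' tP Uz) => t /moving_frame_id[_ []].
- apply/eqP; rewrite -addr_eq0; apply/eqP.
  have H t : U t -> moving_e' t *m L t = 0 by move=> /moving_frame_id[_ []].
  by rewrite -(dmx_mul_eq oU u twice_moving_e' tL Uz H) dmx_cst.
Qed.

Lemma moving_frame_derive_dot z u : U z ->
  [/\ dot (dmx moving_e z u) (moving_f z) = dot (moving_e z *m dmx P z u) (moving_f z),
      dot (dmx moving_f z u) (moving_e' z) = - dot (moving_f z *m dmx P z u) (moving_e' z) &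
      dot (dmx moving_e z u) (moving_e' z) = dot (moving_f z *m dmx L z u) (moving_e' z)].
Proof.
move=> Uz; have [[dx1 dx2 _] [dy1 _ _]] := moving_frame_derive u Uz.
have [[_ _ yP] [x'P x'L] _] := moving_frame_id Uz.
have [g [g' [h F]]] := hd_frame hd Uz; have [PH LH] := frame_herm F.
split.
- by rewrite {1}dx1 dotDl dotM PH yP dot0r add0r.
- by rewrite -{1}x'P -PH -dotM dy1 -scaleN1r dotZl mulN1r.
- by rewrite {1}dx2 dotDl dotM LH x'L dot0r add0r.
Qed.

Lemma normal_dot z u g g' h : U z -> frame (P z) (L z) g g' h ->
  complex.Re (dot (g *m dmx P z u) h) = 0.
Proof.
move=> Uz F; have [PH LH] := frame_herm F.
have := hd_normal hd u Uz.
rewrite (tr_res F LH (herm_dP u Uz) (tan_dP u Uz)).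
have [_ [-> -> _]] := frame_act F.
rewrite dot0l addr0 -dotC cReD [dot h _]dotC cReJ => H; lra.
Qed.

(** Invariance of D read in the moving frame on the whole open set: where the three real forms of D
    vanish, so does <de, e'>. The moving vectors are nonzero multiples of a frame, so the scale
    factors can be cancelled. *)
Lemma near_kernel z u : U z -> moving_e z != 0 -> moving_e' z != 0 ->
  complex.Im (dot (dmx moving_e z u) (moving_f z)) = 0 ->
  dot (dmx moving_f z u) (moving_e' z) = 0 -> dot (dmx moving_e z u) (moving_e' z) = 0.
Proof.
move=> Uz; have [g [g' [h F]]] := hd_frame hd Uz.
have [d1 d2 d3] := moving_frame_derive_dot u Uz; rewrite d1 d2 d3 {d1 d2 d3}.
have [-> -> ->] := moving_frame F; rewrite 3!dot_scale_mul.
move=> /scale_neq0 mu0 /scale_neq0 mu'0 H1 H2.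
(* The real part vanishes by normality; the imaginary part is the hypothesis, since the scale factor
   mu conj(mu) is real and positive. *)
have s0 : dot (g *m dmx P z u) h = 0.
  apply: complex_eq; first exact: (normal_dot u Uz F).
  move: H1 (mul_conj_gt0 mu0).
  move: (dot (g *m dmx P z u) h) (dot e g * Num.conj (dot e g)) => s [a b] H1.
  rewrite ltcE /= => /andP[/eqP b0 a0]; move: H1; rewrite cImM /= b0 mul0r addr0.
  by move=> /eqP; rewrite mulf_eq0 (gt_eqF a0) => /eqP.
have t0 : dot (g' *m dmx P z u) h = 0.
  rewrite dotM (herm_dP u Uz) dotC.
  by move/eqP: H2; rewrite oppr_eq0 => /eqP/(mul_conj_eq0 mu0 mu'0) ->; rewrite rmorph0.
have [_ H] := hd_shape hd Uz F s0 t0.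
by rewrite [dot (h *m _) _]dotM (herm_dL u Uz) [dot h _]dotC H rmorph0 mulr0.
Qed.

End MovingFrame.

Section Jet.
Context {R : realType} (n : nat) (V : lmodType R).
Local Notation C := R[i].
Context (P L : 'M[C]_n) (e e' f : 'rV[C]_n) (F : frame P L e e' f).
Context (dP dL : V -> 'M[C]_n) (dx dx' dy : V -> 'rV[C]_n).

(* First-order data at a point: [dP], [dL] are the derivatives of the plane and
   of the normal, [dx], [dx'], [dy] those of a moving frame that equals
   [e], [e'], [f] at the point. *)
Record jet : Prop := Jet {
  j_x1 : forall u, dx u = dx u *m P + e *m dP u;
  j_x2 : forall u, dx u = dy u *m L + f *m dL u;
  j_y1 : forall u, dy u = dx u *m L + e *m dL u;
  j_y2 : forall u, dy u *m P = - (f *m dP u);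
  j_x'1 : forall u, dx' u = dx' u *m P + e' *m dP u;
  j_x'2 : forall u, dx' u *m L = - (e' *m dL u);
  j_xx' : forall u, dot (dx u) e' + dot e (dx' u) = 0;
  j_xy : forall u, dot (dx u) f + dot e (dy u) = 0;
  j_hP : forall u, (dP u) ^t* = dP u;
  j_hL : forall u, (dL u) ^t* = dL u;
  j_tP : forall u, dP u *m P + P *m dP u = dP u;
  j_surj : forall X, X ^t* = X -> X *m P + P *m X = X ->
    complex.Re (\tr (L *m X)) = 0 -> exists u, dP u = X;
  j_shape : forall u, dot (e *m dP u) f = 0 -> dot (e' *m dP u) f = 0 ->
    dot (e *m dL u) f = 0 /\ dot (e' *m dL u) f = 0;
  j_sym : forall u v, complex.Re (\tr (dL u *m dP v)) =
    complex.Re (\tr (dL v *m dP u)) }.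

Context (J : jet).
Let Q := 1%:M - P - f ^t* *m f.

Lemma jet_dots u :
  [/\ dot (dx u) f = dot (e *m dP u) f,
      dot (dy u) e' = - dot (f *m dP u) e',
      dot (dx u) e' = dot (f *m dL u) e' &
      dot (dy u) e' = dot (e *m dL u) e'].
Proof.
have [PH LH] := frame_herm F.
have [[_ e'P fP] [_ e'L _]] := frame_act F.
split.
- by rewrite (j_x1 J u) dotDl dotM PH fP dot0r add0r.
- by rewrite -{1}e'P -PH -dotM (j_y2 J u) -scaleN1r dotZl mulN1r.
- by rewrite (j_x2 J u) dotDl dotM LH e'L dot0r add0r.
- by rewrite (j_y1 J u) dotDl dotM LH e'L dot0r add0r.
Qed.

Lemma jet_proj u :
  [/\ dx u *m Q = e *m dP u *m Q, dx' u *m Q = e' *m dP u *m Q,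
      dy u *m Q = e *m dL u *m Q, dx u *m Q = f *m dL u *m Q &
      e' *m dL u *m Q = 0].
Proof.
have [[_ _ PQ] [_ _ _ LQ]] := frame_Q F; rewrite -/Q in PQ LQ.
have Z (r s : 'rV[C]_n) (A : 'M[C]_n) : A *m Q = 0 -> (r *m A + s) *m Q = s *m Q.
  by move=> AQ; rewrite mulmxDl -mulmxA AQ mulmx0 add0r.
split.
- by rewrite (j_x1 J u) Z.
- by rewrite (j_x'1 J u) Z.
- by rewrite (j_y1 J u) Z.
- by rewrite (j_x2 J u) Z.
- by apply/eqP; rewrite -oppr_eq0 -mulNmx -(j_x'2 J u) -mulmxA LQ mulmx0.
Qed.

(** A purely imaginary [s] is exactly orthogonality to the normal, so the tangent vector of
    [frame_tangent] lies in the image of [dP]. *)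
Lemma jet_tangent (s t : C) (a b : 'rV[C]_n) :
  complex.Re s = 0 -> a *m Q = a -> b *m Q = b ->
  exists u, [/\ dot (dx u) f = s, dot (dy u) e' = t, dx u *m Q = a &
    dx' u *m Q = b].
Proof.
move=> s0 aQ bQ.
have [X [[XH XT XL] [Xf Xe' XQ X'Q]]] := frame_tangent F s t aQ bQ.
have [|u uX] := j_surj J XH XT; first by rewrite XL cReD cReJ s0 addr0.
have [d1 d2 _ _] := jet_dots u; have [d4 d5 _ _ _] := jet_proj u.
by exists u; rewrite d1 d2 d4 d5 uX Xf Xe' XQ X'Q opprK.
Qed.

(** The distribution D: by [jet_dots] the two products are those of [dP u] between [e], [e'] and
    [f], up to sign and conjugation. *)
Definition inD u := dot (dx u) f = 0 /\ dot (dy u) e' = 0.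

Let dotC0 (a b : 'rV[C]_n) : dot a b = 0 -> dot b a = 0.
Proof. by rewrite [dot b a]dotC => ->; rewrite rmorph0. Qed.

Lemma inD_facts u : inD u ->
  [/\ dot (e *m dP u) f = 0, dot (e' *m dP u) f = 0,
      dot (e *m dL u) f = 0 & dot (e' *m dL u) f = 0] /\
  [/\ dot (dx u) e' = 0, dot (dx' u) e = 0,
      dot (dx' u) f = 0 & dot (dy u) e = 0].
Proof.
move=> [xf ye']; have [d1 d2 d3 d4] := jet_dots u.
have s0 : dot (e *m dP u) f = 0 by rewrite -d1.
have t0 : dot (e' *m dP u) f = 0.
  rewrite dotM (j_hP J); apply: dotC0.
  by apply/eqP; rewrite -oppr_eq0 -d2 ye'.
have [s1 t1] := j_shape J s0 t0.
have xe' : dot (dx u) e' = 0.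
  by rewrite d3 dotM (j_hL J); apply: dotC0.
have x'e : dot (dx' u) e = 0.
  by have := j_xx' J u; rewrite xe' add0r => /dotC0.
have ye : dot (dy u) e = 0.
  by have := j_xy J u; rewrite xf add0r => /dotC0.
have [PH _] := frame_herm F; have [[_ _ fP] _] := frame_act F.
have x'f : dot (dx' u) f = 0.
  by rewrite (j_x'1 J u) dotDl dotM PH fP dot0r add0r.
by [].
Qed.

(** For each of [e], [e'], [f] one of the two factors has no component along it, so only the
    [Q]-parts contribute. *)
Lemma inD_dots u v : inD u -> inD v ->
  [/\ dot (dx u) (dx' v) = dot (dx u *m Q) (dx' v *m Q),
      dot (dy u) (dx' v) = dot (dy u *m Q) (dx' v *m Q) &
      dot (dx u) (dy v) = dot (dx u *m Q) (dy v *m Q)].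
Proof.
move=> Du Dv; have [xf ye'] := Du.
have [_ [xe' _ _ _]] := inD_facts Du.
have [_ [_ vx'e vx'f vye]] := inD_facts Dv.
split.
- exact: dot_res0 F _ _ (or_intror vx'e) (or_introl xe') (or_introl xf).
- exact: dot_res0 F _ _ (or_intror vx'e) (or_introl ye') (or_intror vx'f).
- exact: dot_res0 F _ _ (or_intror vye) (or_introl xe') (or_introl xf).
Qed.

Let double_inj (a b : R) : a + a = b + b -> a = b.
Proof. by move=> ?; lra. Qed.

(** Symmetry of the shape operator against a vector of D: the components along [f] drop out, and
    each trace becomes twice the real part of the product of [Q]-parts. *)
Lemma jet_sym u v : inD v -> complex.Re (dot (dy u *m Q) (dx v *m Q)) =
  complex.Re (dot (dx u *m Q) (dy v *m Q)).
Proof.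
move=> Dv; have [[vs0 vt0 vs1 vt1] _] := inD_facts Dv.
have [PP _ _ _] := frame_proj F.
have zero w r s := @dot_mid0 _ _ _ _ _ _ _ F (dP w) r s (PNP0 PP (j_tP J w)).
have [[eP e'P fP] _] := frame_act F.
have expand w w' :
    dot (e *m dL w) f = 0 \/ dot (e *m dP w') f = 0 ->
    dot (e' *m dL w) f = 0 \/ dot (e' *m dP w') f = 0 ->
    complex.Re (\tr (dL w *m dP w')) =
    complex.Re (dot (dy w *m Q) (dx w' *m Q)) + complex.Re (dot (dy w *m Q) (dx w' *m Q)).
  move=> h1 h2.
  rewrite (tr_res F (j_hL J w) (j_hP J w') (j_tP J w')).
  rewrite (dot_res0 F (or_intror (zero w' e e eP eP))
    (or_intror (zero w' e e' eP e'P)) h1).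
  rewrite (dot_res0 F (or_intror (zero w' e' e e'P eP))
    (or_intror (zero w' e' e' e'P e'P)) h2).
  have [_ _ dY _ d0] := jet_proj w; have [dX' _ _ _ _] := jet_proj w'.
  by rewrite -/Q d0 dot0l addr0 -dY -dX' cReD cReJ.
have := j_sym J u v.
rewrite (expand u v (or_intror vs0) (or_intror vt0)).
rewrite (expand v u (or_introl vs1) (or_introl vt1)) [dot (dy v *m Q) _]dotC cReJ.
exact: double_inj.
Qed.

(** The conclusion is written in [P] and [L] alone, so it no longer depends on the frame. As 1 - L^2
    = e'^*e' + Q, two components have to be compared: the [Q]-part comes from [umbilic_of_codazzi],
    and the [e']-part from [psi0] once c1 = 0 and c3 = i c2 are known. *)
Lemma jet_umbilic (c1 c2 c3 : C) (q : 'rV[C]_n) :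
  (forall a u v, dx (a *: u + v) = a%:C *: dx u + dx v) ->
  (forall a u v, dy (a *: u + v) = a%:C *: dy u + dy v) ->
  q != 0 -> q *m Q = q ->
  (forall u, dot (dx u) e' = c1 * (complex.Im (dot (dx u) f))%:C +
    c2 * (complex.Re (dot (dy u) e'))%:C + c3 * (complex.Im (dot (dy u) e'))%:C) ->
  (forall u v, inD u -> inD v ->
     dot (dx u) (dx' v) - dot (dx v) (dx' u) =
     c1 * (complex.Im (dot (dx u) (dy v) - dot (dx v) (dy u)))%:C +
     c2 * (complex.Re (dot (dy u) (dx' v) - dot (dy v) (dx' u)))%:C +
     c3 * (complex.Im (dot (dy u) (dx' v) - dot (dy v) (dx' u)))%:C) ->
  exists l : R, l != 0 /\ forall u,
    P *m (L *m L) *m dL u *m (1%:M - L *m L) =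
    l%:C *: (P *m (L *m L) *m L *m dL u *m (1%:M - L *m L)).
Proof.
move=> linx liny q0 qQ psi0 main.
have [[_ QQ _] [eQ e'Q fQ LQ]] := frame_Q F; rewrite -/Q in QQ eQ e'Q fQ LQ.
have subl (g : V -> 'rV[C]_n) : (forall a u v, g (a *: u + v) = a%:C *: g u + g v) ->
    forall u v, g (u - v) = g u - g v.
  by move=> lin u v; rewrite -[- v]scaleN1r addrC lin rmorphN1 scaleN1r addrC.
have Dsub u v : inD u -> inD v -> inD (u - v).
  move=> [u1 u2] [v1 v2].
  by split; rewrite (subl dx linx, subl dy liny) -scaleN1r dotDl dotZl ?u1 ?v1 ?u2 ?v2 mulr0 addr0.
have surj a b : a *m Q = a -> b *m Q = b ->
    exists u, [/\ inD u, dx u *m Q = a & dx' u *m Q = b].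
  by move=> aQ bQ; have [u [? ? ? ?]] := @jet_tangent 0 0 a b erefl aQ bQ; exists u.
have sx u v : dx (u - v) *m Q = dx u *m Q - dx v *m Q by rewrite (subl _ linx) mulmxBl.
have sy u v : dy (u - v) *m Q = dy u *m Q - dy v *m Q by rewrite (subl _ liny) mulmxBl.
have PQ' (g : V -> 'rV[C]_n) u : g u *m Q *m Q = g u *m Q by rewrite -mulmxA QQ.
have main' u v : inD u -> inD v ->
     dot (dx u *m Q) (dx' v *m Q) - dot (dx v *m Q) (dx' u *m Q) =
     c1 * (complex.Im (dot (dx u *m Q) (dy v *m Q) - dot (dx v *m Q) (dy u *m Q)))%:C +
     c2 * (complex.Re (dot (dy u *m Q) (dx' v *m Q) - dot (dy v *m Q) (dx' u *m Q)))%:C +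
     c3 * (complex.Im (dot (dy u *m Q) (dx' v *m Q) - dot (dy v *m Q) (dx' u *m Q)))%:C.
  move=> Du Dv; have := main u v Du Dv.
  by have [-> -> ->] := inD_dots Du Dv; have [-> -> ->] := inD_dots Dv Du.
have [l [l0 YX [c10 c2E c3E]]] := @umbilic_of_codazzi R n Q q V inD
  (fun u => dx u *m Q) (fun u => dx' u *m Q) (fun u => dy u *m Q) c1 c2 c3 q0 qQ
  (PQ' dy) (PQ' dx) Dsub sx sy surj jet_sym main'.
exists l; split=> // u.
have key : e *m dL u *m (1%:M - L *m L) = l%:C *: (f *m dL u *m (1%:M - L *m L)).
  have [_ _ d3 d4] := jet_dots u; have [_ _ dY dX _] := jet_proj u.
  have E : c2 * (complex.Re (dot (dy u) e'))%:C + 'i * c2 * (complex.Im (dot (dy u) e'))%:C =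
      c2 * dot (dy u) e'.
    by rewrite [dot _ _ in RHS]complexE mulrDr [c2 * ('i * _)]mulrCA mulrA.
  have D : dot (dy u) e' = l%:C * dot (dx u) e'.
    by rewrite (psi0 u) c10 c3E mul0r add0r E c2E mulrA -rmorphM mulfV// rmorph1 mul1r.
  rewrite (frame_Q' F) -/Q ![_ *m (_ + Q)]mulmxDr scalerDr.
  rewrite ![_ *m (_ *m e')]mulmxA !row_dot scalerA -d3 -d4 D -dY -dX.
  by rewrite (YX u).
have [_ [eL _ _]] := frame_act F.
have -> : P *m (L *m L) *m dL u *m (1%:M - L *m L) =
    e ^t* *m (e *m dL u *m (1%:M - L *m L)) by rewrite (frame_E F) !mulmxA.
have -> : P *m (L *m L) *m L *m dL u *m (1%:M - L *m L) =
    e ^t* *m (f *m dL u *m (1%:M - L *m L)).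
  by rewrite (frame_E F) -(mulmxA _ e L) eL !mulmxA.
by rewrite key -scalemxAr.
Qed.

End Jet.

Lemma Re2_neq0 (R : realType) : complex.Re (2 : R[i]) != 0.
Proof. by rewrite -[2]/(1 + 1) cReD /= -mulr2n pnatr_eq0. Qed.

Lemma complex_comb (R : realType) (z c1 c2 c3 : R[i]) (r1 r2 r3 : R) :
  complex.Re z = r1 * complex.Re c1 + r2 * complex.Re c2 + r3 * complex.Re c3 ->
  complex.Im z = r1 * complex.Im c1 + r2 * complex.Im c2 + r3 * complex.Im c3 ->
  z = c1 * r1%:C + c2 * r2%:C + c3 * r3%:C.
Proof.
move=> Hr Hi; rewrite ![_ * _%:C]mulrC.
by apply: complex_eq; rewrite !(cReD, cImD) !(cReZ, cImZ).
Qed.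

(** [s], [t] and [o] stand for terms with second derivatives; they agree in both hypotheses by the
    symmetry of mixed derivatives, and subtraction removes them. *)
Lemma antisymmetrize (R : realType) (c1 c2 c3 s t o p p' q q' r r' : R[i]) :
  s + p = c1 * (complex.Im (t + q))%:C + c2 * (complex.Re (o + r))%:C +
    c3 * (complex.Im (o + r))%:C ->
  s + p' = c1 * (complex.Im (t + q'))%:C + c2 * (complex.Re (o + r'))%:C +
    c3 * (complex.Im (o + r'))%:C ->
  p - p' = c1 * (complex.Im (q - q'))%:C + c2 * (complex.Re (r - r'))%:C +
    c3 * (complex.Im (r - r'))%:C.
Proof.
rewrite !(cReD, cImD, cReN, cImN) !(rmorphD, rmorphN) /= => H H'.
have -> : p - p' = (s + p) - (s + p') by rewrite opprD addrACA subrr add0r.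
rewrite H H'; move: (_%:C) (_%:C) (_%:C) (_%:C) (_%:C) (_%:C) (_%:C) (_%:C) (_%:C).
by move=> *; ring.
Qed.

(** The projection onto the complement of the frame has trace (m + 2) - 2 - 1 = m - 1, which is
    nonzero. *)
Lemma frame_complement (C : numClosedFieldType) m (P L : 'M[C]_m.+2) e e' f :
  (1 < m)%N -> frame P L e e' f ->
  exists2 q : 'rV[C]_m.+2, q != 0 & q *m (1%:M - P - f ^t* *m f) = q.
Proof.
move=> m1 F; have [PP Pr LT L2] := frame_proj F.
have [[ee e'e' ff] _] := frame_dot F.
have [[QH QQ PQ] _] := frame_Q F.
set Q := 1%:M - P - f ^t* *m f in QH QQ PQ *.
have Q0 : Q != 0.
  apply/eqP => Q0; have : \tr Q = 0 by rewrite Q0 mxtrace0.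
  rewrite /Q !raddfB /= mxtrace1 tr_idem// Pr.
  have -> : \tr (f ^t* *m f) = 1.
    by rewrite -[f ^t* *m f]mulmx1 dot_tr mulmx1.
  move=> /eqP; rewrite -addrA -opprD subr_eq0 -[1]/(1%:R) -natrD eqr_nat.
  by rewrite addn1 !eqSS => /eqP mE; move: m1; rewrite mE.
have /existsP[i qi] : [exists i, row i Q != 0].
  apply: contraNT Q0; rewrite negb_exists => /forallP H.
  by apply/eqP/row_matrixP => i; rewrite row0; apply/eqP; have := H i; rewrite negbK.
by exists (row i Q); rewrite // -row_mul QQ.
Qed.

Section Umbilicity.
Context {R : realType} (m : nat).
Local Notation C := R[i].
Local Notation n := m.+2.
Local Notation V := 'rV[R]_(4 * m).-1.
Context (U : set V) (P L : V -> 'M[C]_n) (hd : hypersurface_data U P L).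
Context (x0 : V) (Ux : U x0) (e e' f : 'rV[C]_n).
Context (F : frame (P x0) (L x0) e e' f).

Let oU := hd_open hd.
Let tP := hd_P hd.
Let tL := hd_L hd.
Local Notation x := (moving_e P L e).
Local Notation x' := (moving_e' P L e').
Local Notation y := (moving_f P L e).
Let tx := twice_moving_e hd e.
Let tx' := twice_moving_e' hd e'.
Let ty := twice_moving_f hd e.

Lemma moving_frame_at : [/\ x x0 = e, y x0 = f & x' x0 = e'].
Proof.
have [-> -> ->] := moving_frame e e' F.
by have [[-> -> _] _] := frame_dot F; rewrite !scale1r.
Qed.

Lemma linear_of_twice p q (G : V -> 'M[C]_(p, q)) z a u v : twice U G -> U z ->
  dmx G z (a *: u + v) = a%:C *: dmx G z u + dmx G z v.
Proof. by move=> tG Uz; have [_ _ _ l] := tG z Uz; exact: l. Qed.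

(** Differentiating Re tr (L dP) = 0 turns the symmetry of the second derivatives of [P] into the
    symmetry of the shape operator. *)
Lemma trace_sym u v : complex.Re (\tr (dmx L x0 u *m dmx P x0 v)) =
  complex.Re (\tr (dmx L x0 v *m dmx P x0 u)).
Proof.
have [dP ddP symP _] := tP Ux; have [dL _ _ _] := tL Ux.
have D a b : is_derive x0 b (fun z => complex.Re (\tr (L z *m dmx P z a)))
    (complex.Re (\tr (dmx L x0 b *m dmx P x0 a +
      L x0 *m dmx (fun z => dmx P z a) x0 b))).
  exact: mxd_tr (mxdM (dL b) (ddP a b)).
have Z a b : complex.Re (\tr (dmx L x0 b *m dmx P x0 a)) +
    complex.Re (\tr (L x0 *m dmx (fun z => dmx P z a) x0 b)) = 0.
  have H : \forall z \near x0,
      (fun=> 0) z = complex.Re (\tr (L z *m dmx P z a)).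
    by apply: (near_open oU Ux) => z Uz; rewrite (hd_normal hd a Uz).
  have [_ H1] := near_eq_is_derive H (is_derive_cst (0 : R) x0 b).
  have [_ H2] := D a b.
  by rewrite -cReD -mxtraceD; exact: etrans (esym H2) H1.
apply: (addIr (complex.Re (\tr (L x0 *m dmx (fun z => dmx P z u) x0 v)))).
apply: etrans (esym (Z u v)); apply: etrans (Z v u).
exact: (f_equal (fun A : 'M[C]_n => complex.Re (\tr (dmx L x0 u *m dmx P x0 v)) +
  complex.Re (\tr (L x0 *m A))) (symP u v)).
Qed.

Lemma jet_at : (0 < m)%N ->
  jet (P x0) (L x0) e e' f (dmx P x0) (dmx L x0) (dmx x x0) (dmx x' x0) (dmx y x0).
Proof.
move=> m0; have [x0E y0E x'0E] := moving_frame_at.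
have [PP Pr LT L2] := frame_proj F; have [PH LH] := frame_herm F.
have dm u := moving_frame_derive hd e e' u Ux.
have H1 z : U z -> dot (x z) (x' z) = 0.
  by move=> Uz; have [_ _ [_ H _ _ _]] := moving_frame_id hd e e' Uz; exact: H.
have H2 z : U z -> dot (x z) (y z) = 0.
  by move=> Uz; have [_ _ [H _ _ _ _]] := moving_frame_id hd e e' Uz; exact: H.
split.
- by move=> u; have [[H _ _] _] := dm u; rewrite x0E in H; exact: H.
- by move=> u; have [[_ H _] _] := dm u; rewrite y0E in H; exact: H.
- by move=> u; have [[_ _ H] _] := dm u; rewrite x0E in H; exact: H.
- by move=> u; have [_ [H _ _]] := dm u; rewrite y0E in H; exact: H.
- by move=> u; have [_ [_ H _]] := dm u; rewrite x'0E in H; exact: H.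
- by move=> u; have [_ [_ _ H]] := dm u; rewrite x'0E in H; exact: H.
- by move=> u; have H := dmx_dot0 oU u tx tx' Ux H1; rewrite x0E x'0E in H; exact: H.
- by move=> u; have H := dmx_dot0 oU u tx ty Ux H2; rewrite x0E y0E in H; exact: H.
- by move=> u; exact: (herm_dP hd u Ux).
- by move=> u; exact: (herm_dL hd u Ux).
- by move=> u; exact: (tan_dP hd u Ux).
- move=> X XH XT XL0.
  have L0 : complex.Re (\tr (L x0 *m L x0)) != 0 by rewrite L2 Re2_neq0.
  have lin a u v := linear_of_twice a u v tP Ux.
  exact: tangent_image m0 (And3 PH PP Pr) (conj LH LT) L0 lin
    (fun u => conj (herm_dP hd u Ux) (tan_dP hd u Ux))
    (fun u => hd_normal hd u Ux) (fun u => hd_immersion hd Ux) X (conj XH XT) XL0.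
- by move=> u; exact: (hd_shape hd Ux F).
- exact: trace_sym.
Qed.

Lemma second_order (a b : V -> 'rV[C]_n) u v : twice U a -> twice U b ->
  [/\ is_derive (0 : R) (1 : R)
        (fun t : R => complex.Re (dot (dmx a (x0 + t *: v) u) (b (x0 + t *: v))))
        (complex.Re (dot (dmx (fun z => dmx a z u) x0 v) (b x0) +
           dot (dmx a x0 u) (dmx b x0 v))) &
      is_derive (0 : R) (1 : R)
        (fun t : R => complex.Im (dot (dmx a (x0 + t *: v) u) (b (x0 + t *: v))))
        (complex.Im (dot (dmx (fun z => dmx a z u) x0 v) (b x0) +
           dot (dmx a x0 u) (dmx b x0 v)))].
Proof.
move=> ta tb; have [_ dda _ _] := ta x0 Ux; have [db _ _ _] := tb x0 Ux.
have [H1 H2] := mxd_dot (dda u v) (db v).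
split.
  exact: (@is_derive_onto_line _ _ (fun z => complex.Re (dot (dmx a z u) (b z)))).
exact: (@is_derive_onto_line _ _ (fun z => complex.Im (dot (dmx a z u) (b z)))).
Qed.

Lemma first_order_near (a : V -> 'rV[C]_n) v : twice U a -> a x0 != 0 ->
  \forall t \near (0 : R), a (x0 + t *: v) != 0.
Proof.
move=> ta a0; have [da _ _ _] := ta x0 Ux.
have [H _] := mxd_dot (da v) (da v).
have H' := @is_derive_onto_line _ _ (fun z => complex.Re (dot (a z) (a z))) _ _ _ H.
have c := is_derive_continuous H'.
have n0 : complex.Re (dot (a (x0 + 0 *: v)) (a (x0 + 0 *: v))) != 0.
  by rewrite scale0r addr0; apply: contra_neq a0 => /dot_Re0.
have N := cvgr_neq0 _ c n0 .
have {}N := N (nbhs_filter (0 : R)).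
apply: filterS N => t; apply: contra_neq => ->; rewrite dot0l //.
Qed.

Lemma umbilic_at : (1 < m)%N -> exists l : R, l != 0 /\ forall u,
  P x0 *m (L x0 *m L x0) *m dmx L x0 u *m (1%:M - L x0 *m L x0) =
  l%:C *: (P x0 *m (L x0 *m L x0) *m L x0 *m dmx L x0 u *m (1%:M - L x0 *m L x0)).
Proof.
move=> m1; have m0 : (0 < m)%N by exact: ltnW.
have J := jet_at m0; have [x0E y0E x'0E] := moving_frame_at.
have [PP Pr LT L2] := frame_proj F.
have [[ee e'e' ff] [[ee' ef e'f] e'e fe fe']] := frame_dot F.
have [[QH QQ PQ] [eQ e'Q fQ LQ]] := frame_Q F.
pose Q := 1%:M - P x0 - f ^t* *m f; rewrite -/Q in QQ QH PQ eQ e'Q fQ LQ.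
have tan s t := fun h => @jet_tangent R n V (P x0) (L x0) e e' f F _ _ _ _ _ J s t 0 0 h
  (mul0mx _ Q) (mul0mx _ Q).
(* [w0], [w1], [w2] are dual to the three real forms of D; the first value is i because <de, f> has
   no real part. *)
have [w0 [w0x w0y _ _]] := tan 'i 0 erefl.
have [w1 [w1x w1y _ _]] := tan 0 1 erefl.
have [w2 [w2x w2y _ _]] := tan 0 'i erefl.
have s3r (a b : V -> 'rV[C]_n) z : twice U a -> U z ->
    real_form (fun u => complex.Re (dot (dmx a z u) (b z))).
  move=> ta Uz r u v; rewrite linear_of_twice //.
  by rewrite dotDl dotZl cReD cReZ.
have s3i (a b : V -> 'rV[C]_n) z : twice U a -> U z ->
    real_form (fun u => complex.Im (dot (dmx a z u) (b z))).
  move=> ta Uz r u v; rewrite linear_of_twice //.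
  by rewrite dotDl dotZl cImD cImZ.
pose Y0 u := complex.Im (dot (dmx x x0 u) (y x0)).
pose Y1 u := complex.Re (dot (dmx y x0 u) (x' x0)).
pose Y2 u := complex.Im (dot (dmx y x0 u) (x' x0)).
have v0 : [/\ Y0 w0 = 1, Y1 w0 = 0 & Y2 w0 = 0].
  by rewrite /Y0 /Y1 /Y2 y0E x'0E w0x w0y.
have v1 : [/\ Y0 w1 = 0, Y1 w1 = 1 & Y2 w1 = 0].
  by rewrite /Y0 /Y1 /Y2 y0E x'0E w1x w1y.
have v2 : [/\ Y0 w2 = 0, Y1 w2 = 0 & Y2 w2 = 1].
  by rewrite /Y0 /Y1 /Y2 y0E x'0E w2x w2y.
have ker z u : U z -> x z != 0 -> x' z != 0 ->
    complex.Im (dot (dmx x z u) (y z)) = 0 -> complex.Re (dot (dmx y z u) (x' z)) = 0 ->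
    complex.Im (dot (dmx y z u) (x' z)) = 0 -> dot (dmx x z u) (x' z) = 0.
  move=> Uz xz x'z h0 h1 h2.
  have h3 : dot (dmx y z u) (x' z) = 0 by apply: complex_eq.
  exact: (near_kernel hd Uz xz x'z h0 h3).
have x00 : x x0 != 0 by rewrite x0E; apply: contra_neq (oner_neq0 C) => e0; rewrite -ee e0 dot0l.
have x'00 : x' x0 != 0 by rewrite x'0E; apply: contra_neq (oner_neq0 C) => e0; rewrite -e'e' e0 dot0l.
(* The coefficients of <de, e'> in terms of the three forms are its values on the dual vectors. *)
set c1 := dot (dmx x x0 w0) e'; set c2 := dot (dmx x x0 w1) e'.
set c3 := dot (dmx x x0 w2) e'.
have psi0 u : dot (dmx x x0 u) e' = c1 * (complex.Im (dot (dmx x x0 u) f))%:C +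
    c2 * (complex.Re (dot (dmx y x0 u) e'))%:C + c3 * (complex.Im (dot (dmx y x0 u) e'))%:C.
  have k1 := kernel_combination3 u (And4 (s3i x y x0 tx Ux) (s3r y x' x0 ty Ux) (s3i y x' x0 ty Ux)
    (s3r x x' x0 tx Ux)) (fun u h0 h1 h2 => congr1 (@complex.Re R) (ker x0 u Ux x00 x'00 h0 h1 h2)) v0 v1 v2.
  have k2 := kernel_combination3 u (And4 (s3i x y x0 tx Ux) (s3r y x' x0 ty Ux) (s3i y x' x0 ty Ux)
    (s3i x x' x0 tx Ux)) (fun u h0 h1 h2 => congr1 (@complex.Im R) (ker x0 u Ux x00 x'00 h0 h1 h2)) v0 v1 v2.
  by move: k1 k2; rewrite /= y0E x'0E; exact: complex_comb.
have [q q0 qQ] := frame_complement m1 F; rewrite -/Q in qQ.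
have lx a u v := linear_of_twice a u v tx Ux.
have ly a u v := linear_of_twice a u v ty Ux.
apply: (jet_umbilic F J lx ly q0 qQ psi0) => u v Du Dv.
(* The derivative of [psi0] along [v'] at a fixed [u'] of D. Derivatives of the coefficients would
   be multiplied by forms that vanish at [u'], so only [c1], [c2], [c3] themselves appear. *)
have E u' v' : inD e' f (dmx x x0) (dmx y x0) u' ->
    dot (dmx (fun z => dmx x z u') x0 v') e' + dot (dmx x x0 u') (dmx x' x0 v') =
    c1 * (complex.Im (dot (dmx (fun z => dmx x z u') x0 v') f + dot (dmx x x0 u') (dmx y x0 v')))%:C +
    c2 * (complex.Re (dot (dmx (fun z => dmx y z u') x0 v') e' + dot (dmx y x0 u') (dmx x' x0 v')))%:C +
    c3 * (complex.Im (dot (dmx (fun z => dmx y z u') x0 v') e' + dot (dmx y x0 u') (dmx x' x0 v')))%:C.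
  move=> [Du1 Du2].
  have nearH : \forall t \near (0 : R), [/\ U (x0 + t *: v'), x (x0 + t *: v') != 0 &
      x' (x0 + t *: v') != 0].
    have h1 := line_near oU v' Ux; have h2 := first_order_near v' tx x00.
    have h3 := first_order_near v' tx' x'00.
    by apply: filterS (filterI h1 (filterI h2 h3)) => t [? [? ?]].
  (* [gc] selects the real or the imaginary part of the complex relation, to which the real
     [kernel_derive3] is applied. *)
  have k (g : C -> R) (gc : bool) : g = (if gc then @complex.Re R else @complex.Im R) ->
      g (dot (dmx (fun z => dmx x z u') x0 v') e' + dot (dmx x x0 u') (dmx x' x0 v')) =
      complex.Im (dot (dmx (fun z => dmx x z u') x0 v') f + dot (dmx x x0 u') (dmx y x0 v'))
        * g c1 +
      complex.Re (dot (dmx (fun z => dmx y z u') x0 v') e' + dot (dmx y x0 u') (dmx x' x0 v'))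
        * g c2 +
      complex.Im (dot (dmx (fun z => dmx y z u') x0 v') e' + dot (dmx y x0 u') (dmx x' x0 v'))
        * g c3.
    move=> gE.
    pose a0 t u := complex.Im (dot (dmx x (x0 + t *: v') u) (y (x0 + t *: v'))).
    pose b0 t u := complex.Re (dot (dmx y (x0 + t *: v') u) (x' (x0 + t *: v'))).
    pose d0 t u := complex.Im (dot (dmx y (x0 + t *: v') u) (x' (x0 + t *: v'))).
    pose p0 t u := g (dot (dmx x (x0 + t *: v') u) (x' (x0 + t *: v'))).
    have z0 : x0 + 0 *: v' = x0 by rewrite scale0r addr0.
    have [_ Da] := second_order u' v' tx ty.
    have [Db Dd] := second_order u' v' ty tx'.
    have Dp : is_derive (0 : R) (1 : R) (p0^~ u')
      (g (dot (dmx (fun z => dmx x z u') x0 v') (x' x0) + dot (dmx x x0 u') (dmx x' x0 v'))).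
      by rewrite /p0 gE; have [h1 h2] := second_order u' v' tx tx'; case: (gc).
    have cont w : [/\ {for 0, continuous (a0^~ w)}, {for 0, continuous (b0^~ w)},
        {for 0, continuous (d0^~ w)} & {for 0, continuous (p0^~ w)}].
      have [_ h1] := second_order w v' tx ty.
      have [h2 h3] := second_order w v' ty tx'.
      split; [exact: is_derive_continuous h1|exact: is_derive_continuous h2|
        exact: is_derive_continuous h3|].
      have [h4 h5] := second_order w v' tx tx'.
      by rewrite /p0 gE; case: (gc); [exact: is_derive_continuous h4|exact: is_derive_continuous h5].
    have nearK : \forall t \near (0 : R),
       [/\ real_form (a0 t), real_form (b0 t), real_form (d0 t) & real_form (p0 t)] /\
       forall w, a0 t w = 0 -> b0 t w = 0 -> d0 t w = 0 -> p0 t w = 0.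
      apply: filterS nearH => t [Ut xt x't]; split.
        split; [exact: s3i tx Ut|exact: s3r ty Ut|exact: s3i ty Ut|].
        by rewrite /p0 gE; case: (gc); [exact: s3r tx Ut|exact: s3i tx Ut].
      move=> w h0 h1 h2; rewrite /p0 (ker _ w Ut xt x't h0 h1 h2) gE.
      by case: (gc).
    have := @kernel_derive3 R V a0 b0 d0 p0 w0 w1 w2 u' _ _ _ _ nearK.
    rewrite /a0 /b0 /d0 /p0 z0 => /(_ _ _ _ _ v0 v1 v2 cont) K.
    have := K _ _ _ _ _ Da Db Dd Dp; rewrite y0E x'0E; apply.
    by rewrite Du1 Du2.
  by apply: complex_comb; [exact: (k _ true erefl)|exact: (k _ false erefl)].
have [_ _ Sx _] := tx Ux; have [_ _ Sy _] := ty Ux.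
have E1 := E u v Du; have E2 := E v u Dv.
rewrite (Sx v u) (Sy v u) in E2.
exact: antisymmetrize E1 E2.
Qed.

End Umbilicity.

(** * Pointwise consequences of differentiating the umbilicity relation *)

Section RigidJet.
Context {R : realType} (n : nat) (V : lmodType R).
Local Notation C := R[i].
Context (P L : 'M[C]_n) (e e' f : 'rV[C]_n) (F : frame P L e e' f).
Context (dP dL : V -> 'M[C]_n) (dx dx' dy : V -> 'rV[C]_n).
Context (J : jet P L e e' f dP dL dx dx' dy).
Let Q := 1%:M - P - f ^t* *m f.
Let Q' := 1%:M - L *m L.

Lemma jet_umbilic_dx (l : R) u : (forall u,
    P *m (L *m L) *m dL u *m (1%:M - L *m L) =
    l%:C *: (P *m (L *m L) *m L *m dL u *m (1%:M - L *m L))) ->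
  [/\ dy u *m Q' = l%:C *: (dx u *m Q'), e *m dL u *m Q' = dy u *m Q' &
      f *m dL u *m Q' = dx u *m Q'].
Proof.
move=> U; have [_ [eL _ fL]] := frame_act F.
have LQ : L *m Q' = 0 := frame_LQ' F.
have Z (r s : 'rV[C]_n) : (r *m L + s) *m Q' = s *m Q'.
  by rewrite mulmxDl -mulmxA LQ mulmx0 add0r.
have y1 : dy u *m Q' = e *m dL u *m Q' by rewrite (j_y1 J u) Z.
have x1 : dx u *m Q' = f *m dL u *m Q' by rewrite (j_x2 J u) Z.
rewrite y1 x1; split=> //.
have [[ee _ _] _] := frame_dot F.
have := congr1 (fun A => e *m A) (U u); rewrite (frame_E F) -/Q' -scalemxAr.
rewrite !mulmxA !row_dot ee !scale1r.
by rewrite eL.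
Qed.

(** [eta] is the derivative of l, and [skew] is the derivative of dy Q' = l dx Q' antisymmetrized in
    the two directions. The vector r = dy - l dx has no component in the image of Q', so r = a e + b
    f, and [skew] becomes a proportionality between dx u Q' and dx v Q' with factors eta - (a + l
    b). Two independent directions make these factors vanish; real parts then give eta = 0 and a = -
    l b. *)
Lemma jet_rigid (l : R) (eta : V -> R) (q : 'rV[C]_n) :
  l != 0 -> q != 0 -> q *m Q = q ->
  (forall u, P *m (L *m L) *m dL u *m (1%:M - L *m L) =
    l%:C *: (P *m (L *m L) *m L *m dL u *m (1%:M - L *m L))) ->
  (forall u v, (dy u - l%:C *: dx u) *m (dL v *m L + L *m dL v) -
      (dy v - l%:C *: dx v) *m (dL u *m L + L *m dL u) =
    (eta u)%:C *: (dx v *m Q') - (eta v)%:C *: (dx u *m Q')) ->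
  (forall u, complex.Re (dot (dx u) f) = 0) ->
  (forall u, complex.Re (dot (dy u) f) = complex.Re (dot (dx u) e)) ->
  forall u, eta u = 0 /\
    exists b : C, dy u - l%:C *: dx u = b *: (f - l%:C *: e).
Proof.
move=> l0 q0 qQ umb skew nrm unit.
have ux u := jet_umbilic_dx u umb.
have [[QH QQ PQ] [eQ e'Q fQ LQ]] := frame_Q F; rewrite -/Q in QH QQ PQ eQ e'Q fQ LQ.
have [_ [eL e'L fL]] := frame_act F; have [_ LH] := frame_herm F.
have QE : Q' = e' ^t* *m e' + Q by exact: frame_Q' F.
have LQ' : L *m Q' = 0 := frame_LQ' F.
pose r u := dy u - l%:C *: dx u.
pose a u := dot (r u) e; pose b u := dot (r u) f.
have rQ u : r u *m Q' = 0.
  by rewrite mulmxBl -scalemxAl; have [-> _ _] := ux u; rewrite subrr.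
have Q'Q : Q' *m Q = Q by rewrite QE mulmxDl QQ -mulmxA e'Q mulmx0 add0r.
have [[ee e'e' ff] [[ee' ef e'f] e'e fe fe']] := frame_dot F.
have Q'e' : Q' *m e' ^t* = e' ^t*.
  rewrite QE mulmxDl -mulmxA.
  have -> : Q *m e' ^t* = 0 by rewrite -[LHS]hcK hcM hcK QH e'Q hc0.
  by rewrite addr0 [e' *m _]mx11_scalar -dotE e'e' mulmx1.
have re' u : dot (r u) e' = 0.
  by rewrite dotE -Q'e' mulmxA rQ mul0mx mxE.
have rE u : r u = a u *: e + b u *: f.
  rewrite {1}(row_res F (r u)) re' scale0r addr0 -/Q -Q'Q mulmxA rQ mul0mx addr0.
  by [].
pose mu u := a u + l%:C * b u.
(* Multiplication by L exchanges [e] and [f], after which umbilicity expresses both e dL and f dL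
   through dx modulo the kernel of Q'. *)
have step u v : r u *m (dL v *m L + L *m dL v) *m Q' = mu u *: (dx v *m Q').
  rewrite -mulmxA mulmxDl -!mulmxA LQ' mulmx0 add0r mulmxA rE mulmxDl.
  rewrite -!scalemxAl eL fL mulmxDl -!scalemxAl.
  have [u1 u2 u3] := ux v; rewrite !mulmxA u2 u3 u1 scalerA -scalerDl.
  by rewrite /mu [b u * _]mulrC.
have Q'Q' : Q' *m Q' = Q' by rewrite {1}/Q' mulmxBl mul1mx -mulmxA LQ' mulmx0 subr0.
pose z u := (eta u)%:C - mu u.
have proj (A B x y : 'rV[C]_n) (s t : C) : A - B = s *: x - t *: y ->
    A *m Q' - B *m Q' = s *: (x *m Q') - t *: (y *m Q').
  by move=> H; rewrite -mulmxBl H mulmxBl -!scalemxAl.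
have swap (m1 m2 e1 e2 : 'rV[C]_n) : m1 - m2 = e1 - e2 -> e1 - m1 = e2 - m2.
  by move=> H; rewrite -[e1](subrK e2) -H addrAC [m1 - _]addrC addrK addrC.
have prop u v : z u *: (dx v *m Q') = z v *: (dx u *m Q').
  have := proj _ _ _ _ _ _ (skew u v).
  rewrite -/(r u) -/(r v) (step u v) (step v u) -!(mulmxA _ Q' Q') Q'Q' => /swap.
  by rewrite -!scalerBl.
(* Two directions with independent dx v Q': [v1] has [Q]-part [q], while [v2] has [Q]-part 0 and a
   nonzero [e']-component. By [prop], [z] vanishes at [v2], then at [v1], then everywhere. *)
have [v1 [_ _ v1q _]] := @jet_tangent _ _ _ _ _ _ _ _ F _ _ _ _ _ J 0 0 q 0
  erefl qQ (mul0mx _ _).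
have [v2 [_ v2t v2q _]] := @jet_tangent _ _ _ _ _ _ _ _ F _ _ _ _ _ J 0 1 0 0
  erefl (mul0mx _ _) (mul0mx _ _).
rewrite -/Q in v1q v2q.
have X1 : dx v1 *m Q' *m Q = q by rewrite -mulmxA Q'Q.
have X10 : dx v1 *m Q' != 0.
  by apply: contra_neq q0 => H; rewrite -X1 H mul0mx.
have X20 : dx v2 *m Q' != 0.
  apply: contra_neq (oner_neq0 C) => H; rewrite -v2t dotE -Q'e' mulmxA.
  by have [-> _ _] := ux v2; rewrite H scaler0 mul0mx mxE.
have fin (a1 a2 : C) (x y : 'rV[C]_n) :
    a1 *: x = a2 *: y -> x *m Q = q -> y *m Q = 0 -> a1 = 0.
  move=> H xq y0; apply/eqP; have := congr1 (fun A => A *m Q) H.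
  rewrite -!scalemxAl xq y0 scaler0 => /eqP.
  by rewrite scaler_eq0 (negbTE q0) orbF.
have zE u : z u = (eta u)%:C - mu u by [].
clearbody z.
have z2 : z v2 = 0.
  have X2 : dx v2 *m Q' *m Q = 0 by rewrite -mulmxA Q'Q.
  exact: fin (prop v2 v1) X1 X2.
have z1 : z v1 = 0.
  have := prop v1 v2; rewrite z2 scale0r => /eqP.
  by rewrite scaler_eq0 (negbTE X20) orbF => /eqP.
have zu u : z u = 0.
  have := prop u v1; rewrite z1 scale0r => /eqP.
  by rewrite scaler_eq0 (negbTE X10) orbF => /eqP.
move=> u; have muE : mu u = (eta u)%:C by apply/esym/eqP; rewrite -subr_eq0 -zE zu.
(* Orthogonality of the moving [e], [f] and normality give Re a; equality of their lengths gives Re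
   b. The two contributions to Re (a + l b) cancel, and this sum is the real number eta. *)
have rea : complex.Re (a u) = - (l * complex.Re (dot (dx u) e)).
  rewrite /a /r -scaleNr dotDl dotZl -rmorphN cReD cReZ mulNr.
  have := congr1 (@complex.Re R) (j_xy J u); rewrite cReD nrm add0r.
  by rewrite [dot e _]dotC cReJ => ->; rewrite add0r.
have reb : complex.Re (b u) = complex.Re (dot (dx u) e).
  by rewrite /b /r -scaleNr dotDl dotZl -rmorphN cReD cReZ nrm mulr0 addr0 unit.
have eta0 : eta u = 0.
  have := congr1 (@complex.Re R) muE; rewrite cReD cReZ rea reb addNr /=.
  by move=> <-.
split=> //; exists (b u); rewrite -/(r u) rE scalerBr scalerA.
have /eqP : mu u = 0 by rewrite muE eta0.
by rewrite addr_eq0 => /eqP ->; rewrite scaleNr addrC [_ * b u]mulrC.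
Qed.

End RigidJet.
Section ScaledDerivative.
Context {R : realType} {V : normedModType R}.
Local Notation C := R[i].

Lemma mxd_scale p q (l : V -> R) (A : V -> 'M[C]_(p, q)) x v l' A' :
  is_derive x v l l' -> mxd A x v A' ->
  mxd (fun z => (l z)%:C *: A z) x v (l'%:C *: A x + (l x)%:C *: A').
Proof.
move=> dl dA i j; have [dr di] := dA i j.
rewrite !mxE cReD cImD !cReZ !cImZ; split.
  rewrite (_ : (fun _ => _) = l * (fun z => complex.Re (A z i j))); last first.
    by apply/funext => z; rewrite mxE cReZ.
  have := is_deriveM dl dr; congr (is_derive _ _ _ _).
  by rewrite addrC [_ *: l']mulrC.
rewrite (_ : (fun _ => _) = l * (fun z => complex.Im (A z i j))); last first.
  by apply/funext => z; rewrite mxE cImZ.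
have := is_deriveM dl di; congr (is_derive _ _ _ _).
by rewrite addrC [_ *: l']mulrC.
Qed.

(* [l = h / g] near the point. *)
Lemma quotient_derivable (l g h : V -> R) x v g' h' :
  is_derive x v g g' -> is_derive x v h h' -> g x != 0 ->
  (\forall t \near (0 : R), h (x + t *: v) = l (x + t *: v) * g (x + t *: v)) ->
  exists l', is_derive x v l l'.
Proof.
move=> dg dh g0 E.
have dg0 := is_derive_onto_line dg; have dh0 := is_derive_onto_line dh.
have z0 : x + (0 : R) *: v = x by rewrite scale0r addr0.
have g00 : g (x + (0 : R) *: v) != 0 by rewrite z0.
have dV := @is_deriveV R (fun t : R => g (x + t *: v)) 0 _ 1 g00 dg0.
have dM := is_deriveM dh0 dV.
have N := cvgr_neq0 _ (is_derive_continuous dg0) g00.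
have {}N := N (nbhs_filter (0 : R)).
have E' : \forall t \near (0 : R), ((fun t : R => h (x + t *: v)) *
    (fun t : R => (g (x + t *: v))^-1)) t = l (x + t *: v).
  apply: filterS (filterI E N) => t [Et Nt].
  have H : h (x + t *: v) / g (x + t *: v) = l (x + t *: v) by rewrite Et mulfK.
  exact: H.
have [D1 D2] := near_eq_is_derive E' dM.
exists ('D_v l x); apply: derivableP.
have lE : (fun t : R => l (x + t *: v)) = (fun t : R => l (t *: v + x)).
  by apply/funext => t; rewrite addrC.
by rewrite lE in D1; apply/derivable1P.
Qed.

Lemma mxd_hermitian n (F : V -> 'M[C]_n) x v F' : mxd F x v F' -> 
  (\forall z \near x, (F z) ^t* = F z) -> F' ^t* = F'.
Proof. by move=> dF H; apply: mxd_uniq (mxd_near H (mxd_hc dF)) dF. Qed.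

End ScaledDerivative.

(** * Constancy of the axis *)

Section LocallyConstant.
Context {R : realType} {V : normedModType R}.

Lemma locally_constant (U : set V) (h : V -> R) x0 : open U -> U x0 ->
  (forall x v, U x -> is_derive x v h 0) -> \forall z \near x0, h z = h x0.
Proof.
move=> oU Ux dh; have [r /= r0 Hr] := open_subball oU Ux.
apply/nbhs_normP; exists (r / 2); first by rewrite /= divr_gt0.
move=> z /= zr; pose v := z - x0.
have UU (t : R) : 0 <= t <= 1 -> U (x0 + t *: v).
  move=> /andP[t0 t1]; apply: (Hr (r / 2)) => /=.
  - by rewrite sub0r normrN gtr0_norm ?divr_gt0// ltr_pdivrMr// ltr_pMr// ltr1n.
  - by rewrite divr_gt0.
  - rewrite -ball_normE /= opprD addrA subrr sub0r normrN normrZ ger0_norm//.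
    apply: le_lt_trans zr; rewrite distrC; exact: ler_piMl.
have D (t : R) : 0 <= t <= 1 -> is_derive t (1 : R) (fun t : R => h (x0 + t *: v)) 0.
  move=> t01; have [dd d0] := dh _ v (UU t t01).
  by have := is_derive_line dd; rewrite d0.
have D' (t : R) : t \in `]0, 1[%R -> is_derive t (1 : R) (fun t : R => h (x0 + t *: v)) ((fun=> 0) t).
  by rewrite in_itv/= => /andP[t0 t1]; apply: D; rewrite !ltW.
have cont : {within `[0, 1], continuous (fun t : R => h (x0 + t *: v))}.
  apply: derivable_within_continuous => t; rewrite in_itv/= => /D H.
  by case: H.
have [c _] := MVT_segment ler01 D' cont.
have E1 : x0 + (1 : R) *: v = z by rewrite scale1r /v addrCA subrr addr0.
have E0 : x0 + (0 : R) *: v = x0 by rewrite scale0r addr0.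
by rewrite E1 E0 mul0r => /subr0_eq.
Qed.

End LocallyConstant.

Section Axis.
Context {C : numClosedFieldType} (n : nat).

(* With [P = e^*e + e'^*e'] and [L = e^*f + f^*e] this is
   [(f - l e)^* (f - l e)]. *)
Definition axis (l : C) (P L : 'M[C]_n) : 'M[C]_n :=
  L *m L - P *m (L *m L) - l *: L + l *: (l *: (P *m (L *m L))).

Lemma axisE l P L e e' f : Num.conj l = l -> frame P L e e' f ->
  axis l P L = (f - l *: e) ^t* *m (f - l *: e).
Proof.
move=> lc F; rewrite /axis (frame_E F) (frame_K F) [e ^t* *m e + _]addrC addrK.
have [_ _ _ ->] := F.
rewrite hcB hcZ lc mulmxBl !mulmxBr -!scalemxAl -!scalemxAr scalerDr.
move: (f ^t* *m f) (l *: (e ^t* *m f)) (l *: (f ^t* *m e)) (l *: (l *: _)).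
by move=> a b c d; apply/matrixP => i j; rewrite !mxE; ring.
Qed.

(** [S] and [T] are the second derivatives of the moving frame, common to both hypotheses. *)
Lemma skew_cancel (S T yu yv xu xv : 'rV[C]_n) (Du Dv Q' : 'M[C]_n) (l eu ev : C) :
  S *m Q' + yu *m - Dv - (ev *: (xu *m Q') + l *: (T *m Q' + xu *m - Dv)) = 0 ->
  S *m Q' + yv *m - Du - (eu *: (xv *m Q') + l *: (T *m Q' + xv *m - Du)) = 0 ->
  (yu - l *: xu) *m Dv - (yv - l *: xv) *m Du =
  eu *: (xv *m Q') - ev *: (xu *m Q').
Proof.
rewrite !mulmxN !mulmxBl -!scalemxAl.
move: (S *m Q') (yu *m Dv) (xu *m Q') (T *m Q') (xu *m Dv) (yv *m Du) (xv *m Q') (xv *m Du).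
move=> s a b t c a' b' c' H1 H2; apply/eqP; rewrite -subr_eq0 -oppr_eq0; apply/eqP.
have : (s - a - (ev *: b + l *: (t - c))) - (s - a' - (eu *: b' + l *: (t - c'))) = 0.
  by rewrite H1 H2 subrr.
apply: etrans; apply/rowP => i; rewrite !mxE.
by move: (s 0 i) (a 0 i) (b 0 i) (t 0 i) (c 0 i) (a' 0 i) (b' 0 i) (c' 0 i) => *; ring.
Qed.

End Axis.

Lemma Re_dot_sym (R : realType) n (a b : 'rV[R[i]]_n) :
  complex.Re (dot a b + dot b a) = complex.Re (dot a b) * 2%:R.
Proof. by rewrite cReD [dot b a]dotC cReJ mulr_natr. Qed.

Lemma mxd_tr0 (R : realType) (V : normedModType R) n (F : V -> 'M[R[i]]_n) z v F' c :
  mxd F z v F' -> (\forall t \near z, \tr (F t) = c) -> \tr F' = 0.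
Proof.
move=> dF E; apply: complex_eq.
  have [_ H] := mxd_tr dF.
  have E1 : \forall t \near z, complex.Re (\tr (F t)) = (fun=> complex.Re c) t.
    by apply: filterS E => t ->.
  have [_ H'] := near_eq_is_derive E1 (mxd_tr dF).
  by rewrite -H' derive_val.
have dI : is_derive z v (fun z => complex.Im (\tr (F z))) (complex.Im (\tr F')).
  have -> : (fun z => complex.Im (\tr (F z))) =
      \sum_(i < n) (fun z => complex.Im (F z i i)).
    by apply/funext => t; rewrite fct_sumE /mxtrace cIm_sum.
  by rewrite /mxtrace cIm_sum; apply: is_derive_sum => i; have [] := dF i i.
have E1 : \forall t \near z, complex.Im (\tr (F t)) = (fun=> complex.Im c) t.
  by apply: filterS E => t ->.
have [_ H'] := near_eq_is_derive E1 dI.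
by rewrite -H' derive_val.
Qed.

Lemma near_entries (T : topologicalType) (S : Type) p q (W : T -> 'M[S]_(p, q)) x0 :
  (forall i j, \forall z \near x0, W z i j = W x0 i j) ->
  \forall z \near x0, W z = W x0.
Proof.
move=> H; have N : \forall z \near x0, forall i j, W z i j = W x0 i j.
  apply: (@filter_forall T 'I_p (fun i z => forall j, W z i j = W x0 i j) _ (nbhs_filter x0)) => i.
  have := @filter_forall T 'I_q (fun j z => W z i j = W x0 i j) _ (nbhs_filter x0).
  by apply => j; exact: H.
by apply: filterS N => z Wz; apply/matrixP.
Qed.

Section AxisAlgebra.
Context {R : realType} (n : nat) (P L : 'M[R[i]]_n) (e e' f : 'rV[R[i]]_n).
Context (F : frame P L e e' f).

Lemma scaled_axis (c : R[i]) (l : R) :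
  (complex.Re (dot (c *: e) (c *: e)))%:C *: axis l%:C P L =
  (c *: f - l%:C *: (c *: e)) ^t* *m (c *: f - l%:C *: (c *: e)).
Proof.
have -> : (complex.Re (dot (c *: e) (c *: e)))%:C = dot (c *: e) (c *: e).
  by apply: complex_eq => //=; rewrite ger0_Im// dot_ge0.
have [[ee _ _] _] := frame_dot F.
rewrite dotZl dotZr ee mulr1 (axisE (conj_real _) F) [l%:C *: (c *: e)]scalerA [l%:C * c]mulrC.
by rewrite -(scalerA c l%:C) -scalerBr hcZ -scalemxAl -scalemxAr scalerA [_ * c]mulrC.
Qed.

Lemma trace_axis (l : R) : \tr (axis l%:C P L) = 1 + l%:C * l%:C.
Proof.
have [[ee _ ff] [[_ ef _] _ fe _]] := frame_dot F.
rewrite (axisE (conj_real _) F) -[X in \tr X]mulmx1 dot_tr mulmx1.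
rewrite -!scaleNr dotDl !dotDr !dotZl !dotZr ee ff ef fe.
by rewrite rmorphN /= conj_real !mulr0 addr0 add0r mulr1 mulrNN.
Qed.

End AxisAlgebra.

(** If w' = b w, the derivative of W is a multiple of W, even when only a rescaled W is known to be
    w^*w; constancy of the trace makes the multiple zero. *)
Lemma scalar_derivative (C : numClosedFieldType) n (s b : C) (W W' : 'M[C]_n) (w : 'rV[C]_n) :
  W = w ^t* *m w -> \tr W != 0 -> \tr W' = 0 ->
  s *: W + 1 *: W' = (b *: w) ^t* *m w + w ^t* *m (b *: w) -> W' = 0.
Proof.
move=> WE W0 t0; rewrite hcZ -scalemxAl -scalemxAr -WE scale1r -scalerDl.
move=> /eqP; rewrite addrC eq_sym -subr_eq eq_sym -scalerBl => /eqP H.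
have := congr1 (@mxtrace _ _) H; rewrite t0 mxtraceZ => /esym/eqP.
by rewrite mulf_eq0 (negbTE W0) orbF H => /eqP ->; rewrite scale0r.
Qed.

Lemma axis_weight_neq0 (R : realType) (l : R) : 1 + l%:C * l%:C != 0 :> R[i].
Proof.
apply/eqP => /(congr1 (@complex.Re R)); rewrite cReD cReZ /= => /eqP.
by apply/negP/lt0r_neq0; rewrite ltr_pwDl ?ltr01// -expr2 sqr_ge0.
Qed.

Section Rigidity.
Context {R : realType} (m : nat).
Local Notation C := R[i].
Local Notation n := m.+2.
Local Notation V := 'rV[R]_(4 * m).-1.
Context (U : set V) (P L : V -> 'M[C]_n) (hd : hypersurface_data U P L).
Context (lam : V -> R).

Definition umbilic (l : R) z := forall u,
  P z *m (L z *m L z) *m dmx L z u *m (1%:M - L z *m L z) =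
  l%:C *: (P z *m (L z *m L z) *m L z *m dmx L z u *m (1%:M - L z *m L z)).

Context (umb : forall z, U z -> lam z != 0 /\ umbilic (lam z) z) (m1 : (1 < m)%N).

Let oU := hd_open hd.
Let tP := hd_P hd.
Let tL := hd_L hd.

Lemma moving_frame_umbilic e z u : U z ->
  dmx (moving_f P L e) z u *m (1%:M - L z *m L z) =
  (lam z)%:C *: (dmx (moving_e P L e) z u *m (1%:M - L z *m L z)).
Proof.
move=> Uz; have [g [g' [h F]]] := hd_frame hd Uz.
have [_ Hz] := umb Uz; have {}Hz := Hz u.
have [[_ dx dy] _] := moving_frame_derive hd e e u Uz.
have Z (r s : 'rV[C]_n) : (r *m L z + s) *m (1%:M - L z *m L z) = s *m (1%:M - L z *m L z).
  by rewrite mulmxDl -(mulmxA r) (frame_LQ' F) mulmx0 add0r.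
have [xE yE _] := moving_frame e e F.
have [[gg _ _] _] := frame_dot F; have [_ [gL _ _]] := frame_act F.
have H := congr1 (fun A => g *m A) Hz.
rewrite (frame_E F) -scalemxAr !mulmxA !row_dot gg !scale1r gL in H.
rewrite dx dy 2!Z xE yE -!scalemxAl -[X in X *m _]scale1r.
rewrite scale1r -!mulmxA in H *.
by rewrite H !scalerA [dot e g * _]mulrC.
Qed.

Section Center.
Context (x0 : V) (Ux : U x0) (e e' f : 'rV[C]_n).
Context (F : frame (P x0) (L x0) e e' f).
Local Notation x := (moving_e P L e).
Local Notation y := (moving_f P L e).
Let tx := twice_moving_e hd e.
Let ty := twice_moving_f hd e.

Lemma unit_derivative u :
  complex.Re (dot (dmx y x0 u) f) = complex.Re (dot (dmx x x0 u) e).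
Proof.
have [x0E y0E _] := moving_frame_at F.
have [dx _ _ _] := tx Ux; have [dy _ _ _] := ty Ux.
have [[_ Hx] _] := mxd_dot (dx u) (dx u); have [Hy _] := mxd_dot (dy u) (dy u).
have E : \forall z \near x0, complex.Re (dot (y z) (y z)) = complex.Re (dot (x z) (x z)).
  apply: (near_open oU Ux) => z Uz.
  by have [_ _ [_ _ _ _ ->]] := moving_frame_id hd e e' Uz.
have [_ Hy'] := near_eq_is_derive E Hy.
rewrite x0E Re_dot_sym in Hx; rewrite y0E Re_dot_sym in Hy'.
move: (etrans (esym Hy') Hx).
by apply: mulIf; rewrite pnatr_eq0.
Qed.

(** [lam] is merely a pointwise choice. Pairing the umbilicity relation with de along a fixed
    direction exhibits it as a quotient of derivable functions; a direction with [Q]-part [q] keeps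
    the denominator away from zero. *)
Lemma lam_derivable v : exists l', is_derive x0 v lam l'.
Proof.
have J := jet_at hd Ux F (ltnW m1); have [q q0 qQ] := frame_complement m1 F.
have [u0 [_ _ u0q _]] := @jet_tangent R n V (P x0) (L x0) e e' f F _ _ _ _ _ J 0 0 q 0 erefl qQ (mul0mx _ _).
pose Q' z := 1%:M - L z *m L z.
have tQ : twice U Q' by exact: (twiceB oU (twice_cst _) (twiceM oU tL tL)).
have [_ ddx _ _] := tx Ux; have [_ ddy _ _] := ty Ux; have [dQ _ _ _] := tQ _ Ux.
have [Hg _] := mxd_dot (mxdM (ddx u0 v) (dQ v)) (ddx u0 v).
have [Hh _] := mxd_dot (mxdM (ddy u0 v) (dQ v)) (ddx u0 v).
apply: (quotient_derivable Hg Hh).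
  have [[QH QQ PQ] [eQ e'Q fQ LQ]] := frame_Q F.
  have QE : Q' x0 = _ := frame_Q' F.
  move: u0q; set a := dmx _ _ _ => aq.
  have Q'H : (Q' x0) ^t* = Q' x0.
    by have [_ LH] := frame_herm F; rewrite /Q' hcB hcM LH hc1.
  have Q'Q' : Q' x0 *m Q' x0 = Q' x0.
    by rewrite {1}/Q' mulmxBl mul1mx -mulmxA (frame_LQ' F) mulmx0 subr0.
  rewrite -Q'Q' mulmxA dotM Q'H; apply: contra_neq q0 => /dot_Re0 a0.
  have Q'Q : Q' x0 *m (1%:M - P x0 - f ^t* *m f) = 1%:M - P x0 - f ^t* *m f.
    by rewrite QE mulmxDl QQ -mulmxA e'Q mulmx0 add0r.
  by rewrite -aq -Q'Q mulmxA a0 mul0mx.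
apply: filterS (line_near oU v Ux) => t Ut.
by rewrite /= (moving_frame_umbilic e u0 Ut) dotZl cReZ.
Qed.

Lemma rigid v : is_derive x0 v lam 0 /\
  exists b : C, dmx y x0 v - (lam x0)%:C *: dmx x x0 v = b *: (f - (lam x0)%:C *: e).
Proof.
have J := jet_at hd Ux F (ltnW m1); have [q q0 qQ] := frame_complement m1 F.
have [l0 um] := umb Ux.
have Dl w : is_derive x0 w lam ('D_w lam x0).
  by have [l' [d _]] := lam_derivable w; exact: derivableP.
have skew u w : (dmx y x0 u - (lam x0)%:C *: dmx x x0 u) *m
      (dmx L x0 w *m L x0 + L x0 *m dmx L x0 w) -
    (dmx y x0 w - (lam x0)%:C *: dmx x x0 w) *m
      (dmx L x0 u *m L x0 + L x0 *m dmx L x0 u) =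
    ('D_u lam x0)%:C *: (dmx x x0 w *m (1%:M - L x0 *m L x0)) -
    ('D_w lam x0)%:C *: (dmx x x0 u *m (1%:M - L x0 *m L x0)).
  have [_ ddx Sx _] := tx Ux; have [_ ddy Sy _] := ty Ux; have [dL _ _ _] := tL Ux.
  (* The derivative along [b] of the relation of [moving_frame_umbilic] in direction [a], its two
     sides having constant difference 0. *)
  have T a b : dmx (fun z => dmx y z a) x0 b *m (1%:M - L x0 *m L x0) +
      dmx y x0 a *m - (dmx L x0 b *m L x0 + L x0 *m dmx L x0 b) -
      (('D_b lam x0)%:C *: (dmx x x0 a *m (1%:M - L x0 *m L x0)) +
       (lam x0)%:C *: (dmx (fun z => dmx x z a) x0 b *m (1%:M - L x0 *m L x0) +
         dmx x x0 a *m - (dmx L x0 b *m L x0 + L x0 *m dmx L x0 b))) = 0.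
    have dQ := mxdB (mxd_cst (1%:M : 'M[C]_n) x0 b) (mxdM (dL b) (dL b)).
    rewrite sub0r in dQ.
    have D := mxdB (mxdM (ddy a b) dQ) (mxd_scale (Dl b) (mxdM (ddx a b) dQ)).
    apply: mxd_uniq D _; apply: mxd_near (mxd_cst 0 x0 b).
    by apply: (near_open oU Ux) => z Uz; rewrite (moving_frame_umbilic e a Uz) subrr.
  have T2 := T w u; rewrite (Sx w u) (Sy w u) in T2.
  exact: skew_cancel (T u w) T2.
have nrm u : complex.Re (dot (dmx x x0 u) f) = 0.
  have [-> _ _ _] := jet_dots F J u; exact: (normal_dot hd u Ux F).
have [H b] := jet_rigid F J l0 q0 qQ um skew nrm unit_derivative v.
by split=> //; rewrite -H.
Qed.

End Center.

(** By [rigid] the derivative of f - l e is a multiple of f - l e, so the line it spans does not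
    move; its projection has the constant trace 1 + l^2. *)
Lemma axis_locally_constant x0 : U x0 -> \forall z \near x0,
  lam z = lam x0 /\
  axis (lam x0)%:C (P z) (L z) = axis (lam x0)%:C (P x0) (L x0).
Proof.
move=> Ux.
have Nl : \forall z \near x0, lam z = lam x0.
  apply: (locally_constant oU Ux) => z v Uz.
  have [g [g' [h F]]] := hd_frame hd Uz; by have [] := rigid Uz F v.
(* [W] is formed with the fixed number [lam x0] and [rigid] speaks of [lam z]; on [U'] they
   coincide. *)
pose U' := U `&` [set z | lam z = lam x0]°.
have oU' : open U' by apply: openI => //; exact: open_interior.
have U'x : U' x0 by split.
pose W z := axis (lam x0)%:C (P z) (L z).
have tLL := twiceM oU tL tL; have tPL := twiceM oU tP tLL.
have tW : twice U W.
  exact: (twiceD oU (twiceB oU (twiceB oU tLL tPL) (twiceZ oU _ tL))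
    (twiceZ oU _ (twiceZ oU _ tPL))).
have dW z v : U' z -> mxd W z v 0.
  move=> [Uz /interior_subset lz].
  have [dWz _ _ _] := tW z Uz.
  suff <- : dmx W z v = 0 by [].
  have [g [g' [h F]]] := hd_frame hd Uz.
  have [_ [b bE]] := rigid Uz F v; rewrite lz in bE.
  have [dx _ _ _] := twice_moving_e hd g Uz; have [dy _ _ _] := twice_moving_f hd g Uz.
  have dw := mxdB (dy v) (mxdZ (lam x0)%:C (dx v)); rewrite bE in dw.
  have dww := mxdM (mxd_hc dw) dw.
  have [dN _] := mxd_dot (dx v) (dx v).
  have dNW := mxd_scale dN (dWz v).
  (* The moving frame is not normalized, so it yields the axis only up to the squared length of the
     moving [e]. *)
  have E : \forall t \near z, 
     (complex.Re (dot (moving_e P L g t) (moving_e P L g t)))%:C *: W t =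
     (moving_f P L g t - (lam x0)%:C *: moving_e P L g t) ^t* *m
       (moving_f P L g t - (lam x0)%:C *: moving_e P L g t).
    apply: (near_open oU Uz) => t Ut.
    have [k [k' [j G]]] := hd_frame hd Ut.
    have [-> -> _] := moving_frame g g' G.
    exact: (scaled_axis G).
  have := mxd_uniq (mxd_near E dNW) dww.
  have [x0E y0E _] := moving_frame_at F; have [[gg _ _] _] := frame_dot F.
  rewrite x0E y0E gg; apply: scalar_derivative.
  - exact: axisE (conj_real _) F.
  - have T : \tr (W z) = 1 + (lam x0)%:C * (lam x0)%:C := trace_axis F _.
    by rewrite T; apply: axis_weight_neq0.
  - apply: (mxd_tr0 (c := 1 + (lam x0)%:C * (lam x0)%:C) (dWz v)).
    apply: (near_open oU Uz) => t Ut.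
    by have [k [k' [j G]]] := hd_frame hd Ut; rewrite (trace_axis G).
have N : \forall z \near x0, W z = W x0.
  apply: near_entries => i j.
  have dR z v : U' z -> is_derive z v (fun z => complex.Re (W z i j)) 0.
    by move=> U'z; have [] := dW z v U'z i j; rewrite mxE.
  have dI z v : U' z -> is_derive z v (fun z => complex.Im (W z i j)) 0.
    by move=> U'z; have [] := dW z v U'z i j; rewrite mxE.
  apply: filterS (filterI (locally_constant oU' U'x dR) (locally_constant oU' U'x dI)).
  by move=> z [] *; exact: complex_eq.
exact: (filterI Nl N).
Qed.

End Rigidity.

Section AxisSlope.
Context {R : realType} (m : nat).
Local Notation C := R[i].
Local Notation n := m.+2.
Local Notation V := 'rV[R]_(4 * m).-1.
Context (U : set V) (P L : V -> 'M[C]_n) (hd : hypersurface_data U P L).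
Context (m1 : (1 < m)%N) (x0 : V) (Ux : U x0) (e e' f : 'rV[C]_n).
Context (F : frame (P x0) (L x0) e e' f).

Let oU := hd_open hd.
Let tL := hd_L hd.

Lemma axis_mulQ' (l : R) z : U z -> axis l%:C (P z) (L z) *m (1%:M - L z *m L z) = 0.
Proof.
move=> Uz; have [g [g' [h G]]] := hd_frame hd Uz.
have [_ [gL _ hL]] := frame_act G; have LQ := frame_LQ' G.
rewrite (axisE (conj_real _) G) -mulmxA mulmxBl -scalemxAl.
have -> : h *m (1%:M - L z *m L z) = 0 by rewrite -gL -mulmxA LQ mulmx0.
have -> : g *m (1%:M - L z *m L z) = 0 by rewrite -hL -mulmxA LQ mulmx0.
by rewrite scaler0 subrr mulmx0.
Qed.

(** The axis W satisfies W (1 - L^2) = 0. If W is constant, differentiating gives W L dL (1 - L^2) =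
    0, and (f - l e) L = e - l f. *)
Lemma axis_slope (l : R) (W : 'M[C]_n) u :
  (\forall z \near x0, axis l%:C (P z) (L z) = W) ->
  e *m dmx L x0 u *m (1%:M - L x0 *m L x0) =
  l%:C *: (f *m dmx L x0 u *m (1%:M - L x0 *m L x0)).
Proof.
move=> HW; have W0 := nbhs_singleton HW.
have [dL _ _ _] := tL Ux.
have D := mxdM (mxd_cst W x0 u)
  (mxdB (mxd_cst (1%:M : 'M[C]_n) x0 u) (mxdM (dL u) (dL u))).
have E : \forall z \near x0, W *m (1%:M - L z *m L z) = 0.
  apply: filterS (filterI HW (open_nbhs_nbhs (conj oU Ux))) => z [<- Uz].
  exact: axis_mulQ'.
have {D} D := mxd_uniq (mxd_near E D) (mxd_cst 0 x0 u).
rewrite mul0mx add0r sub0r mulmxN in D.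
move/eqP: D; rewrite oppr_eq0 => /eqP /(congr1 (fun A => A *m (1%:M - L x0 *m L x0))).
have LQ := frame_LQ' F; have [_ [eL _ fL]] := frame_act F.
rewrite mul0mx -mulmxA mulmxDl -!(mulmxA _ (L x0) (1%:M - _)) LQ mulmx0 add0r.
rewrite -W0 (axisE (conj_real _) F) => H.
have {H} := congr1 (fun A => (f - l%:C *: e) *m A) H.
rewrite mulmx0 !mulmxA row_dot -!scalemxAl mulmxBl -scalemxAl eL fL => /eqP.
have [[ee _ ff] [[_ ef _] _ fe _]] := frame_dot F.
rewrite -!scaleNr dotDl !dotDr !dotZl !dotZr ee ff ef fe.
rewrite rmorphN /= conj_real !mulr0 addr0 add0r mulr1 mulrNN.
rewrite scaler_eq0 (negbTE (axis_weight_neq0 _)) /=.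
rewrite mulmxDl mulmxDl scaleNr mulNmx mulNmx subr_eq0 => /eqP ->.
by rewrite -!scalemxAl.
Qed.

(** The slopes found near different points must be shown to agree, sign included; a direction with
    nonzero f dL (1 - L^2) detects l. *)
Lemma axis_unique (l l' : R) (W W' : 'M[C]_n) :
  (\forall z \near x0, axis l%:C (P z) (L z) = W) ->
  (\forall z \near x0, axis l'%:C (P z) (L z) = W') -> l = l'.
Proof.
move=> H H'; have [q q0 qQ] := frame_complement m1 F.
have J := jet_at hd Ux F (ltnW m1).
have [u [_ _ uq _]] := @jet_tangent R n V (P x0) (L x0) e e' f F _ _ _ _ _ J
  0 0 q 0 erefl qQ (mul0mx _ _).
have [_ _ _ fq _] := jet_proj F J u; rewrite uq in fq.
have := etrans (esym (axis_slope u H)) (axis_slope u H').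
move=> /eqP; rewrite -subr_eq0 -scalerBl scaler_eq0 => /orP[|/eqP H0].
  by rewrite -rmorphB => /eqP [] /eqP; rewrite subr_eq0 => /eqP.
case/eqP: q0; rewrite fq.
have [[QH QQ PQ] [eQ e'Q fQ LQ]] := frame_Q F.
have Q'Q : (1%:M - L x0 *m L x0) *m (1%:M - P x0 - f ^t* *m f) = 1%:M - P x0 - f ^t* *m f.
  by rewrite (frame_Q' F) mulmxDl QQ -mulmxA e'Q mulmx0 add0r.
by rewrite -Q'Q mulmxA H0 mul0mx.
Qed.

End AxisSlope.

Lemma axis_exists (R : realType) (m : nat) (U : set 'rV[R]_(4 * m).-1)
    (P L : 'rV[R]_(4 * m).-1 -> 'M[R[i]]_m.+2) x0 :
  hypersurface_data U P L -> (1 < m)%N -> U x0 ->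
  exists (l : R) W, l != 0 /\ \forall z \near x0, axis l%:C (P z) (L z) = W.
Proof.
move=> hd m1 Ux.
have H z : exists l : R, U z -> l != 0 /\ umbilic P L l z.
  have [Uz|nUz] := pselect (U z); last by exists 0 => /nUz.
  have [g [g' [h F]]] := hd_frame hd Uz.
  by have [l [l0 um]] := umbilic_at hd Uz F m1; exists l => _; split; [exact: l0|exact: um].
have [lam Hlam] := choice H.
exists (lam x0), (axis (lam x0)%:C (P x0) (L x0)); split.
  by have [] := Hlam x0 Ux.
have := axis_locally_constant hd Hlam m1 Ux.
by apply: filterS => z [].
Qed.

(** * From the hypersurface to its charts *)

Section PointwiseFrame.
Context {R : realType} (n : nat).
Local Notation C := R[i].

(** A unit normal has tr (N N) = 4 because of the factor 1/4 in [gmet]; the scaled normal has trace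
    2, as is required for e and f to be unit vectors. *)
Definition unit_scale : C := ((Num.sqrt 2%:R)^-1 : R)%:C.

Lemma unit_scale_sqr : unit_scale * unit_scale = 2^-1.
Proof.
rewrite /unit_scale -rmorphM -invfM -expr2 sqr_sqrtr ?ler0n//.
by rewrite fmorphV rmorph_nat.
Qed.

Lemma hom_tangent (P X : 'M[C]_n) : P *m P = P -> gr2_tangent P X ->
  hom_of P X = P *m X.
Proof. by move=> PP [_ XT]; rewrite /hom_of mulmxBr mulmx1 (PNP0 PP XT) subr0. Qed.

Lemma tr_hc (A : 'M[C]_n) : \tr (A ^t*) = Num.conj (\tr A).
Proof. by rewrite trace_map_mx mxtrace_tr. Qed.

(** Left multiplication by P keeps the block in Hom(V, V^perp), and the hypothesis on the Reeb field
    becomes q (P N) = - i (P N), the eigenvector condition of [frame_exists]. *)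
Lemma reeb_frame (P N q : 'M[C]_n) : gr2 P -> gr2_tangent P N ->
  gmet N N = 1 -> su_plane P q -> - kahlerJ P N = quatJ P q N ->
  exists e e' f, frame P (unit_scale *: N) e e' f.
Proof.
move=> [PH PP Pr] NT NN [Pq qH qt]; rewrite /kahlerJ /quatJ (hom_tangent PP NT).
have [NH NP] := NT; have PNP := PNP0 PP NP.
rewrite /tan_of !hcM hcZ hcM PH NH => /(congr1 (fun A => P *m A)).
have Pq' : P *m q = q by rewrite -[RHS]Pq -{1}Pq !mulmxA PP.
rewrite mulmxN !mulmxDr -!scalemxAr !mulmxA PNP mul0mx scaler0 addr0 addr0 PP Pq' => H.
have sc : Num.conj unit_scale = unit_scale := conj_real _.
apply: (@frame_exists _ n P (unit_scale *: N) q) => //.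
- by rewrite hcZ sc NH.
- by rewrite -scalemxAl -scalemxAr -scalerDr NP.
- rewrite -scalemxAl -scalemxAr scalerA unit_scale_sqr mxtraceZ.
  suff -> : \tr (N *m N) = 4%:R by rewrite -[4%N]/(2 * 2)%N natrM mulKf// pnatr_eq0.
  apply: complex_eq.
    move: NN; rewrite /gmet NH => /(congr1 (fun a => a * 4%:R)).
    by rewrite mul1r divfK ?pnatr_eq0// => ->; rewrite -(rmorph_nat (real_complex R)).
  have : Num.conj (\tr (N *m N)) = \tr (N *m N).
    by rewrite -tr_hc hcM NH.
  move=> /(congr1 (@complex.Im R)); rewrite cImJ => /eqP H0.
  have -> : complex.Im (4%:R : C) = 0 by rewrite -(rmorph_nat (real_complex R)).
  by move: H0; move: (complex.Im _) => t /eqP H0; lra.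
- by rewrite -!scalemxAr mulmxA -H -complexiE scalerN !scalerA [_ * unit_scale]mulrC.
Qed.

Context (P N : 'M[C]_n) (e e' f : 'rV[C]_n).
Context (F : frame P (unit_scale *: N) e e' f).

Lemma gmet_quatJ (X q : 'M[C]_n) : X ^t* = X -> gr2_tangent P N ->
  (gmet X (quatJ P q N) == 0) = (complex.Re (dot (f *m X *m q) e) == 0).
Proof.
move=> XH NT; have [PP _ _ _] := frame_proj F.
have s2 : Num.sqrt 2%:R != 0 :> R by rewrite gt_eqF// sqrtr_gt0 ltr0n.
have PNE : P *m N = (Num.sqrt 2%:R)%:C *: (e ^t* *m f).
  have [_ _ PE _] := F; have [_ [eL' e'L _]] := frame_act F.
  have : P *m (unit_scale *: N) = e ^t* *m f.
    by rewrite {1}PE mulmxDl -!mulmxA eL' e'L mulmx0 addr0.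
  by rewrite -scalemxAr => <-; rewrite scalerA /unit_scale -rmorphM mulfV ?scale1r.
rewrite /gmet /quatJ (hom_tangent PP NT) /tan_of hcD hcK mulmxDr mxtraceD cReD.
have -> : \tr (X *m (q *m (P *m N)) ^t*) = Num.conj (\tr (X *m (q *m (P *m N)))).
  by rewrite -tr_hc [in RHS]hcM XH mxtrace_mulC.
rewrite cReJ -mulr2n mulf_eq0 invr_eq0 pnatr_eq0 orbF mulrn_eq0 /=.
rewrite PNE -!scalemxAr mxtraceZ cReZ mulf_eq0 (negbTE s2) /=.
by rewrite mulmxA mxtrace_mulC dot_tr mulmxA.
Qed.

(** The three-dimensional su(V) gives three real equations. The real part of <e X, f> being zero
    already, they are the vanishing of its imaginary part and of both parts of <e' X, f>. *)
Lemma perp_quat (X : 'M[C]_n) : X ^t* = X -> X *m P + P *m X = X ->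
  gr2_tangent P N -> complex.Re (dot (e *m X) f) = 0 ->
  (forall Y, (exists2 q, su_plane P q & Y = quatJ P q N) -> gmet X Y = 0) <->
  dot (e *m X) f = 0 /\ dot (e' *m X) f = 0.
Proof.
move=> XH XT NT Xf; have [[eP e'P fP] _] := frame_act F.
have [[ee e'e' ff] [[ee' ef e'f] e'e fe fe']] := frame_dot F.
have [_ _ PE _] := F.
have fX : f *m X = dot (f *m X) e *: e + dot (f *m X) e' *: e'.
  by rewrite -{1}XT mulmxDr [f *m (P *m X)]mulmxA fP mul0mx addr0 {1}PE !mulmxDr !mulmxA !row_dot.
have fXe : dot (f *m X) e = Num.conj (dot (e *m X) f).
  by rewrite -dotC dotM XH.
have fXe' : dot (f *m X) e' = Num.conj (dot (e' *m X) f).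
  by rewrite -dotC dotM XH.
split=> [H|[H1 H2] Y [q qs ->]]; last first.
  apply/eqP; rewrite gmet_quatJ// fX fXe fXe' H1 H2 conjC0 !scale0r addr0.
  by rewrite mul0mx dot0l.
have K q : su_plane P q -> complex.Re (dot (f *m X *m q) e) = 0.
  by move=> qs; apply/eqP; rewrite -gmet_quatJ//; apply/eqP/H; exists q.
have PH q (a b : 'rV[C]_n) : q = a ^t* *m b -> a *m P = a -> b *m P = b -> P *m q *m P = q.
  move=> -> aP bP; have [PH _] := frame_herm F.
  by rewrite -mulmxA -(mulmxA _ b) bP mulmxA -{1}PH -hcM aP.
have T (a b : 'rV[C]_n) : \tr (a ^t* *m b) = dot b a.
  by rewrite -[a ^t* *m b]mulmx1 dot_tr mulmx1.
have D (a b : 'rV[C]_n) : dot (f *m X *m (a ^t* *m b)) e = dot (f *m X) a * dot b e.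
  by rewrite mulmxA row_dot dotZl.
have ic : Num.conj ('i : C) = - 'i := conjCi _.
have E1 := PH _ e e erefl eP eP; have E2 := PH _ e e' erefl eP e'P.
have E3 := PH _ e' e erefl e'P eP; have E4 := PH _ e' e' erefl e'P e'P.
(* A basis of su(V) in the frame, the Pauli matrices up to factors. *)
have s1 : su_plane P ('i *: (e ^t* *m e - e' ^t* *m e')).
  split; first by rewrite -scalemxAr -scalemxAl mulmxBr mulmxBl E1 E4.
    by rewrite hcZ ic hcB !hcM !hcK scaleNr.
  by rewrite mxtraceZ raddfB /= !T ee e'e' subrr mulr0.
have s2 : su_plane P (e' ^t* *m e - e ^t* *m e').
  split; first by rewrite mulmxBr mulmxBl E2 E3.
    by rewrite hcB !hcM !hcK opprB.
  by rewrite raddfB /= !T ee' e'e subrr.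
have s3 : su_plane P ('i *: (e' ^t* *m e + e ^t* *m e')).
  split; first by rewrite -scalemxAr -scalemxAl mulmxDr mulmxDl E2 E3.
    by rewrite hcZ ic hcD !hcM !hcK scaleNr addrC.
  by rewrite mxtraceZ mxtraceD !T ee' e'e addr0 mulr0.
have DD A B : dot (f *m X *m (A + B)) e = dot (f *m X *m A) e + dot (f *m X *m B) e.
  by rewrite mulmxDr dotDl.
have DZ c A : dot (f *m X *m (c *: A)) e = c * dot (f *m X *m A) e.
  by rewrite -scalemxAr dotZl.
have DB A B : dot (f *m X *m (A - B)) e = dot (f *m X *m A) e - dot (f *m X *m B) e.
  by rewrite -scaleN1r DD DZ mulN1r.
have := K _ s1; have := K _ s2; have := K _ s3.
rewrite DZ DD D D ee e'e mulr0 mulr1 addr0 fXe'.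
rewrite DB D D ee e'e mulr0 mulr1 subr0 fXe'.
rewrite DZ DB D D ee e'e mulr0 mulr1 subr0 fXe -complexiE.
move: Xf; move: (dot (e *m X) f) (dot (e' *m X) f) => [a b] [c d] /= a0 h1 h2 h3.
split; apply: complex_eq => /=; lra.
Qed.

End PointwiseFrame.

Lemma near_continuous (S T : topologicalType) (g : S -> T) p (Q : T -> Prop) :
  {for p, continuous g} -> (\forall z \near g p, Q z) -> \forall q \near p, Q (g q).
Proof. by move=> c H; exact: (c _ H). Qed.

(** A product between a vector of the plane and one of its complement sees only an off-diagonal
    block, which the tangential projection preserves; so the ambient derivative of N can replace the
    covariant one. *)
Lemma dot_tanproj (R : realType) n (P A : 'M[R[i]]_n) (a g : 'rV[R[i]]_n) :
  P ^t* = P -> a *m P = a -> g *m P = 0 ->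
  dot (a *m - tanproj P A) g = - dot (a *m A) g.
Proof.
move=> PH aP gP; rewrite mulmxN -scaleN1r dotZl mulN1r /tanproj.
rewrite [a *m (_ + _)]mulmxDr !mulmxA.
have -> : a *m (1%:M - P) = 0 by rewrite mulmxBr mulmx1 aP subrr.
rewrite !mul0mx addr0 aP dotM hcB hc1 PH.
by rewrite mulmxBr mulmx1 gP subr0.
Qed.

Section Charts.
Context {R : realType} (m : nat) (M : topologicalType).
Context (atl : set (chart R (4 * m).-1 M)) (f N : M -> 'M[R[i]]_m.+2).
Local Notation C := R[i].
Local Notation n := m.+2.
Local Notation V := 'rV[R]_(4 * m).-1.
Context (hf : real_hypersurface atl f) (hN : unit_normal atl f N).
Context (hA : shape_preserves_D atl f N) (hX : forall p, Dperp f N p (reeb f N p)).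

Definition half_normal p := unit_scale *: N p.

Lemma frame_at p : exists e e' g, frame (f p) (half_normal p) e e' g.
Proof.
have [_ grf _ _] := hf; have [_ /(_ p)[NT NN _]] := hN.
have [q qs qE] := hX p; exact: reeb_frame (grf p) NT NN qs qE.
Qed.

Lemma mx_deriveE (F : V -> 'M[C]_n) z u : mx_derive F z u = dmx F z u.
Proof. by apply/matrixP => i j; rewrite dmxE mxE. Qed.

Section OneChart.
Context (c : chart R (4 * m).-1 M) (ac : atl c).
Local Notation U := (chart_cod c).
Local Notation P := (f \o chart_inv c).
Local Notation L := (fun z => unit_scale *: (N \o chart_inv c) z).

Lemma chart_facts : open U /\ (forall z, U z -> chart_dom c (chart_inv c z) /\
  chart_map c (chart_inv c z) = z).
Proof.
have [[_ _ homeo _ _] _ _ _] := hf; have [_ oU inv _ _] := homeo c ac.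
by split=> // z [p dp <-]; rewrite inv.
Qed.

Lemma twice_chart : twice U P /\ twice U (N \o chart_inv c).
Proof.
have [oU _] := chart_facts; have [_ _ sf _] := hf; have [sN _] := hN.
split; first exact: (smooth_twice oU (sf c ac)).
exact: (smooth_twice oU (sN c ac)).
Qed.

Lemma dP_tangent z u : U z -> gr2_tangent (P z) (dmx P z u).
Proof.
move=> Uz; have [oU _] := chart_facts; have [tP _] := twice_chart.
have [_ grf _ _] := hf.
split.
  have FG t : U t -> P t = (P t) ^t* by have [E _ _] := grf (chart_inv c t) => _; rewrite /= E.
  rewrite -(dmx_hc u tP Uz); exact: (dmx_ext oU u tP FG Uz).
apply/esym/(dmx_mul_eq oU u tP tP Uz) => t _.
by have [_ -> _] := grf (chart_inv c t).
Qed.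

Lemma mx_dirE (F : M -> 'M[C]_n) z u : U z ->
  mx_dir F c (chart_inv c z) u = dmx (F \o chart_inv c) z u.
Proof.
by move=> Uz; have [_ /(_ z Uz)[_ E]] := chart_facts; rewrite /mx_dir E mx_deriveE.
Qed.

Lemma tangent_dP z u : U z -> tangent atl f (chart_inv c z) (dmx P z u).
Proof.
move=> Uz; exists c, u; split=> //; first by have [_ /(_ z Uz)[]] := chart_facts.
by rewrite mx_dirE.
Qed.

End OneChart.

Lemma tangent_facts p X : tangent atl f p X ->
  gr2_tangent (f p) X /\ complex.Re (\tr (half_normal p *m X)) = 0.
Proof.
move=> TX; have [c [u [ac dp XE]]] := TX; have [_ grf _ _] := hf.
have [_ /(_ p)[NT NN NX]] := hN.
have [[_ _ homeo _ _] _ _ _] := hf; have [_ _ inv _ _] := homeo c ac.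
have Uz : chart_cod c (chart_map c p) by exists p.
have T := dP_tangent ac u Uz; rewrite /= inv// in T.
rewrite -mx_dirE// inv// in T; rewrite -XE in T; split=> //.
have := NX X TX; rewrite /gmet; have [-> _] := T => /eqP.
rewrite mulf_eq0 invr_eq0 pnatr_eq0 orbF => /eqP H.
by rewrite -scalemxAl mxtraceZ cReZ H mulr0.
Qed.

Lemma Ddist_frame p X e e' g : frame (f p) (half_normal p) e e' g ->
  tangent atl f p X ->
  Ddist atl f N p X <-> dot (e *m X) g = 0 /\ dot (e' *m X) g = 0.
Proof.
move=> F TX; have [[XH XT] XL] := tangent_facts TX.
have [_ /(_ p)[NT _ _]] := hN.
have Xg : complex.Re (dot (e *m X) g) = 0.
  have [PH LH] := frame_herm F; move: XL; rewrite (tr_res F LH XH XT).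
  have [_ [-> -> _]] := frame_act F.
  by rewrite dot0l addr0 -dotC cReD [dot g _]dotC cReJ => H; lra.
have := perp_quat F XH XT NT Xg; rewrite /Ddist /= => <-.
by split=> [[]|H].
Qed.

Lemma chart_hypersurface c : atl c ->
  hypersurface_data (chart_cod c) (f \o chart_inv c) (half_normal \o chart_inv c).
Proof.
move=> ac; have [oU inv] := chart_facts ac; have [tP tN] := twice_chart ac.
have tL := twiceZ oU unit_scale tN.
split.
- exact: oU.
- exact: tP.
- exact: tL.
- by move=> z _; exact: frame_at.
- by move=> z u Uz; have [_] := tangent_facts (tangent_dP ac u Uz).
- move=> z u Uz; rewrite -(mx_dirE ac _ u Uz); have [_ _ _ imm] := hf.
  by apply: imm => //; have [] := inv z Uz.
move=> z u e e' g Uz F s0 t0.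
have [dz _] := inv z Uz.
have TX := tangent_dP ac u Uz.
have DX : Ddist atl f N (chart_inv c z) (dmx (f \o chart_inv c) z u).
  by apply/(Ddist_frame F TX).
rewrite -(mx_dirE ac _ u Uz) in DX.
have DA := hA ac dz DX.
have [TA _] := DA; have := (Ddist_frame F TA).1 DA.
have [[eP e'P gP] _] := frame_act F; have [PH _] := frame_herm F.
rewrite /shape_op /nabla (mx_dirE ac _ u Uz).
have [_ _ _ lL] := tL z Uz; have [dN _ _ _] := tN z Uz.
have LE : dmx (half_normal \o chart_inv c) z u = unit_scale *: dmx (N \o chart_inv c) z u.
  exact: mxd_dmx (mxdZ unit_scale (dN u)).
rewrite (dot_tanproj _ PH eP gP) (dot_tanproj _ PH e'P gP).
rewrite LE -!scalemxAr !dotZl => -[/eqP + /eqP].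
by rewrite !oppr_eq0 => /eqP -> /eqP ->; rewrite mulr0.
Qed.

Lemma axis_global (p0 : M) : (1 < m)%N -> connected [set: M] ->
  exists (l : R) (W : 'M[C]_n), l != 0 /\
    forall p, axis l%:C (f p) (half_normal p) = W.
Proof.
move=> m1 conn.
have [[_ _ homeo cover _] _ _ _] := hf.
(* These sets are open by construction, cover M and, by [un], are disjoint for different pairs;
   connectedness leaves only one. *)
pose S (l : R) (W : 'M[C]_n) : set M := [set p : M | \forall q \near p, axis l%:C (f q) (half_normal q) = W].
have oS l W : open (S l W) by exact: open_interior.
have ex p : exists (l : R) W, l != 0 /\ S l W p.
  have [c ac dp] := cover p; have [od oU inv cm ci] := homeo c ac.
  have Ux : chart_cod c (chart_map c p) by exists p.
  have [l [W [l0 H]]] := axis_exists (chart_hypersurface ac) m1 Ux.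
  exists l, W; split=> //; rewrite /S /=.
  have H' := near_continuous (cm p dp) H.
  apply: (@filterS _ _ (nbhs_filter p) _ _ _ (filterI H' (open_nbhs_nbhs (conj od dp)))).
  by move=> q [] /= + dq; rewrite (inv q dq).
have un p l W l' W' : S l W p -> S l' W' p -> l = l' /\ W = W'.
  move=> H H'; have [c ac dp] := cover p; have [od oU inv cm ci] := homeo c ac.
  have Ux : chart_cod c (chart_map c p) by exists p.
  have [e [e' [g F]]] := frame_at p.
  have t l1 W1 : S l1 W1 p -> \forall z \near chart_map c p,
      axis l1%:C ((f \o chart_inv c) z) ((half_normal \o chart_inv c) z) = W1.
    move=> HS; have HS' : \forall q \near chart_inv c (chart_map c p),
        axis l1%:C (f q) (half_normal q) = W1 by rewrite (inv p dp).
    exact: (near_continuous (ci _ Ux) HS').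
  have F' : frame ((f \o chart_inv c) (chart_map c p)) 
     ((half_normal \o chart_inv c) (chart_map c p)) e e' g by rewrite /= (inv p dp).
  have E := axis_unique (chart_hypersurface ac) m1 Ux F' (t _ _ H) (t _ _ H').
  split=> //; have := nbhs_singleton H; have := nbhs_singleton H'.
  by rewrite E => <-.
have [l [W [l0 S0]]] := ex p0; exists l, W; split=> // p.
have ST : S l W = [set: M].
  apply: conn; first by exists p0.
    by exists (S l W) => //; rewrite setTI.
  exists (S l W); last by rewrite setTI.
  rewrite -[X in closed X]setCK; apply: open_closedC.
  rewrite openE => q nq; have [l1 [W1 [_ S1]]] := ex q.
  apply: filterS (open_nbhs_nbhs (conj (oS l1 W1) S1)) => r Sr Sr'.
  by have [E1 E2] := un _ _ _ _ _ Sr Sr'; apply: nq; rewrite -E1 -E2.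
have : S l W p by rewrite ST.
exact: nbhs_singleton.
Qed.

End Charts.

(** * The distance to the planes of a hyperplane *)

Section RealInnerProduct.
Context {R : realType} (n : nat).
Local Notation C := R[i].
Implicit Types X Y : 'M[C]_n.

Lemma gmet_sum X Y : gmet X Y = (\sum_i \sum_j (complex.Re (X i j) * complex.Re (Y i j) +
   complex.Im (X i j) * complex.Im (Y i j))) / 4%:R.
Proof.
rewrite /gmet /mxtrace cRe_sum; congr (_ / _); apply: eq_bigr => i _.
rewrite mxE cRe_sum; apply: eq_bigr => j _.
by rewrite hcE cReM cReJ cImJ mulrN opprK.
Qed.

Lemma gmetC X Y : gmet X Y = gmet Y X.
Proof.
rewrite !gmet_sum; congr (_ / _); apply: eq_bigr => i _; apply: eq_bigr => j _.
by rewrite mulrC [X in _ + X]mulrC.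
Qed.

Lemma gmet_ge0 X : 0 <= gmet X X.
Proof.
rewrite gmet_sum divr_ge0 ?ler0n// sumr_ge0// => i _; rewrite sumr_ge0// => j _.
by rewrite -!expr2 addr_ge0// sqr_ge0.
Qed.

Lemma gmet_lin (a b : R) X Y Z :
  gmet (a%:C *: X + b%:C *: Y) Z = a * gmet X Z + b * gmet Y Z.
Proof.
rewrite /gmet mulmxDl -!scalemxAl mxtraceD !mxtraceZ cReD !cReZ mulrDl.
by rewrite !mulrA.
Qed.

Lemma gmet_sqr (a b : R) X Y :
  gmet (a%:C *: X + b%:C *: Y) (a%:C *: X + b%:C *: Y) =
  a ^+ 2 * gmet X X + 2%:R * a * b * gmet X Y + b ^+ 2 * gmet Y Y.
Proof.
rewrite gmet_lin [gmet X _]gmetC [gmet Y (_ + _)]gmetC 2!gmet_lin [gmet Y X]gmetC.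
by move: (gmet X X) (gmet X Y) (gmet Y Y) => x y z; ring.
Qed.

Lemma gmet_cauchy_schwarz X Y : gmet X Y ^+ 2 <= gmet X X * gmet Y Y.
Proof.
have [YY0|YY] := eqVneq (gmet Y Y) 0.
  have : forall t : R, 0 <= gmet X X + t * gmet X Y.
    move=> t; have := gmet_ge0 (1%:C *: X + (t / 2)%:C *: Y).
    rewrite gmet_sqr YY0 mulr0 addr0 expr1n mul1r mulr1.
    by rewrite [2%:R * (t / 2)]mulrC divfK ?pnatr_eq0.
  move=> H; suff -> : gmet X Y = 0 by rewrite expr0n /= mulr_ge0 ?gmet_ge0.
  apply/eqP; apply: contraT => xy0.
  have := H (- (gmet X X + 1) / gmet X Y); rewrite divfK//.
  by rewrite opprD addrA subrr add0r oppr_ge0 ler10.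
have Y0 : 0 < gmet Y Y by rewrite lt_neqAle eq_sym YY gmet_ge0.
have := gmet_ge0 ((gmet Y Y)%:C *: X + (- gmet X Y)%:C *: Y).
rewrite gmet_sqr => H.
rewrite -(ler_pM2l Y0) -subr_ge0; apply: le_trans H _.
by rewrite le_eqVlt; apply/orP; left; apply/eqP; move: (gmet X X) (gmet X Y) (gmet Y Y) => a b c; ring.
Qed.

Lemma gmet_entry X i j : complex.Re (X i j) ^+ 2 + complex.Im (X i j) ^+ 2 <= 4%:R * gmet X X.
Proof.
rewrite gmet_sum mulrC divfK ?pnatr_eq0// (bigD1 i)//= (bigD1 j)//= -!expr2.
rewrite -addrA lerDl addr_ge0//; first rewrite sumr_ge0// => k _.
  by rewrite -!expr2 addr_ge0// sqr_ge0.
rewrite sumr_ge0// => k _; rewrite sumr_ge0// => l _.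
by rewrite -!expr2 addr_ge0// sqr_ge0.
Qed.

End RealInnerProduct.

Section CurveLength.
Context {R : realType} (n : nat) (gam : R -> 'M[R[i]]_n).
Context (hg : mx_Ck 1 [set: R] gam).
Local Notation mu := lebesgue_measure.

Definition speed (t : R) := Num.sqrt (gmet (mx_derive gam t 1) (mx_derive gam t 1)).

Lemma curve_mxd t : mxd gam t 1 (mx_derive gam t 1).
Proof.
move=> i j; rewrite mxE /=; have [[hr _] [hi _]] := hg i j.
split; apply/derivableP.
  exact: (diff_derivable (hr t I)).
exact: (diff_derivable (hi t I)).
Qed.

Lemma continuous_mx_derive i j :
  continuous (fun t : R => complex.Re (mx_derive gam t 1 i j)) /\
  continuous (fun t : R => complex.Im (mx_derive gam t 1 i j)).
Proof.
have [[_ /(_ 1) hr] [_ /(_ 1) hi]] := hg i j.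
split=> t.
  rewrite (_ : (fun _ => _) = (fun t => 'D_1 (re_entry gam i j) t)); first exact: hr.
  by apply/funext => s; rewrite mxE.
rewrite (_ : (fun _ => _) = (fun t => 'D_1 (im_entry gam i j) t)); first exact: hi.
by apply/funext => s; rewrite mxE.
Qed.

Lemma continuous_speed : continuous speed.
Proof.
move=> t; rewrite /speed.
apply: (@continuous_comp _ _ _ (fun t => gmet (mx_derive gam t 1) (mx_derive gam t 1)) (@Num.sqrt R)); last exact: sqrt_continuous.
have -> : (fun t : R => gmet (mx_derive gam t 1) (mx_derive gam t 1)) =
    (fun t : R => (\sum_i \sum_j (complex.Re (mx_derive gam t 1 i j) *
      complex.Re (mx_derive gam t 1 i j) + complex.Im (mx_derive gam t 1 i j) *
      complex.Im (mx_derive gam t 1 i j))) / 4%:R).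
  by apply/funext => s; rewrite gmet_sum.
apply: continuousM; last exact: cst_continuous.
apply: (continuous_bigsum _) => i; apply: (continuous_bigsum _) => j.
have [cr ci] := continuous_mx_derive i j.
by apply: continuousD; apply: continuousM; (exact: cr || exact: ci).
Qed.

(** The bound is asked on the open interval only: a curve stays in the Grassmannian for times in
    [0, 1], so its velocity is known to be tangent at interior times. *)
Lemma length_ge (phi phi' : R -> R) (K : R) : 0 <= K ->
  (forall t : R, 0 <= t <= 1 -> is_derive t (1 : R) phi (phi' t)) ->
  {within `[0 : R, 1], continuous phi'} ->
  (forall t : R, 0 < t < 1 -> phi' t <= K * speed t) ->
  ((phi 1 - phi 0)%:E <= K%:E * curve_length gam)%E.
Proof.
move=> K0 d c le.
have cphi (t : R) : 0 <= t <= 1 -> {for t, continuous phi}.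
  by move=> /d /is_derive_continuous.
have -> : ((phi 1 - phi 0)%:E = \int[mu]_(t in `[0%R, 1%R]) (phi' t)%:E)%E.
  rewrite (@continuous_FTC2 _ phi' phi 0 1)//.
  - split.
    + by move=> t; rewrite in_itv/= => /andP[t0 t1]; have [] := d t; rewrite ?ltW.
    + by apply: cvg_at_right_filter; apply: cphi; rewrite lexx ler01.
    + by apply: cvg_at_left_filter; apply: cphi; rewrite lexx ler01.
  - move=> t; rewrite in_itv/= => /andP[t0 t1].
    by have [|_ <-] := d t; rewrite ?ltW// derive1E.
have cs : {within `[(0 : R), 1], continuous (fun t => K * speed t)}.
  apply: continuous_subspaceT => t; apply: continuousM; first exact: cst_continuous.
  exact: continuous_speed.
have i1 := continuous_compact_integrable (@segment_compact _ 0 1) c.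
have i2 := continuous_compact_integrable (@segment_compact _ 0 1) cs.
have i3 := continuous_compact_integrable (@segment_compact _ 0 1)
  (continuous_subspaceT continuous_speed).
have mitv : measurable `[(0 : R), 1] by exact: measurable_itv.
have sub : `](0 : R), 1[ `<=` `[0, 1] by exact: subset_itv_oo_cc.
have m1 := measurable_funS mitv sub (measurable_int _ i1).
have m2 := measurable_funS mitv sub (measurable_int _ i2).
have -> : (K%:E * curve_length gam = \int[mu]_(t in `[0%R, 1%R]) (K * speed t)%:E)%E.
  rewrite /curve_length -ge0_integralZl_EFin//.
  exact: (measurable_int _ i3).
rewrite (integral_itv_bndoo _ _ m1) (integral_itv_bndoo _ _ m2).
apply: le_integral.
- exact: measurable_itv.
- by apply: integrableS i1.
- by apply: integrableS i2.
- by move=> t; rewrite inE /= in_itv /= => t01; rewrite lee_fin le.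
Qed.

End CurveLength.

Lemma tr_pair (R : realType) n (X : 'M[R[i]]_n) (a b : 'rV[R[i]]_n) :
  dot (a *m X) a = 0 -> dot (b *m X) b = 0 ->
  \tr (X *m (a ^t* *m b + b ^t* *m a)) = dot ((a + b) *m X) (a + b).
Proof.
move=> aXa bXb; rewrite mxtrace_mulC mulmxDl mxtraceD 2!dot_tr.
by rewrite mulmxDl dotDl 2!dotDr aXa bXb add0r addr0 addrC.
Qed.

Lemma tr_pair_sqr (R : realType) n (a b : 'rV[R[i]]_n) :
  dot a b = 0 -> dot b a = 0 ->
  \tr ((a ^t* *m b + b ^t* *m a) *m (a ^t* *m b + b ^t* *m a)) =
  2%:R * (dot a a * dot b b).
Proof.
move=> ab ba; rewrite {1}mulmxDl mxtraceD 2!dot_tr 2!mulmxDr !mulmxA !row_dot ab ba.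
rewrite !scale0r addr0 add0r 2!dotZl [dot b b * _]mulrC.
by rewrite mulr_natl mulr2n.
Qed.

Section HeightDerivative.
Context {R : realType} (n : nat) (Q X : 'M[R[i]]_n) (w : 'rV[R[i]]_n).
Local Notation C := R[i].
Context (QH : Q ^t* = Q) (QQ : Q *m Q = Q).
Context (ww : dot w w = 1).

Definition height (M : 'M[C]_n) : R := complex.Re (dot (w *m M) w).

Local Notation a := (w *m Q).
Local Notation b := (w - w *m Q).

Lemma height_dots : [/\ dot a a = dot a w, dot b b = 1 - dot a w,
  dot a b = 0 & dot b a = 0].
Proof.
have aa : dot a a = dot a w by rewrite -[in RHS]QQ mulmxA [RHS]dotM QH.
have D (c d e : 'rV[C]_n) : dot (c - d) e = dot c e - dot d e.
  by rewrite -scaleN1r dotDl dotZl mulN1r.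
have D' (c d e : 'rV[C]_n) : dot e (c - d) = dot e c - dot e d.
  by rewrite -scaleN1r dotDr dotZr rmorphN1 mulN1r.
have wa : dot w a = dot a a by rewrite [LHS]dotC -aa -dotC.
have ba : dot b a = 0 by rewrite D wa subrr.
have ab : dot a b = 0 by rewrite [LHS]dotC ba rmorph0.
split; [exact: aa| |exact: ab|exact: ba].
by rewrite D' ba subr0 D ww.
Qed.

Lemma height_real : dot a w = (height Q)%:C.
Proof.
have [aa _ _ _] := height_dots; apply: complex_eq => //=.
by rewrite -aa ger0_Im// dot_ge0.
Qed.

Lemma height_itv : 0 <= height Q <= 1.
Proof.
have [aa bb _ _] := height_dots; rewrite height_real in aa bb.
have := dot_ge0 a; have := dot_ge0 b; rewrite aa bb.
by rewrite -(rmorph1 (real_complex R)) -rmorphB !ler0c subr_ge0 => -> ->.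
Qed.

Context (XH : X ^t* = X) (XT : X *m Q + Q *m X = X).

(** With a = w Q and b = w - w Q, the matrix Y = a^*b + b^*a represents the differential of the
    height: the height of X is tr (X Y), that is 4 times the metric product, and Y has squared
    length h (1 - h) / 2. The factor 8 is 16 / 2 in Cauchy-Schwarz. *)
Lemma height_derivative_bound :
  height X ^+ 2 <= 8%:R * (height Q * (1 - height Q)) * gmet X X.
Proof.
have [aa bb ab ba] := height_dots; rewrite height_real in aa bb.
pose Y := a ^t* *m b + b ^t* *m a.
have YH : Y ^t* = Y by rewrite /Y hcD !hcM !hcK addrC.
have QXQ : Q *m X *m Q = 0 by exact: PNP0.
have aXa : dot (a *m X) a = 0.
  by rewrite -[X in dot _ (_ *m X)]QH -dotM -!mulmxA (mulmxA Q) QXQ mulmx0 dot0l.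
have bXb : dot (b *m X) b = 0.
  have -> : b = w *m (1%:M - Q) by rewrite mulmxBr mulmx1.
  have H1 : (1%:M - Q) ^t* = 1%:M - Q by rewrite hcB hc1 QH.
  rewrite -[X in dot _ (_ *m X)]H1 -dotM -!mulmxA (mulmxA _ X).
  have -> : (1%:M - Q) *m X *m (1%:M - Q) = 0.
    rewrite mulmxBl mul1mx mulmxBr mulmx1 mulmxBl QXQ subr0 -{1}XT.
    by rewrite addrK subrr.
  by rewrite mulmx0 dot0l.
have tX : \tr (X *m Y) = dot (w *m X) w.
  by rewrite /Y (tr_pair aXa bXb) addrC subrK.
have tY : \tr (Y *m Y) = 2%:R * ((height Q)%:C * (1 - (height Q)%:C)).
  by rewrite /Y (tr_pair_sqr ab ba) aa bb.
have := gmet_cauchy_schwarz X Y; rewrite {1}/gmet YH tX {2}/gmet YH tY.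
rewrite -(rmorph1 (real_complex R)) -rmorphB -rmorphM.
rewrite -(rmorph_nat (real_complex R)) -rmorphM /=.
rewrite -/(height X); move: (height X) (height Q) (gmet X X) => x q g.
nra.
Qed.

End HeightDerivative.

Section CurveBounds.
Context {R : realType} (n : nat).
Local Notation C := R[i].
Implicit Types P Q : 'M[C]_n.

Lemma curve_tangent P Q gam (t : R) : gr2_curve P Q gam -> 0 < t < 1 ->
  gr2_tangent (gam t) (mx_derive gam t 1).
Proof.
move=> [hg gr _ _] t01; have d := curve_mxd hg t.
have N : \forall s \near t, gr2 (gam s).
  have := near_in_itvoo (x := t) (a := 0) (b := 1); rewrite in_itv/= => /(_ t01).
  by apply: filterS => s; rewrite in_itv/= => /andP[s0 s1]; apply: gr; rewrite !ltW.
split.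
  by apply: mxd_hermitian d _; apply: filterS N => s [].
have E : \forall s \near t, gam s *m gam s = gam s by apply: filterS N => s [].
exact: mxd_uniq (mxd_near E (mxdM d d)) d.
Qed.

(** This compares the Riemannian distance with the ambient one; the factor 2 undoes the 1/4 in
    [gmet]. *)
Lemma curve_entry P Q gam i j : gr2_curve P Q gam ->
  ((`|complex.Re (Q i j) - complex.Re (P i j)|)%:E <= 2%:E * curve_length gam)%E /\
  ((`|complex.Im (Q i j) - complex.Im (P i j)|)%:E <= 2%:E * curve_length gam)%E.
Proof.
move=> [hg gr g0 g1].
have d (g : C -> R) (gc : bool) : g = (if gc then @complex.Re R else @complex.Im R) ->
    ((`|g (Q i j) - g (P i j)|)%:E <= 2%:E * curve_length gam)%E.
  move=> gE.
  have dg t : is_derive t (1 : R) (fun t => g (gam t i j)) (g (mx_derive gam t 1 i j)).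
    by have [] := curve_mxd hg t i j; rewrite gE; case: (gc).
  have cg : continuous (fun t => g (mx_derive gam t 1 i j)).
    by have [cr ci] := continuous_mx_derive hg i j; rewrite gE; case: (gc).
  have bd t : `|g (mx_derive gam t 1 i j)| <= 2%:R * speed gam t.
    rewrite -(ler_pXn2r (n := 2))// ?nnegrE ?mulr_ge0 ?sqrtr_ge0 ?ler0n//.
    rewrite exprMn sqr_sqrtr ?gmet_ge0// real_normK ?num_real//.
    rewrite (_ : 2%:R ^+ 2 = 4%:R :> R); last by rewrite -natrX.
    apply: le_trans (gmet_entry _ i j); rewrite gE; case: (gc).
      by rewrite lerDl sqr_ge0.
    by rewrite lerDr sqr_ge0.
  rewrite -g0 -g1; have [le0|le0] := leP 0 (g (gam 1 i j) - g (gam 0 i j)).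
    rewrite (ger0_norm le0).
    apply: (length_ge hg (ler0n _ 2) (fun t _ => dg t)).
    + exact: continuous_subspaceT.
    + by move=> t _; apply: le_trans (bd t); exact: ler_norm.
  rewrite (ltr0_norm le0) opprB addrC -[X in _ + X]opprK.
  have dg' t : is_derive t (1 : R) (fun t => - g (gam t i j)) (- g (mx_derive gam t 1 i j)).
    exact: is_deriveN (dg t).
  apply: (length_ge hg (ler0n _ 2) (fun t _ => dg' t)).
  + by apply: continuous_subspaceT => t; apply: continuousN; exact: cg.
  + by move=> t _; apply: le_trans (bd t); rewrite -normrN; exact: ler_norm.
by split; [exact: (d _ true)|exact: (d _ false)].
Qed.

Lemma rdist_lt_entry P Q (e : R) i j : (rdist P Q < e%:E)%E ->
  `|complex.Re (Q i j) - complex.Re (P i j)| < 2%:R * e /\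
  `|complex.Im (Q i j) - complex.Im (P i j)| < 2%:R * e.
Proof.
move=> /ereal_inf_lt[_ [gam hgam <-] le].
have [h1 h2] := curve_entry i j hgam.
have lt : (2%:E * curve_length gam < (2%:R * e)%:E)%E.
  by rewrite EFinM lte_pmul2l ?lte_fin ?ltr0n.
by split; rewrite -lte_fin; [exact: le_lt_trans h1 lt|exact: le_lt_trans h2 lt].
Qed.

Section Angle.
Context (w : 'rV[C]_n) (ww : dot w w = 1).
Local Notation h := (height w).

Lemma height_mxd F (t : R) F' : mxd F t (1 : R) F' ->
  is_derive t (1 : R) (fun t => h (F t)) (h F').
Proof.
move=> d; have dw := mxdM (mxd_cst w t (1 : R)) d; rewrite mul0mx add0r in dw.
have [H _] := mxd_dot dw (mxd_cst w t 1).
by rewrite dot0r addr0 in H.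
Qed.

Lemma continuous_height (F : R -> 'M[C]_n) (t : R) :
  (forall i j, {for t, continuous (fun t : R => complex.Re (F t i j))} /\
               {for t, continuous (fun t : R => complex.Im (F t i j))}) ->
  {for t, continuous (fun t : R => h (F t))}.
Proof.
move=> c; have -> : (fun t : R => h (F t)) = (fun t : R => \sum_j \sum_i
    (complex.Re (w 0 i * (w ^t*) j 0) * complex.Re (F t i j) -
     complex.Im (w 0 i * (w ^t*) j 0) * complex.Im (F t i j))).
  apply/funext => s; rewrite /height dotE mxE cRe_sum; apply: eq_bigr => j _.
  rewrite [X in X * _]mxE mulr_suml cRe_sum; apply: eq_bigr => i _.
  by apply: etrans (cReM _ _); congr complex.Re; exact: mulrAC.
apply: (continuous_bigsum _) => j; apply: (continuous_bigsum _) => i.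
have [cr ci] := c i j.
by apply: continuousB; apply: continuousM => //; exact: cst_continuous.
Qed.

Lemma continuous_quotient (k : R) (c c' : R -> R) (t : R) :
  {for t, continuous c} -> {for t, continuous c'} -> 0 < 1 - (k * c t) ^+ 2 ->
  {for t, continuous (fun t => k * c' t / Num.sqrt (1 - (k * c t) ^+ 2))}.
Proof.
move=> cc cc' r0; apply: continuousM.
  by apply: continuousM => //; exact: cst_continuous.
apply: continuousV; first by rewrite gt_eqF// sqrtr_gt0.
apply: (@continuous_comp _ _ _ (fun t => 1 - (k * c t) ^+ 2) (@Num.sqrt R)).
  apply: continuousB; first exact: cst_continuous.
  rewrite (_ : (fun _ => _) = (fun t => (k * c t) * (k * c t))); last first.
    by apply/funext => s; rewrite expr2.
  by apply: continuousM; apply: continuousM => //; exact: cst_continuous.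
exact: sqrt_continuous.
Qed.

(** Since 4 q (1 - q) = 1 - c^2, the squared inequality reduces to k^2 - (k c)^2 <= 1 - (k c)^2. *)
Lemma angle_speed_bound (k c x q sp S r : R) : 0 < k < 1 -> c = 1 - 2%:R * q ->
  0 <= q <= 1 -> x ^+ 2 <= 8%:R * (q * (1 - q)) * sp ^+ 2 -> 0 <= sp -> 0 < S ->
  S ^+ 2 = 1 - (k * c) ^+ 2 -> 0 <= r -> r ^+ 2 = 2%:R ->
  k * - (2%:R * x) <= 2%:R * r * sp * S.
Proof.
move=> /andP[k0 k1] cE /andP[q0 q1] H sp0 S0 SE r0 rE.
apply: (le_trans (ler_norm _)); have S1 := ltW S0.
rewrite -(ler_pXn2r (n := 2))// ?nnegrE ?mulr_ge0//.
rewrite real_normK ?num_real//.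
have -> : (2%:R * r * sp * S) ^+ 2 = 8%:R * sp ^+ 2 * (1 - (k * c) ^+ 2).
  by rewrite -SE !exprMn rE -natrX; ring.
have -> : (k * - (2%:R * x)) ^+ 2 = 4%:R * k ^+ 2 * x ^+ 2 by ring.
have kk : k ^+ 2 <= 1 by rewrite expr_le1// ltW.
apply: (@le_trans _ _ (4%:R * k ^+ 2 * (8%:R * (q * (1 - q)) * sp ^+ 2))).
  by rewrite ler_wpM2l// mulr_ge0// sqr_ge0.
have -> : 4%:R * k ^+ 2 * (8%:R * (q * (1 - q)) * sp ^+ 2) =
    8%:R * sp ^+ 2 * (k ^+ 2 - (k * c) ^+ 2) by rewrite cE; ring.
by rewrite ler_wpM2l ?mulr_ge0 ?sqr_ge0// lerD2r.
Qed.

(* The factor [cos delta] keeps the argument away from 1 and -1, where [acos]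
   is not differentiable. *)
Lemma curve_angle P Q gam (delta : R) : gr2_curve P Q gam -> h Q = 0 ->
  0 < delta < 1 ->
  ((acos (cos delta * (1 - 2%:R * h P)) - delta)%:E <=
    (2%:R * Num.sqrt 2%:R)%:E * curve_length gam)%E.
Proof.
move=> gc hQ /andP[d0 d1]; have [hg gr g0 g1] := gc.
have pi1 : 1 < (pi : R) by apply: lt_le_trans (pi_ge2 _); rewrite ltr1n.
have k0 : 0 < cos delta.
  apply: cos_gt0_pihalf; have := pi_ge2 R => p2.
  by apply/andP; split; lra.
have k1 : cos delta < 1.
  rewrite -cos0 ltr_cos// in_itv/= ?lexx ?pi_ge0//= ltW//= ltW//.
  exact: lt_trans d1 pi1.
pose c (t : R) : R := 1 - 2%:R * h (gam t).
pose c' (t : R) : R := - (2%:R * h (mx_derive gam t 1)).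
have dc t : is_derive t (1 : R) c (c' t).
  have := is_deriveB (is_derive_cst (1 : R) t 1) (is_deriveZ 2%:R (height_mxd (curve_mxd hg t))).
  by rewrite sub0r.
have cB (t : R) : 0 <= t <= 1 -> -1 <= c t <= 1.
  move=> /gr [GH GG _]; have /andP[a0 a1] := height_itv GH GG ww.
  rewrite /c; move: a0 a1; move: (h _) => x *; apply/andP; split; lra.
have kcB (t : R) : 0 <= t <= 1 -> -1 < cos delta * c t < 1.
  move=> /cB /andP[]; move: (c t) (cos delta) k0 k1 => x k *; apply/andP; split; nra.
have sB (t : R) : 0 <= t <= 1 -> 0 < 1 - (cos delta * c t) ^+ 2.
  move=> /kcB /andP[]; move: (cos delta * c t) => x *; nra.
pose phi (t : R) : R := - acos (cos delta * c t).
pose phi' (t : R) : R := cos delta * c' t / Num.sqrt (1 - (cos delta * c t) ^+ 2).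
have dphi (t : R) : 0 <= t <= 1 -> is_derive t (1 : R) phi (phi' t).
  move=> t01; have D1 := is_derive1_acos (kcB t t01).
  have D2 := is_deriveZ (cos delta) (dc t).
  have := is_deriveN (@is_derive1_comp _ (@acos R) (fun t => cos delta * c t) _ _ _ D1 D2).
  by rewrite /phi' mulNr opprK mulrC.
have := length_ge hg (phi := phi) (phi' := phi') (K := 2%:R * Num.sqrt 2%:R).
rewrite /phi /c g0 g1 hQ mulr0 subr0 mulr1 opprK addrC cosK; last first.
  by rewrite in_itv/= (ltW d0) ltW// (lt_trans d1).
apply=> //.
- apply: continuous_in_subspaceT => t; rewrite inE /= in_itv/= => t01.
  apply: (continuous_quotient (k := cos delta) (c := c) (c' := c')).
  + exact: is_derive_continuous (dc t).
  + apply: continuousN; apply: continuousM; first exact: cst_continuous.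
    apply: continuous_height => i j; have [cr ci] := continuous_mx_derive hg i j.
    by split; [exact: cr|exact: ci].
  + exact: sB.
- move=> t t01; have t01' : 0 <= t <= 1 by move/andP: t01 => [? ?]; rewrite !ltW.
  have [GH GG _] := gr t t01'; have [XH XT] := curve_tangent gc t01.
  have := height_derivative_bound GH GG ww XT.
  have sp0 : 0 <= speed gam t := sqrtr_ge0 _.
  have sp : gmet (mx_derive gam t 1) (mx_derive gam t 1) = speed gam t ^+ 2.
    by rewrite sqr_sqrtr// gmet_ge0.
  have s0 := sB t t01'; have s1 := cB t t01'.
  have r0 : 0 < Num.sqrt (1 - (cos delta * c t) ^+ 2) by rewrite sqrtr_gt0.
  have r2 : Num.sqrt (2%:R : R) ^+ 2 = 2%:R by rewrite sqr_sqrtr.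
  have rs : Num.sqrt (1 - (cos delta * c t) ^+ 2) ^+ 2 = 1 - (cos delta * c t) ^+ 2.
    by rewrite sqr_sqrtr// ltW.
  rewrite sp /phi' ler_pdivrMr// => H.
  apply: (angle_speed_bound _ erefl (height_itv GH GG ww) H sp0 r0 rs _ r2).
    by rewrite k0 k1.
  exact: sqrtr_ge0.
Qed.

(** Let delta tend to 0 in [curve_angle]: the height of P lies strictly between 0 and 1, where the
    arccosine is continuous. *)
Lemma rdist_angle P Q : 0 < h P < 1 -> h Q = 0 ->
  ((acos (1 - 2%:R * h P) / (2%:R * Num.sqrt 2%:R))%:E <= rdist P Q)%E.
Proof.
move=> /andP[h0 h1] hQ; apply: le_ereal_inf_tmp => _ [gam gc <-].
have K0 : 0 < 2%:R * Num.sqrt 2%:R :> R by rewrite mulr_gt0// sqrtr_gt0.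
have H d := @curve_angle P Q gam d gc hQ; move: H.
case: (curve_length gam) => [l||] H.
- rewrite lee_fin ler_pdivrMr//.
  pose g (d : R) := acos (cos d * (1 - 2%:R * h P)) - d.
  have g0 : g 0 = acos (1 - 2%:R * h P) by rewrite /g cos0 mul1r subr0.
  rewrite leNgt; apply/negP => lt.
  have cg : {for 0, continuous g}.
    apply: continuousB; last exact: cvg_id.
    apply: (@continuous_comp _ _ _ (fun d => cos d * (1 - 2%:R * h P)) (@acos R)).
      by apply: continuousM; [exact: continuous_cos|exact: cst_continuous].
    apply: continuous_acos; rewrite cos0 mul1r; apply/andP.
    by move: (h P) h0 h1 => x *; split; lra.
  have lt' : l * (2%:R * Num.sqrt 2%:R) < g 0 by rewrite g0.
  have N := cvgr_gt _ cg _ lt'.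
  have {}N : \forall d \near (0 : R), l * (2%:R * Num.sqrt 2%:R) < g d := N (nbhs_filter (0 : R)).
  move: N => /nbhs_normP[e /= e0 He].
  pose d : R := Num.min (e / 2%:R) (2%:R^-1).
  have d0 : 0 < d by rewrite lt_min invr_gt0 divr_gt0//= ltr0n.
  have d1 : d < 1 by rewrite gt_min invf_lt1 ?ltr0n// ltr1n orbT.
  have de : d < e by rewrite gt_min ltr_pdivrMr// ltr_pMr// ltr1n.
  have := He d; rewrite /= sub0r normrN gtr0_norm// => /(_ de).
  have := H d; rewrite d0 d1 -EFinM lee_fin => /(_ isT).
  rewrite -/(g d) mulrC => h2 h3.
  by have := le_lt_trans h2 h3; rewrite ltxx.
- exact: leey.
(* A length is an extended real, so the value minus infinity is excluded by one instance of the
   lower bound. *)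
- have := H (2%:R^-1); rewrite invr_gt0 ltr0n invf_lt1 ?ltr0n// ltr1n => /(_ isT).
  by rewrite mulrNy gtr0_sg// mul1e leeNy_eq.
Qed.

End Angle.
End CurveBounds.

(** * Rotating a plane into the hyperplane along a shortest curve *)

Section PlaneRotation.
Context {C : numClosedFieldType} (n : nat) (Q : 'M[C]_n) (a b : 'rV[C]_n).
Context (QH : Q ^t* = Q) (QQ : Q *m Q = Q) (Qt : \tr Q = 2).
Context (aa : a *m a ^t* = 1%:M) (bb : b *m b ^t* = 1%:M) (ab : a *m b ^t* = 0).
Context (aQ : a *m Q = a) (bQ : b *m Q = 0).

Lemma rotated_plane (c s : C) : Num.conj c = c -> Num.conj s = s ->
  c * c + s * s = 1 ->
  let v := c *: a - s *: b in
  let G := Q - a ^t* *m a + v ^t* *m v in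
  [/\ G ^t* = G, G *m G = G & \rank G = 2%N].
Proof.
move=> cc sc cs1 v G.
have ba : b *m a ^t* = 0 by rewrite -[LHS]hcK hcM hcK ab hc0.
have Qa : Q *m a ^t* = a ^t* by rewrite -{1}QH -hcM aQ.
have Q0H : (Q - a ^t* *m a) ^t* = Q - a ^t* *m a by rewrite hcB hcM hcK QH.
have vH : (v ^t* *m v) ^t* = v ^t* *m v by rewrite hcM hcK.
have vv : v *m v ^t* = 1%:M.
  rewrite /v hcB !hcZ cc sc mulmxBl !mulmxBr -!scalemxAl -!scalemxAr aa bb ab ba.
  by rewrite !scaler0 subr0 sub0r opprK !scalerA -scalerDl cs1 scale1r.
have vQ0 : v *m (Q - a ^t* *m a) = 0.
  rewrite mulmxBr /v !mulmxBl -!scalemxAl aQ bQ !mulmxA aa ba mul1mx mul0mx.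
  by rewrite scaler0 subrr.
have Q0v : (Q - a ^t* *m a) *m v ^t* = 0 by rewrite -Q0H -hcM vQ0 hc0.
have Q0Q0 : (Q - a ^t* *m a) *m (Q - a ^t* *m a) = Q - a ^t* *m a.
  rewrite mulmxBl !mulmxBr QQ mulmxA Qa -!mulmxA aQ (mulmxA a) aa mul1mx.
  by rewrite subrr subr0.
have GG : G *m G = G.
  rewrite /G; clear vH; clearbody v; move: Q0Q0 Q0v vQ0; move: (Q - a ^t* *m a) => Q0 Q0Q0 Q0v vQ0.
  have E1 : Q0 *m (v ^t* *m v) = 0 by rewrite mulmxA Q0v mul0mx.
  have E2 : v ^t* *m v *m Q0 = 0 by rewrite -mulmxA vQ0 mulmx0.
  have E3 : v ^t* *m v *m (v ^t* *m v) = v ^t* *m v.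
    by rewrite -mulmxA (mulmxA v) vv mul1mx.
  by rewrite mulmxDl 2!mulmxDr Q0Q0 E1 E2 E3 addr0 add0r.
split=> //; first by rewrite /G hcD Q0H vH.
have T (x : 'rV[C]_n) : x *m x ^t* = 1%:M -> \tr (x ^t* *m x) = 1.
  by move=> xx; rewrite mxtrace_mulC xx mxtrace1.
have := tr_idem GG; rewrite /G mxtraceD raddfB /= Qt !T// subrK => /eqP.
by rewrite -[2]/(2%:R) eqr_nat => /eqP ->.
Qed.

(** In the application w = s a + c b, and the rotated vector c a - s b is orthogonal to it; so the
    rotated plane lies in the hyperplane orthogonal to w. *)
Lemma rotation_end (c s : C) : Num.conj c = c -> Num.conj s = s ->
  (s *: a + c *: b) *m
    (Q - a ^t* *m a + (c *: a - s *: b) ^t* *m (c *: a - s *: b)) = 0.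
Proof.
move=> cc sc; have ba : b *m a ^t* = 0 by rewrite -[LHS]hcK hcM hcK ab hc0.
have H1 : (s *: a + c *: b) *m Q = s *: a.
  by rewrite mulmxDl -!scalemxAl aQ bQ scaler0 addr0.
have H2 : (s *: a + c *: b) *m a ^t* = s%:M.
  by rewrite mulmxDl -!scalemxAl aa ba scaler0 addr0 scale_scalar_mx mulr1.
have H3 : (s *: a + c *: b) *m (c *: a - s *: b) ^t* = 0.
  rewrite hcB !hcZ cc sc mulmxDl !mulmxBr -!scalemxAl -!scalemxAr aa bb ab ba.
  by rewrite !scaler0 subr0 sub0r !scalerA mulrC subrr.
rewrite mulmxDr mulmxBr H1 [_ *m (a ^t* *m a)]mulmxA H2 mul_scalar_mx subrr add0r.
by rewrite mulmxA H3 mul0mx.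
Qed.

End PlaneRotation.

Section Hyperplane.
Context {R : realType} (m : nat) (w : 'rV[R[i]]_m.+2) (ww : dot w w = 1).
Local Notation C := R[i].
Local Notation n := m.+2.

Definition perp : 'M[C]_n := 1%:M - w ^t* *m w.

Let w1 : w *m w ^t* = 1%:M.
Proof. by rewrite [LHS]mx11_scalar -dotE ww. Qed.

Lemma rank_perp : \rank perp = m.+1.
Proof.
have PP : perp *m perp = perp.
  rewrite {1}/perp mulmxBl mul1mx -mulmxA.
  have -> : w *m perp = 0 by rewrite /perp mulmxBr mulmx1 mulmxA w1 mul1mx subrr.
  by rewrite mulmx0 subr0.
have := tr_idem PP; rewrite /perp raddfB /= mxtrace1 mxtrace_mulC w1 mxtrace1.
by rewrite -natr1 addrK => /eqP; rewrite eqr_nat => /eqP <-.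
Qed.

Lemma sub_perp (P : 'M[C]_n) : P ^t* = P -> (P <= perp)%MS <-> w *m P = 0.
Proof.
move=> PH; split=> [/submxP[D PE]|wP].
  rewrite -[w *m P]hcK hcM PH PE -mulmxA /perp mulmxBl mul1mx -(mulmxA _ w) w1.
  by rewrite mulmx1 subrr mulmx0 hc0.
have Pw : P *m w ^t* = 0 by rewrite -PH -hcM wP hc0.
apply/submxP; exists P; rewrite /perp mulmxBr mulmx1 mulmxA Pw mul0mx.
by rewrite subr0.
Qed.

End Hyperplane.

Section Geodesic.
Context {R : realType} (n : nat).
Local Notation C := R[i].

Lemma Ck1_of_mxd (F F' : R -> 'M[C]_n) :
  (forall t, mxd F t (1 : R) (F' t)) ->
  (forall t, exists F'', mxd F' t (1 : R) F'') -> mx_Ck 1 [set: R] F.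
Proof.
move=> dF dF' i j.
have K (g g' : R -> R) : (forall t : R, is_derive t (1 : R) g (g' t)) -> continuous g' ->
    Ck 1 [set: R] g.
  move=> dg cg; split.
    by move=> t _; have [d _] := dg t; exact/derivable1_diffP.
  move=> v t _ /=; have -> : (fun x => 'D_v g x) = (fun x => v * g' x).
    apply/funext => x; have [d <-] := dg x.
    have D : differentiable g x by exact/derivable1_diffP.
    rewrite !deriveE// -[v in LHS]mulr1 -[v * 1]/(v *: (1 : R)) linearZ /=.
    by [].
  by apply: continuousM; [exact: cst_continuous|exact: cg].
split.
  apply: (K _ (fun t => complex.Re (F' t i j))).
    by move=> t; have [] := dF t i j.
  by move=> t; have [F'' /(_ i j)[d _]] := dF' t; exact: is_derive_continuous d.
apply: (K _ (fun t => complex.Im (F' t i j))).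
  by move=> t; have [] := dF t i j.
by move=> t; have [F'' /(_ i j)[_ d]] := dF' t; exact: is_derive_continuous d.
Qed.

Context (Q0 : 'M[C]_n) (a b : 'rV[C]_n) (th : R).

(** Of the initial plane, the line of [a] turns through the angle th t in the span of [a] and [b],
    while the part with projection [Q0] stays fixed. *)
Definition turn (t : R) : 'rV[C]_n :=
  (cos (th * t))%:C *: a - (sin (th * t))%:C *: b.
Definition turn' (t : R) : 'rV[C]_n :=
  (- th)%:C *: ((sin (th * t))%:C *: a + (cos (th * t))%:C *: b).
Definition geodesic (t : R) : 'M[C]_n := Q0 + (turn t) ^t* *m turn t.
Definition geodesic' (t : R) : 'M[C]_n :=
  (turn' t) ^t* *m turn t + (turn t) ^t* *m turn' t.

Let dmul (t : R) : is_derive t (1 : R) (fun t : R => th * t) th.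
Proof.
have := is_deriveZ th (is_derive_id t (1 : R)).
by rewrite /GRing.scale /= mulr1.
Qed.

Let dcos (t : R) : is_derive t (1 : R) (fun t : R => cos (th * t)) (- th * sin (th * t)).
Proof.
have := @is_derive1_comp _ (@cos R) (fun t => th * t) _ _ _ (is_derive_cos _) (dmul t).
have -> : - sin (th * t) * th = - th * sin (th * t) by ring.
by [].
Qed.

Let dsin (t : R) : is_derive t (1 : R) (fun t : R => sin (th * t)) (th * cos (th * t)).
Proof.
have := @is_derive1_comp _ (@sin R) (fun t => th * t) _ _ _ (is_derive_sin _) (dmul t).
by rewrite mulrC.
Qed.

Lemma mxd_turn t : mxd turn t (1 : R) (turn' t).
Proof.
have := mxdB (mxd_scale (dcos t) (mxd_cst a t 1)) (mxd_scale (dsin t) (mxd_cst b t 1)).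
rewrite !scaler0 !addr0 /turn' scalerDr !scalerA -scaleNr -rmorphN -mulNr.
by rewrite -!rmorphM.
Qed.

Lemma mxd_turn' t : exists T, mxd turn' t (1 : R) T.
Proof.
have D := mxdD (mxd_scale (dsin t) (mxd_cst a t 1)) (mxd_scale (dcos t) (mxd_cst b t 1)).
exact: (ex_intro _ _ (mxdZ (- th)%:C D)).
Qed.

Lemma geodesic_Ck1 : mx_Ck 1 [set: R] geodesic.
Proof.
apply: (@Ck1_of_mxd geodesic geodesic') => t.
  have := mxdD (mxd_cst Q0 t 1) (mxdM (mxd_hc (mxd_turn t)) (mxd_turn t)).
  by rewrite add0r.
have [T dT] := mxd_turn' t.
eexists; exact: mxdD (mxdM (mxd_hc dT) (mxd_turn t)) (mxdM (mxd_hc (mxd_turn t)) dT).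
Qed.

Lemma geodesic_derive t : mx_derive geodesic t 1 = geodesic' t.
Proof.
have D := mxdD (mxd_cst Q0 t 1) (mxdM (mxd_hc (mxd_turn t)) (mxd_turn t)).
by rewrite add0r in D; exact: mxd_uniq (curve_mxd geodesic_Ck1 t) D.
Qed.

Context (aa : dot a a = 1) (bb : dot b b = 1) (ab : dot a b = 0).

Lemma geodesic_length : 0 <= th ->
  curve_length geodesic = (th / Num.sqrt 2%:R)%:E.
Proof.
move=> th0; have S t : speed geodesic t = th / Num.sqrt 2%:R.
  rewrite /speed geodesic_derive.
  pose c : C := (cos (th * t))%:C; pose s : C := (sin (th * t))%:C.
  pose u := s *: a + c *: b.
  have ba : dot b a = 0 by rewrite [LHS]dotC ab rmorph0.
  have cc : c * c + s * s = 1.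
    by rewrite /c /s -!rmorphM -rmorphD -!expr2 cos2Dsin2.
  have uu : dot u u = 1.
    rewrite /u dotDl !dotDr !dotZl !dotZr aa bb ab ba !mulr0 addr0 add0r !mulr1.
    by rewrite /s /c !conj_real addrC.
  have vv : dot (turn t) (turn t) = 1.
    rewrite /turn -/c -/s -scaleNr dotDl !dotDr !dotZl !dotZr aa bb ab ba.
    by rewrite !mulr0 addr0 add0r !mulr1 rmorphN /= mulrNN /s /c !conj_real.
  have uv : dot u (turn t) = 0.
    rewrite /turn -/c -/s -scaleNr /u dotDl !dotDr !dotZl !dotZr aa bb ab ba.
    rewrite !mulr0 addr0 add0r !mulr1 rmorphN /= /s /c !conj_real.
    by move: (_%:C) (_%:C) => x y; ring.
  have vu : dot (turn t) u = 0 by rewrite [LHS]dotC uv rmorph0.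
  have -> : geodesic' t = (- th)%:C *: (u ^t* *m turn t + (turn t) ^t* *m u).
    by rewrite /geodesic' /turn' -/c -/s -/u hcZ conj_real -scalemxAl -scalemxAr scalerDr.
  move: (turn t) vv uv vu => v vv uv vu.
  rewrite /gmet hcZ conj_real -scalemxAl -scalemxAr scalerA mxtraceZ.
  have YH : (u ^t* *m v + v ^t* *m u) ^t* = u ^t* *m v + v ^t* *m u.
    by rewrite hcD !hcM !hcK addrC.
  rewrite YH (tr_pair_sqr uv vu) uu vv mulr1 mulr1 -rmorphM cReZ.
  have -> : complex.Re (2%:R : C) = 2%:R by rewrite -(rmorph_nat (real_complex R)).
  rewrite mulrNN; apply/eqP; rewrite -(@eqrXn2 _ 2)// ?sqrtr_ge0 ?divr_ge0 ?sqrtr_ge0//.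
  rewrite sqr_sqrtr ?divr_ge0 ?mulr_ge0// expr_div_n sqr_sqrtr//.
  by apply/eqP; field.
rewrite /curve_length (eq_integral (fun=> (th / Num.sqrt 2%:R)%:E)); last first.
  by move=> t _; rewrite -[X in (X%:E)%E]/(speed geodesic t) S.
rewrite integral_cst; last exact: measurable_itv.
rewrite [X in (_ * X)%E](_ : _ = 1%E) ?mule1//.
by apply: etrans (lebesgue_measure_itv `[(0 : R), 1]) _; rewrite /= lte_fin ltr01 oppr0 adde0.
Qed.

End Geodesic.

Section DistanceToPerp.
Context {R : realType} (m : nat) (w : 'rV[R[i]]_m.+2) (ww : dot w w = 1).
Local Notation C := R[i].
Local Notation n := m.+2.
Local Notation h := (height w).

(** Equivalently arcsin (sqrt x) / sqrt 2: the rotation angle from the plane to the hyperplane,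
    times the speed 1 / sqrt 2 of a unit rotation. *)
Definition angle (x : R) : R := acos (1 - 2%:R * x) / (2%:R * Num.sqrt 2%:R).

Lemma half_angle (x : R) : 0 < x < 1 ->
  let th := acos (1 - 2%:R * x) / 2%:R in
  [/\ 0 <= th, cos th = Num.sqrt (1 - x) & sin th = Num.sqrt x].
Proof.
move=> /andP[x0 x1] th.
have B : -1 <= 1 - 2%:R * x <= 1 by apply/andP; split; lra.
have [a0 api] : 0 <= acos (1 - 2%:R * x) /\ acos (1 - 2%:R * x) <= pi.
  by rewrite acos_ge0// acos_lepi.
have th0 : 0 <= th by rewrite divr_ge0.
have thpi : th <= pi / 2%:R by rewrite ler_pM2r// invr_gt0.
have cth0 : 0 <= cos th.
  apply: cos_ge0_pihalf; rewrite thpi andbT (le_trans _ th0)// oppr_le0.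
  by rewrite divr_ge0// pi_ge0.
have sth0 : 0 <= sin th.
  apply: sin_ge0_pi; rewrite th0 (le_trans thpi)// ler_pdivrMr// ler_peMr// ?pi_ge0//.
  by rewrite ler1n.
have c2 : cos th ^+ 2 = 1 - x.
  have E : cos (th *+ 2) = 1 - 2%:R * x.
    by rewrite -mulr_natr divfK ?pnatr_eq0// acosK// in_itv.
  by move: E; rewrite cos_mulr2n; move: (cos th ^+ 2) => y; lra.
have s2 : sin th ^+ 2 = x by rewrite sin2cos2 c2; ring.
split=> //.
  by rewrite -c2 sqrtr_sqr ger0_norm.
by rewrite -s2 sqrtr_sqr ger0_norm.
Qed.

Lemma rdist_perp_le (Q : 'M[C]_n) : gr2 Q -> 0 < h Q < 1 ->
  exists2 P, sub_gr2 (perp w) P & (rdist Q P <= (angle (h Q))%:E)%E.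
Proof.
move=> [QH QQ Qr] hQ; have /andP[h0 h1] := hQ.
have [dA dB dAB dBA] := height_dots QH QQ ww.
rewrite (height_real QH QQ ww) in dA dB.
have [th0 cth sth] := half_angle hQ.
set th := acos (1 - 2%:R * h Q) / 2%:R in th0 cth sth.
pose a := ((Num.sqrt (h Q))^-1)%:C *: (w *m Q).
pose b := ((Num.sqrt (1 - h Q))^-1)%:C *: (w - w *m Q).
have sA : 0 < Num.sqrt (h Q) by rewrite sqrtr_gt0.
have sB : 0 < Num.sqrt (1 - h Q) by rewrite sqrtr_gt0 subr_gt0.
have unit (x s : R) : s = Num.sqrt x -> 0 < s -> 0 <= x -> (s^-1)%:C * ((s^-1)%:C * x%:C) = 1 :> C.
  move=> -> s0 x0; rewrite -!rmorphM -[X in _ * (_ * X)](sqr_sqrtr x0) expr2.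
  by rewrite mulKf ?gt_eqF// mulVf ?gt_eqF.
have aa : dot a a = 1.
  by rewrite /a dotZl dotZr conj_real dA (unit _ _ erefl)// ltW.
have bb : dot b b = 1.
  rewrite /b dotZl dotZr conj_real dB -(rmorph1 (real_complex R)) -rmorphB.
  by rewrite (unit _ _ erefl)// ltW// subr_gt0.
have ab : dot a b = 0 by rewrite /a /b dotZl dotZr dAB !mulr0.
have ba : dot b a = 0 by rewrite [LHS]dotC ab rmorph0.
have M (x y : 'rV[C]_n) c : dot x y = c -> x *m y ^t* = c%:M.
  by move=> <-; rewrite [LHS]mx11_scalar -dotE.
have aQ : a *m Q = a by rewrite /a -scalemxAl -mulmxA QQ.
have bQ : b *m Q = 0 by rewrite /b -scalemxAl mulmxBl -mulmxA QQ subrr scaler0.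
have aaM := M _ _ _ aa; have bbM := M _ _ _ bb; have abM := M _ _ _ ab.
have baM := M _ _ _ ba; rewrite raddf0 in abM baM.
have wE : w = (Num.sqrt (h Q))%:C *: a + (Num.sqrt (1 - h Q))%:C *: b.
  rewrite /a /b !scalerA -!rmorphM !mulfV ?gt_eqF// !scale1r.
  by rewrite addrC subrK.
pose g := geodesic (Q - a ^t* *m a) a b th.
have Qt : \tr Q = 2 by rewrite (tr_idem QQ) Qr.
have g0 : g 0 = Q.
  by rewrite /g /geodesic /turn mulr0 cos0 sin0 scale1r scale0r subr0 subrK.
have ggr t : gr2 (g t).
  have cs1 : (cos (th * t))%:C * (cos (th * t))%:C + (sin (th * t))%:C * (sin (th * t))%:C = 1 :> C.
    by rewrite -!rmorphM -rmorphD -!expr2 cos2Dsin2.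
  by have [] := rotated_plane QH QQ Qt aaM bbM abM aQ bQ (conj_real _) (conj_real _) cs1.
exists (g 1).
  split; first exact: ggr.
  have [gH _ _] := ggr 1; apply/(sub_perp ww gH).
  rewrite /g /geodesic /turn mulr1 cth sth {1}wE.
  exact: (rotation_end aaM bbM abM aQ bQ (conj_real (Num.sqrt (1 - h Q)))
    (conj_real (Num.sqrt (h Q)))).
apply: ge_ereal_inf; exists (curve_length g).
  by exists g => //; split=> //; exact: geodesic_Ck1.
rewrite (geodesic_length _ aa bb ab th0) lee_fin /angle /th.
by rewrite invfM mulrA.
Qed.

Lemma rdist_set_perp (Q : 'M[C]_n) : gr2 Q -> 0 < h Q < 1 ->
  rdist_set Q (sub_gr2 (perp w)) = (angle (h Q))%:E.
Proof.
move=> gQ hQ; apply/eqP; rewrite eq_le; apply/andP; split.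
  have [P HP le] := rdist_perp_le gQ hQ.
  by apply: ge_ereal_inf; exists (rdist Q P) => //; exists P.
apply: le_ereal_inf_tmp => _ [P [[PH PP Pr] HP] <-].
apply: rdist_angle => //.
by rewrite /height (sub_perp ww PH).1// dot0l.
Qed.

Lemma angle_itv (x : R) : 0 < x < 1 -> 0 < angle x < pi / Num.sqrt 8%:R.
Proof.
move=> /andP[x0 x1]; have s2 : 0 < Num.sqrt 2%:R :> R by rewrite sqrtr_gt0.
have -> : Num.sqrt 8%:R = 2%:R * Num.sqrt 2%:R :> R.
  rewrite -[8%N]/(2 ^ 2 * 2)%N natrM sqrtrM ?ler0n// natrX sqrtr_sqr.
  by rewrite ger0_norm.
have K : 0 < 2%:R * Num.sqrt 2%:R :> R by rewrite mulr_gt0.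
rewrite /angle divr_gt0//= ?acos_gt0 ?ltr_pM2r ?invr_gt0 ?acos_ltpi//; apply/andP; split; lra.
Qed.

Lemma angle_inj (x y : R) : 0 < x < 1 -> 0 < y < 1 -> angle x = angle y -> x = y.
Proof.
move=> /andP[x0 x1] /andP[y0 y1] /(congr1 (fun t => t * (2%:R * Num.sqrt 2%:R))).
have K : 2%:R * Num.sqrt 2%:R != 0 :> R by rewrite mulf_neq0// gt_eqF// sqrtr_gt0.
rewrite /angle !divfK// => /(congr1 (@cos R)); rewrite !acosK ?in_itv/=.
- by lra.
- by apply/andP; split; lra.
- by apply/andP; split; lra.
Qed.

End DistanceToPerp.

(** * Openness in the level set *)

Section RealBilinear.
Context {R : realType} (n : nat).
Local Notation C := R[i].

Lemma gmetDl (X Y Z : 'M[C]_n) : gmet (X + Y) Z = gmet X Z + gmet Y Z.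
Proof. by have := gmet_lin 1 1 X Y Z; rewrite !scale1r !mul1r. Qed.

Lemma gmetZl (a : R) (X Z : 'M[C]_n) : gmet (a%:C *: X) Z = a * gmet X Z.
Proof. by have := gmet_lin a 0 X 0 Z; rewrite scale0r addr0 mul0r addr0. Qed.

Lemma gmetBl (X Y Z : 'M[C]_n) : gmet (X - Y) Z = gmet X Z - gmet Y Z.
Proof.
have := gmet_lin 1 (- 1) X Y Z; rewrite scale1r mul1r mulN1r => <-.
by rewrite rmorphN scaleN1r.
Qed.

Lemma gmet_eq0 (X : 'M[C]_n) : gmet X X = 0 -> X = 0.
Proof.
move=> X0; apply/matrixP => i j; rewrite mxE; have := gmet_entry X i j.
rewrite X0 mulr0; case: (X i j) => a b /= H.
have a0 : a ^+ 2 = 0 by apply/eqP; rewrite eq_le sqr_ge0 andbT (le_trans _ H)// lerDl sqr_ge0.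
have b0 : b ^+ 2 = 0 by apply/eqP; rewrite eq_le sqr_ge0 andbT (le_trans _ H)// lerDr sqr_ge0.
by apply: complex_eq => /=; apply/eqP; rewrite -sqrf_eq0; apply/eqP.
Qed.

End RealBilinear.

Section EntrywiseNorm.
Context {C : numClosedFieldType}.

(** Being submultiplicative for all shapes, this norm also bounds products with the row [w] and its
    adjoint. Its values stay in [C], where moduli already live. *)
Definition l1norm p q (A : 'M[C]_(p, q)) : C := \sum_i \sum_j `|A i j|.

Lemma l1norm_ge0 p q (A : 'M[C]_(p, q)) : 0 <= l1norm A.
Proof. by rewrite sumr_ge0// => i _; rewrite sumr_ge0. Qed.

Lemma l1norm_eq0 p q (A : 'M[C]_(p, q)) : l1norm A = 0 -> A = 0.
Proof.
move=> /eqP; rewrite psumr_eq0; last by move=> i _; rewrite sumr_ge0.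
move=> /allP H; apply/matrixP => i j; rewrite mxE; apply/eqP.
have /eqP/eqP := H i (mem_index_enum _); rewrite psumr_eq0//.
by move=> /allP /(_ j (mem_index_enum _)); rewrite /= normr_eq0.
Qed.

Lemma l1normD p q (A B : 'M[C]_(p, q)) : l1norm (A + B) <= l1norm A + l1norm B.
Proof.
rewrite /l1norm -big_split ler_sum// => i _; rewrite -big_split ler_sum// => j _.
by rewrite mxE ler_normD.
Qed.

Lemma l1normZ p q c (A : 'M[C]_(p, q)) : l1norm (c *: A) = `|c| * l1norm A.
Proof.
rewrite /l1norm mulr_sumr; apply: eq_bigr => i _; rewrite mulr_sumr.
by apply: eq_bigr => j _; rewrite mxE normrM.
Qed.

Lemma l1normB p q (A B : 'M[C]_(p, q)) : l1norm (A - B) <= l1norm A + l1norm B.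
Proof.
apply: le_trans (l1normD _ _) _; rewrite lerD2l -scaleN1r l1normZ normrN1 mul1r.
exact: lexx.
Qed.

Lemma l1normM p q r (A : 'M[C]_(p, q)) (B : 'M[C]_(q, r)) : l1norm (A *m B) <= l1norm A * l1norm B.
Proof.
rewrite /l1norm mulr_suml ler_sum// => i _; rewrite mulr_suml.
apply: (@le_trans _ _ (\sum_j \sum_k `|A i k| * `|B k j|)).
  rewrite ler_sum// => j _; rewrite mxE; apply: le_trans (ler_norm_sum _ _ _) _.
  by rewrite ler_sum// => k _; rewrite normrM.
rewrite exchange_big ler_sum// => k _; rewrite -mulr_sumr ler_wpM2l//.
rewrite (bigD1 k)//= lerDl sumr_ge0// => l _; exact: sumr_ge0.
Qed.

Lemma l1norm_le p q (A : 'M[C]_(p, q)) (c : C) : (forall i j, `|A i j| <= c) ->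
  l1norm A <= (p * q)%:R * c.
Proof.
move=> H; apply: (@le_trans _ _ (\sum_(i < p) \sum_(j < q) c)).
  by rewrite ler_sum// => i _; rewrite ler_sum.
by rewrite !sumr_const !card_ord -mulrnA mulr_natl mulnC.
Qed.

Lemma l1norm_scalar (c : C) : l1norm (c%:M : 'M[C]_1) = `|c|.
Proof. by rewrite /l1norm !big_ord1 mxE mulr1n. Qed.

(* The squared norms of the rows of [A] are the diagonal entries of the
   projection [A *m A]. *)
Lemma l1norm_partial_isometry n (A : 'M[C]_n) : A ^t* = A ->
  (A *m A) *m (A *m A) = A *m A -> l1norm A <= (n * n)%:R.
Proof.
move=> AH AA.
have diag (K : 'M[C]_n) i : K ^t* = K -> (K *m K) i i = \sum_j `|K i j| ^+ 2.
  move=> KH; rewrite mxE; apply: eq_bigr => j _.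
  by rewrite -{2}KH hcE -normCK.
have le1 (K : 'M[C]_n) i j : K ^t* = K -> `|K i j| ^+ 2 <= (K *m K) i i.
  move=> KH; rewrite diag// (bigD1 j)//= lerDl sumr_ge0// => k _; exact: exprn_ge0.
have AAH : (A *m A) ^t* = A *m A by rewrite hcM AH.
have d0 i : 0 <= (A *m A) i i by rewrite diag// sumr_ge0// => j _; rewrite exprn_ge0.
have d1 i : (A *m A) i i <= 1.
  have := le1 _ i i AAH; rewrite AA ger0_norm// => H.
  have [->|n0] := eqVneq ((A *m A) i i) 0; first exact: ler01.
  have p0 : 0 < (A *m A) i i by rewrite lt_neqAle eq_sym n0 d0.
  by rewrite -(ler_pM2l p0) mulr1 -expr2.
rewrite -[leRHS]mulr1; apply: l1norm_le => i j.
rewrite -(@ler_pXn2r _ 2)// ?nnegrE// expr1n.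
exact: le_trans (le1 _ i j AH) (d1 i).
Qed.

(* The diagonal blocks of [D] are quadratic in [D]; the off-diagonal ones are
   [c *: L], where [c] is determined by the diagonal ones through [w]. *)
Lemma perturbation_rigid n (P L D : 'M[C]_n) (w : 'rV[C]_n) (k c B : C) :
  P *m P = P -> D = P *m D + D *m P + D *m D ->
  P *m D *m (1%:M - P) + (1%:M - P) *m D *m P = c *: L ->
  w *m D *m w ^t* = 0 -> w *m L *m w ^t* = k%:M -> k != 0 ->
  l1norm P <= B -> l1norm (1%:M - P) <= B -> l1norm L <= B ->
  l1norm D * ((l1norm w * l1norm (w ^t*) * B / `|k| + 1) * (B * B + B * B)) < 1 ->
  D = 0.
Proof.
move=> PP DE TE wD wL k0 PB QB LB small.
have B0 : 0 <= B := le_trans (l1norm_ge0 P) PB.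
set Q := 1%:M - P in TE QB.
have PQ1 : P + Q = 1%:M by rewrite /Q addrC subrK.
have QP : Q *m P = 0 by rewrite /Q mulmxBl mul1mx PP subrr.
have PQ : P *m Q = 0 by rewrite /Q mulmxBr mulmx1 PP subrr.
clearbody Q.
(* Compressing [DE] by P counts the linear term twice, and compressing it by Q kills that term;
   either way the diagonal block is quadratic in D. *)
have e1 : P *m D *m P = - (P *m (D *m D) *m P).
  apply/eqP; rewrite -addr_eq0; apply/eqP; apply: (addrI (P *m D *m P)).
  rewrite addr0 [in RHS]DE !mulmxDr !mulmxDl !mulmxA PP -[in RHS]addrA.
  by rewrite -!mulmxA PP.
have e2 : Q *m D *m Q = Q *m (D *m D) *m Q.
  rewrite {1}DE !mulmxDr !mulmxDl !mulmxA QP !mul0mx add0r.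
  by rewrite -(mulmxA _ P) PQ mulmx0 add0r.
pose N := Q *m (D *m D) *m Q - P *m (D *m D) *m P.
have DN : D = c *: L + N.
  have XE : D = P *m D *m P + P *m D *m Q + (Q *m D *m P + Q *m D *m Q).
    by rewrite -!mulmxDr PQ1 !mulmx1 -mulmxDl PQ1 mul1mx.
  rewrite /N -e2 -e1 -TE [LHS]XE.
  move: (P *m D *m P) (P *m D *m Q) (Q *m D *m P) (Q *m D *m Q) => a b d e.
  by rewrite [a + b]addrC -addrA [a + _]addrCA [a + e]addrC !addrA.
have nPDP (A X : 'M[C]_n) : l1norm A <= B -> l1norm (A *m X *m A) <= B * B * l1norm X.
  move=> AB; apply: le_trans (l1normM _ _) _.
  rewrite -mulrA mulrC; apply: ler_pM; rewrite ?l1norm_ge0//.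
  apply: le_trans (l1normM _ _) _; apply: ler_pM; rewrite ?l1norm_ge0//.
have nN : l1norm N <= (B * B + B * B) * (l1norm D * l1norm D).
  apply: le_trans (l1normB _ _) _; rewrite mulrDl.
  by apply: lerD; apply: le_trans (nPDP _ _ _) _ => //;
     rewrite ler_wpM2l ?mulr_ge0// l1normM.
(* As w D w^* = 0, the number c k equals - w N w^*, so c is of second order too. *)
have ck : `|c| * `|k| <= l1norm w * l1norm (w ^t*) * l1norm N.
  have : c *: k%:M = - (w *m N *m w ^t*).
    apply/eqP; rewrite -addr_eq0 -wL scalemxAl scalemxAr -mulmxDl -mulmxDr -DN.
    exact/eqP.
  move=> /(congr1 (@l1norm 1 1)); rewrite l1normZ l1norm_scalar => ->.
  rewrite -scaleN1r l1normZ normrN1 mul1r.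
  apply: le_trans (l1normM _ _) _; rewrite mulrAC ler_wpM2r ?l1norm_ge0//.
  exact: l1normM.
have k0' : 0 < `|k| by rewrite normr_gt0.
have main : l1norm D <= (l1norm w * l1norm (w ^t*) * B / `|k| + 1) * l1norm N.
  rewrite {1}DN; apply: le_trans (l1normD _ _) _; rewrite mulrDl mul1r lerD2r l1normZ.
  apply: (@le_trans _ _ (`|c| * B)); first by rewrite ler_wpM2l.
  have -> : l1norm w * l1norm (w ^t*) * B / `|k| * l1norm N = l1norm w * l1norm (w ^t*) * l1norm N / `|k| * B.
    by move: (l1norm w) (l1norm _) (l1norm N) (`|k|^-1) => x y z t; ring.
  by rewrite ler_wpM2r// ler_pdivlMr.
set K := l1norm w * _ * B / _ + 1 in main small.
have K0 : 0 <= K by rewrite addr_ge0// divr_ge0// !mulr_ge0// l1norm_ge0.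
apply: l1norm_eq0; apply/eqP; apply: contraT => D0.
have Dp : 0 < l1norm D by rewrite lt_neqAle eq_sym D0 l1norm_ge0.
suff : l1norm D < l1norm D by rewrite ltxx.
apply: (@le_lt_trans _ _ (l1norm D * (l1norm D * (K * (B * B + B * B))))).
  apply: le_trans main _; apply: le_trans (ler_wpM2l K0 nN) _.
  have E (x y b : C) : x * (x * (y * (b * b + b * b))) = y * ((b * b + b * b) * (x * x)).
    by ring.
  rewrite E.
  exact: lexx.
by rewrite gtr_pMr.
Qed.

End EntrywiseNorm.

Lemma idem_difference (C : numClosedFieldType) n (P Q : 'M[C]_n) :
  P *m P = P -> Q *m Q = Q ->
  Q - P = P *m (Q - P) + (Q - P) *m P + (Q - P) *m (Q - P).
Proof.
move=> PP QQ; rewrite !mulmxBr !mulmxBl QQ PP.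
move: (Q *m P) (P *m Q) => y t; apply/matrixP => i j; rewrite !mxE.
by move: (Q i j) (P i j) (y i j) (t i j) => a b c d; ring.
Qed.

Section NormalComponent.
Context {R : realType} (m : nat).
Local Notation C := R[i].
Local Notation n := m.+2.
Local Notation V := 'rV[R]_(4 * m).-1.
Context (U : set V) (P L : V -> 'M[C]_n) (hd : hypersurface_data U P L).
Context (m0 : (0 < m)%N).

Lemma hd_gr2 z : U z -> gr2 (P z) /\ gr2_tangent (P z) (L z).
Proof.
move=> Uz; have [e [e' [f F]]] := hd_frame hd Uz.
by have [PH LH] := frame_herm F; have [PP Pr LT _] := frame_proj F.
Qed.

(** The tangential part of D is orthogonal to the hypersurface, whose tangent space is the full
    orthogonal complement of L by [tangent_image]. *)
Lemma normal_component z (D : 'M[C]_n) : U z -> D ^t* = D ->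
  (forall u, gmet D (dmx P z u) = 0) ->
  exists c : R, tanproj (P z) D = c%:C *: L z.
Proof.
move=> Uz DH Dperp; have [gP tL] := hd_gr2 Uz; have [LH LT] := tL.
have [e [e' [f F]]] := hd_frame hd Uz; have [_ _ _ LL] := frame_proj F.
have [_ _ _ ldP] := hd_P hd Uz.
have tT u : gr2_tangent (P z) (dmx P z u) by split; [exact: (herm_dP hd u Uz)|exact: (tan_dP hd u Uz)].
have [tD Dt] := tanprojP gP DH; have [TH TT] := tD.
set T := tanproj (P z) D in tD Dt TH TT *.
have gL X : gr2_tangent (P z) X -> gmet (L z) X = complex.Re (\tr (L z *m X)) / 4%:R.
  by move=> [XH _]; rewrite /gmet XH.
have LLr : complex.Re (\tr (L z *m L z)) = 2%:R by rewrite LL -(rmorph_nat (real_complex R)).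
have gLL : gmet (L z) (L z) = 2%:R^-1.
  by rewrite gL// LLr -[4%N]/(2 * 2)%N natrM invfM mulVKf ?pnatr_eq0.
(* L has squared length 1/2, so this is the coefficient of the orthogonal projection onto its
   line. *)
pose c := gmet T (L z) * 2%:R.
exists c; apply/eqP; rewrite -subr_eq0; apply/eqP; apply: gmet_eq0.
set X := T - c%:C *: L z.
have tX : gr2_tangent (P z) X.
  split; first by rewrite /X hcB hcZ conj_real TH LH.
  rewrite /X mulmxBl mulmxBr -scalemxAl -scalemxAr addrACA -opprD -scalerDr.
  by rewrite TT LT.
have LX : complex.Re (\tr (L z *m X)) = 0.
  have := gL X tX; rewrite gmetC /X gmetBl gmetZl gLL /c mulfK ?pnatr_eq0// subrr.
  by move=> /esym/eqP; rewrite mulf_eq0 invr_eq0 pnatr_eq0 orbF => /eqP.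
have nL : complex.Re (\tr (L z *m L z)) != 0 by rewrite LLr pnatr_eq0.
have [u uX] := tangent_image m0 gP tL nL (ldP) tT (fun u => hd_normal hd u Uz)
  (fun u => @hd_immersion _ _ _ _ _ hd z u Uz) tX LX.
rewrite -[X in gmet _ X]uX /X gmetBl gmetZl gL// (hd_normal hd u Uz) mul0r mulr0 subr0.
have := Dt _ (tT u); rewrite gmetBl Dperp sub0r => /eqP.
by rewrite oppr_eq0 => /eqP.
Qed.

Context (w : 'rV[C]_n) (ww : dot w w = 1) (k : C) (k0 : k != 0) (s : R).
Context (wL : forall z, U z -> w *m L z *m w ^t* = k%:M).
Context (hs : forall z, U z -> height w (P z) = s).

(** The radius does not depend on z: the nearest point is found only after the radius has been
    fixed. Uniformity holds because P, 1 - P and L have entrywise norm at most n^2 by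
    [l1norm_partial_isometry]. *)
Lemma close_rigid : exists2 eps : R, 0 < eps & forall z Q, U z -> gr2 Q ->
  height w Q = s -> (forall u, gmet (Q - P z) (dmx P z u) = 0) ->
  gmet (Q - P z) (Q - P z) < eps -> Q = P z.
Proof.
pose B : C := (n * n)%:R.
pose Kc : C := (l1norm w * l1norm (w ^t*) * B / `|k| + 1) * (B * B + B * B).
have Kc0 : 0 <= Kc.
  by rewrite mulr_ge0// ?addr_ge0// ?divr_ge0// ?mulr_ge0// l1norm_ge0.
pose K := complex.Re Kc.
have KcE : Kc = K%:C by apply: complex_eq => //=; rewrite ger0_Im.
have K0 : 0 <= K by move: Kc0; rewrite KcE ler0c.
(* D has n^2 entries, each at most twice its Riemannian length (see [nD]); K + 1 in place of K makes
   the final inequality strict and the inverse meaningful. *)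
pose a : R := ((n * n)%:R * 2%:R * (K + 1))^-1.
have a0 : 0 < a by rewrite invr_gt0 !mulr_gt0// ?ltr0n// ltr_wpDl.
exists (a ^+ 2); first exact: exprn_gt0.
move=> z Q Uz gQ hQ Dperp small.
have [gP tL] := hd_gr2 Uz; have [PH PP _] := gP; have [QH QQ _] := gQ; have [LH LT] := tL.
have [e [e' [f F]]] := hd_frame hd Uz.
set D := Q - P z in Dperp small.
have DH : D ^t* = D by rewrite /D hcB QH PH.
have [c cE] := normal_component Uz DH Dperp.
have LLL : (L z *m L z) *m (L z *m L z) = L z *m L z.
  have LQ := frame_LQ' F; rewrite mulmxBr mulmx1 in LQ.
  have /eqP := LQ; rewrite subr_eq0 => /eqP E.
  by rewrite -mulmxA -E.
have PPP : (P z *m P z) *m (P z *m P z) = P z *m P z by rewrite PP PP.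
have H1 : (1%:M - P z) ^t* = 1%:M - P z by rewrite hcB hc1 PH.
have H2 : (1%:M - P z) *m (1%:M - P z) = 1%:M - P z.
  by rewrite mulmxBl mul1mx mulmxBr mulmx1 PP subrr subr0.
have H3 : ((1%:M - P z) *m (1%:M - P z)) *m ((1%:M - P z) *m (1%:M - P z)) =
    (1%:M - P z) *m (1%:M - P z) by rewrite H2 H2.
have DE : D = P z *m D + D *m P z + D *m D.
  exact: idem_difference.
have wD : w *m D *m w ^t* = 0.
  rewrite [LHS]mx11_scalar -dotE /D mulmxBr -scaleN1r dotDl dotZl.
  rewrite (height_real QH QQ ww) (height_real PH PP ww) hQ hs// mulN1r subrr.
  by rewrite raddf0.
have nD : l1norm D <= (n * n)%:R * (2%:R * Num.sqrt (gmet D D))%:C.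
  apply: l1norm_le => i j.
  have s0 : 0 <= 2%:R * Num.sqrt (gmet D D) by rewrite mulr_ge0// sqrtr_ge0.
  rewrite -(@ler_pXn2r _ 2)// ?nnegrE ?ler0c//.
  have := gmet_entry D i j.
  have -> : `|D i j| ^+ 2 = (complex.Re (D i j) ^+ 2 + complex.Im (D i j) ^+ 2)%:C.
    rewrite normCK; apply: complex_eq; rewrite ?cReM ?cImM ?cReJ ?cImJ /=; ring.
  rewrite -rmorphXn lecR exprMn sqr_sqrtr ?gmet_ge0//.
  by rewrite -natrX.
have fin : l1norm D * Kc < 1.
  apply: (@le_lt_trans _ _ ((n * n)%:R * (2%:R * Num.sqrt (gmet D D))%:C * Kc)).
    by rewrite ler_wpM2r.
  rewrite KcE -(rmorph_nat (real_complex R)) -!rmorphM -(rmorph1 (real_complex R)) ltcR.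
  have sq : Num.sqrt (gmet D D) < a.
    by rewrite -(@ltr_pXn2r _ 2)// ?nnegrE ?sqrtr_ge0// ?ltW// sqr_sqrtr ?gmet_ge0.
  have nn : 0 < (n * n)%:R * 2%:R * (K + 1) :> R by rewrite -invr_gt0.
  have : (n * n)%:R * 2%:R * (K + 1) * Num.sqrt (gmet D D) < 1.
    by rewrite -(@ltr_pdivlMl _ _ _ _ nn) mulr1.
  apply: le_lt_trans.
  have sg := sqrtr_ge0 (gmet D D).
  rewrite -subr_ge0.
  have -> : (n * n)%:R * 2 * (K + 1) * Num.sqrt (gmet D D) -
     (n * n)%:R * (2 * Num.sqrt (gmet D D)) * K = (n * n)%:R * 2%:R * Num.sqrt (gmet D D) by ring.
  by rewrite !mulr_ge0.
apply/eqP; rewrite -subr_eq0; apply/eqP; rewrite -/D.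
apply: (perturbation_rigid PP DE cE wD (wL Uz) k0 (B := B)) => //.
- exact: (l1norm_partial_isometry PH PPP).
- exact: (l1norm_partial_isometry H1 H3).
- exact: (l1norm_partial_isometry LH LLL).
Qed.

End NormalComponent.

Section Calculus.
Context {R : realType} {V : normedModType R} (n : nat).
Local Notation C := R[i].

Lemma mxd_gmet (F G : V -> 'M[C]_n) z v F' G' : mxd F z v F' -> mxd G z v G' ->
  is_derive z v (fun z => gmet (F z) (G z)) (gmet F' (G z) + gmet (F z) G').
Proof.
move=> dF dG; have D := mxd_tr (mxdM dF (mxd_hc dG)).
have -> : (fun z => gmet (F z) (G z)) =
    4%:R^-1 \*: (fun z => complex.Re (\tr (F z *m (G z) ^t*))).
  by apply/funext => t; rewrite /gmet mulrC.
have -> : gmet F' (G z) + gmet (F z) G' =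
    4%:R^-1 *: complex.Re (\tr (F' *m (G z) ^t* + F z *m G' ^t*)).
  by rewrite mxtraceD cReD /GRing.scale /= mulrDr /gmet ![_ / _]mulrC.
exact: is_deriveZ.
Qed.

Lemma differentiable_bigsum (I : Type) (r : seq I) (F : I -> V -> R) z :
  (forall i, differentiable (F i) z) -> differentiable (fun z => \sum_(i <- r) F i z) z.
Proof.
move=> dF; elim: r => [|i r IH].
  by under eq_fun do rewrite big_nil; exact: differentiable_cst.
under eq_fun do rewrite big_cons.
exact: differentiableD.
Qed.

Definition mx_differentiable (F : V -> 'M[C]_n) z := forall i j,
  differentiable (fun z => complex.Re (F z i j)) z /\
  differentiable (fun z => complex.Im (F z i j)) z.

Lemma differentiable_gmet (F : V -> 'M[C]_n) Y z : mx_differentiable F z ->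
  differentiable (fun z => gmet (F z) Y) z.
Proof.
move=> dF; have -> : (fun z => gmet (F z) Y) = (fun z => \sum_i \sum_j
    (complex.Re (F z i j) * (complex.Re (Y i j) / 4%:R) +
     complex.Im (F z i j) * (complex.Im (Y i j) / 4%:R))).
  apply/funext => t; rewrite gmet_sum mulr_suml; apply: eq_bigr => i _.
  by rewrite mulr_suml; apply: eq_bigr => j _; rewrite mulrDl !mulrA.
apply: differentiable_bigsum => i; apply: differentiable_bigsum => j.
have [dr di] := dF i j.
by apply: differentiableD; apply: differentiableM => //; exact: differentiable_cst.
Qed.

Lemma continuous_gmet_sqr (F : V -> 'M[C]_n) Q z : mx_differentiable F z ->
  {for z, continuous (fun z => gmet (F z - Q) (F z - Q))}.
Proof.
move=> dF.
have E t : gmet (F t - Q) (F t - Q) = \sum_i \sum_j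
    ((complex.Re (F t i j) - complex.Re (Q i j)) * (complex.Re (F t i j) - complex.Re (Q i j)) / 4%:R +
     (complex.Im (F t i j) - complex.Im (Q i j)) * (complex.Im (F t i j) - complex.Im (Q i j)) / 4%:R).
  rewrite gmet_sum mulr_suml; apply: eq_bigr => i _.
  rewrite mulr_suml; apply: eq_bigr => j _.
  by rewrite mulrDl 2!mxE cReD cImD cReN cImN.
have -> : (fun z => gmet (F z - Q) (F z - Q)) = (fun t => \sum_i \sum_j
    ((complex.Re (F t i j) - complex.Re (Q i j)) * (complex.Re (F t i j) - complex.Re (Q i j)) / 4%:R +
     (complex.Im (F t i j) - complex.Im (Q i j)) * (complex.Im (F t i j) - complex.Im (Q i j)) / 4%:R)).
  by apply/funext => t; exact: E.
apply: differentiable_continuous.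
apply: differentiable_bigsum => i; apply: differentiable_bigsum => j.
have [dr di] := dF i j.
have dr' : differentiable (fun z => complex.Re (F z i j) - complex.Re (Q i j)) z.
  by apply: differentiableB => //; exact: differentiable_cst.
have di' : differentiable (fun z => complex.Im (F z i j) - complex.Im (Q i j)) z.
  by apply: differentiableB => //; exact: differentiable_cst.
by apply: differentiableD; apply: differentiableM; (exact: differentiable_cst || exact: differentiableM).
Qed.

Lemma differentiable_half (g : V -> R) z : differentiable g z ->
  \forall v \near (0 : V), `|g (z + v) - g z - 'D_v g z| <= 2%:R^-1 * `|v|.
Proof.
move=> dg; have h0 : 0 < 2%:R^-1 :> R by rewrite invr_gt0.
have [r r0 H] := differentiable_near dg h0.
apply/nbhs_normP; exists r => // v; rewrite /= sub0r normrN; exact: H.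
Qed.

Lemma critical_min (phi : V -> R) (U : set V) x : open U -> U x ->
  (forall z v, U z -> derivable phi z v) -> (forall z, U z -> phi x <= phi z) ->
  forall v d, is_derive x v phi d -> d = 0.
Proof.
move=> oU Ux dphi min v d dv.
have /nbhs_normP[e /= e0 He] := line_near oU v Ux.
have sub (t : R) : t \in `](- e), e[%R -> U (x + t *: v).
  rewrite in_itv/= => te; apply: (He t).
  by rewrite /= sub0r normrN ltr_norml.
have D (t : R) : t \in `](- e), e[%R -> derivable (fun t : R => phi (x + t *: v)) t 1.
  move=> /sub Ut; by have [] := is_derive_line (dphi _ v Ut).
have z0 : (0 : R) \in `](- e), e[%R by rewrite in_itv/= oppr_lt0 e0.
have := @derive1_at_min R (fun t : R => phi (x + t *: v)) (- e) e 0 _ D z0 _.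
have le : - e <= e by rewrite (@le_trans _ _ 0) ?oppr_le0 ?ltW.
move=> /(_ le) H.
have [|_ E] := H.
  by move=> t /sub Ut; rewrite scale0r addr0; exact: min.
by have [_ <-] := is_derive_onto_line dv; rewrite E.
Qed.

End Calculus.

Lemma smooth_differentiable (R : realType) (V : normedModType R) n (U : set V)
    (F : V -> 'M[R[i]]_n) z : mx_smooth_on U F -> U z -> mx_differentiable F z.
Proof.
move=> sF Uz i j; have [[dr _] [di _]] := sF 1%N i j.
by split; [exact: dr|exact: di].
Qed.

Lemma gmet0r (R : realType) n (X : 'M[R[i]]_n) : gmet X 0 = 0.
Proof. by rewrite /gmet hc0 mulmx0 mxtrace0 /= mul0r. Qed.

Lemma gmetNN (R : realType) n (X : 'M[R[i]]_n) : gmet (- X) (- X) = gmet X X.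
Proof. by rewrite /gmet hcN mulNmx mulmxN opprK. Qed.

Lemma gmet_le_sqrt (R : realType) n (X Y : 'M[R[i]]_n) (a b : R) :
  gmet X X <= a -> gmet Y Y <= b -> `|gmet X Y| <= Num.sqrt (a * b).
Proof.
move=> Xa Yb; rewrite -sqrtr_sqr ler_wsqrtr//.
apply: le_trans (gmet_cauchy_schwarz X Y) _.
by apply: ler_pM => //; exact: gmet_ge0.
Qed.

Lemma norm_three (R : realType) (x y z u t b : R) : `|x - y - u| <= t ->
  `|x - z| <= b -> `|y - z| <= b -> `|u| <= 2%:R * b + t.
Proof.
rewrite !ler_norml => /andP[t1 t2] /andP[a1 a2] /andP[b1 b2].
by apply/andP; split; lra.
Qed.

Lemma half_absorb (R : realType) (a b : R) :
  a <= 2%:R * b + 2%:R^-1 * a -> a <= 4%:R * b.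
Proof. lra. Qed.

Lemma half_square (R : realType) (a : R) : 0 < a -> 4%:R ^+ 2 * (a / 32%:R) < a.
Proof. by move=> a0; lra. Qed.

Lemma row_norm_le (R : realType) d (v : 'rV[R]_d) (a : R) : 0 <= a ->
  (forall i, `|v 0 i| <= a) -> `|v| <= a.
Proof.
move=> a0 H; have [E|/mx_norm_neq0[[i j] E]] := eqVneq (mx_norm v) 0.
  by rewrite [`|v|]E.
by rewrite [`|v|]E /= ord1.
Qed.

(** The Gram matrix of an injective real-linear map is invertible, and its inverse yields the dual
    vectors. *)
Lemma dual_frame (R : realType) (d n : nat) (T : 'rV[R]_d -> 'M[R[i]]_n) :
  (forall (a : R) u v, T (a *: u + v) = a%:C *: T u + T v) ->
  (forall u, T u = 0 -> u = 0) ->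
  exists Y : 'I_d -> 'M[R[i]]_n, forall v k, gmet (T v) (Y k) = v 0 k.
Proof.
move=> lT iT.
have T0 : T 0 = 0.
  by have := lT 1 0 0; rewrite scaler0 addr0 scale1r -[LHS]addr0 => /addrI.
pose E (i : 'I_d) : 'rV[R]_d := delta_mx 0 i.
have gs (X : 'M[R[i]]_n) (I : finType) (c : I -> R) (Z : I -> 'M[R[i]]_n) :
    gmet X (\sum_i (c i)%:C *: Z i) = \sum_i c i * gmet X (Z i).
  elim/big_rec2: _ => [|i y Y _ IH].
    exact: gmet0r.
  by rewrite gmetC gmetDl gmetZl gmetC [gmet Y X]gmetC IH.
have TE v : T v = \sum_i (v 0 i)%:C *: T (E i).
  have S (I : finType) (c : I -> R) (u : I -> 'rV[R]_d) :
      T (\sum_i c i *: u i) = \sum_i (c i)%:C *: T (u i).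
    by elim/big_rec2: _ => // i y Y _ IH; rewrite lT IH.
  rewrite -S; congr T; exact: row_sum_delta.
pose A := \matrix_(i, j) gmet (T (E i)) (T (E j)).
have vA v j : (v *m A) 0 j = gmet (T v) (T (E j)).
  rewrite mxE TE gmetC gs; apply: eq_bigr => i _.
  by rewrite mxE gmetC.
have uA : A \in unitmx.
  rewrite -row_free_unit -kermx_eq0; apply/eqP/row_matrixP => i; rewrite row0.
  set v := row i _; have vA0 : v *m A = 0 by rewrite /v -row_mul mulmx_ker row0.
  apply: iT; apply: gmet_eq0; rewrite [X in gmet _ X]TE gs big1// => j _.
  have -> : gmet (T v) (T (E j)) = 0 by rewrite -vA vA0 mxE.
  exact: mulr0.
exists (fun k => \sum_j (invmx A j k)%:C *: T (E j)) => v k.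
rewrite gs -[in RHS](mulmxK uA v) mxE; apply: eq_bigr => j _.
by rewrite vA mulrC.
Qed.

Section LocalSurjectivity.
Context {R : realType} (m : nat).
Local Notation C := R[i].
Local Notation n := m.+2.
Local Notation V := 'rV[R]_(4 * m).-1.
Context (U : set V) (P L : V -> 'M[C]_n) (hd : hypersurface_data U P L).
Context (m0 : (0 < m)%N) (dP : forall z, U z -> mx_differentiable P z).
Context (w : 'rV[C]_n) (ww : dot w w = 1) (k : C) (k0 : k != 0) (s : R).
Context (wL : forall z, U z -> w *m L z *m w ^t* = k%:M).
Context (hs : forall z, U z -> height w (P z) = s).

(** The distance to Q attains its minimum on a closed ball of the chart. If Q is close enough the
    minimizer is interior, hence critical: Q - P is then orthogonal to the hypersurface, and
    [close_rigid] gives Q = P. *)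
Lemma locally_onto x0 : U x0 -> exists2 eps : R, 0 < eps &
  forall Q, gr2 Q -> height w Q = s -> gmet (Q - P x0) (Q - P x0) < eps ->
  exists2 x, U x & P x = Q.
Proof.
move=> Ux; have oU := hd_open hd.
have [e1 e10 close] := close_rigid hd m0 ww k0 wL hs.
have [_ _ _ lT] := hd_P hd Ux.
have [Y HY] := dual_frame lT (fun u => @hd_immersion _ _ _ _ _ hd x0 u Ux).
pose B : R := 1 + \sum_i gmet (Y i) (Y i).
have B0 : 0 < B by rewrite ltr_wpDr// sumr_ge0// => i _; exact: gmet_ge0.
have BY i : gmet (Y i) (Y i) <= B.
  rewrite /B (bigD1 i)//= addrCA lerDl addr_ge0// sumr_ge0// => j _; exact: gmet_ge0.
(* The functionals dual to the derivative keep the minimizer inside the ball. *)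
have near1 : \forall v \near (0 : V), forall i,
    `|gmet (P (x0 + v)) (Y i) - gmet (P x0) (Y i) - v 0 i| <= 2%:R^-1 * `|v|.
  apply: (@filter_forall V 'I_(4 * m).-1 (fun i v =>
    `|gmet (P (x0 + v)) (Y i) - gmet (P x0) (Y i) - v 0 i| <= 2%:R^-1 * `|v|) _ (nbhs_filter (0 : V))) => i.
  have := differentiable_half (differentiable_gmet (Y i) (dP Ux)).
  apply: (@filterS _ _ (nbhs_filter (0 : V))) => v.
  have [dPx _ _ _] := hd_P hd Ux.
  have [_ ->] := mxd_gmet (dPx v) (mxd_cst (Y i) x0 v).
  by rewrite HY gmet0r addr0.
have [r1 /= r10 Hr1] := open_subball oU Ux.
move: near1 => /nbhs_normP[r2 /= r20 Hr2].
pose r := Num.min (r1 / 4%:R) (r2 / 2%:R).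
have r0 : 0 < r by rewrite lt_min !divr_gt0.
have r1r : r <= r1 / 4%:R by rewrite ge_min lexx.
have r2r : r <= r2 / 2%:R by rewrite ge_min lexx orbT.
have ball_U z : `|x0 - z| <= r -> U z.
  move=> zr; apply: (Hr1 (r1 / 2%:R)) => /=.
  - by rewrite sub0r normrN gtr0_norm ?divr_gt0// ltr_pdivrMr// ltr_pMr// ltr1n.
  - by rewrite divr_gt0.
  - rewrite -ball_normE /=; apply: le_lt_trans zr _; apply: le_lt_trans r1r _.
    by rewrite ltr_pM2l// ltf_pV2 ?posrE ?ltr0n// ltr_nat.
(* The first bound is the radius of [close_rigid]. The second gives beta^2 <= r^2 / 32 below, so
   that 4 beta < r keeps the minimizer off the boundary. *)
pose eps := Num.min e1 (r ^+ 2 / (32%:R * B)).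
have eps0 : 0 < eps by rewrite lt_min e10 divr_gt0// ?exprn_gt0// mulr_gt0.
exists eps; first exact: eps0.
move=> Q gQ hQ Qs.
pose phi z := gmet (P z - Q) (P z - Q).
have phi0 : phi x0 < eps by rewrite /phi -opprB gmetNN.
pose A : set V := closed_ball_ (@Num.norm R V) x0 r.
have A0 : A !=set0 by exists x0; rewrite /A /closed_ball_ /= subrr normr0 ltW.
have cA : compact A.
  apply: bounded_closed_compact; last exact: closed_closed_ball_.
  exists (`|x0| + r); split; first exact: num_real.
  move=> M ltM z /= zr; apply: le_trans (ltW ltM).
  rewrite -[z](subKr x0); apply: le_trans (ler_normB _ _) _.
  by rewrite lerD2l.
have cphi : {within A, continuous phi}.
  apply: continuous_in_subspaceT => z; rewrite inE => zA.
  exact: (continuous_gmet_sqr (Q := Q) (dP (ball_U z zA))).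
have [xm] := EVT_min_rV A0 cA cphi; rewrite inE => xmA min.
have minA z : A z -> phi xm <= phi z by move=> Az; apply: min; rewrite inE.
have xmr : `|x0 - xm| <= r := xmA.
have Uxm := ball_U xm xmr.
have phim : phi xm <= eps.
  apply: le_trans (ltW phi0); apply: minA.
  by rewrite /A /closed_ball_ /= subrr normr0 ltW.
pose v : V := xm - x0.
have vr : `|v| <= r by rewrite /v distrC.
have vE : x0 + v = xm by rewrite /v addrCA subrr addr0.
pose beta := Num.sqrt (eps * B).
have beta0 : 0 <= beta := sqrtr_ge0 _.
(* The i-th coordinate of v is the derivative of P paired with [Y i]. The corresponding difference
   of values is at most 2 beta, as both values of P are near Q; the remainder |v| / 2 is absorbed
   afterwards. *)
have vi i : `|v 0 i| <= 2%:R * beta + 2%:R^-1 * `|v|.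
  have := Hr2 v; rewrite /= sub0r normrN => /(_ _ i); rewrite vE => T.
  have {}T := T _; have {}T : `|gmet (P xm) (Y i) - gmet (P x0) (Y i) - v 0 i| <= 2%:R^-1 * `|v|.
    by apply: T; apply: le_lt_trans vr _; apply: le_lt_trans r2r _; rewrite ltr_pdivrMr// ltr_pMr// ltr1n.
  have b1 : `|gmet (P xm - Q) (Y i)| <= beta := gmet_le_sqrt phim (BY i).
  have b2 : `|gmet (P x0 - Q) (Y i)| <= beta := gmet_le_sqrt (ltW phi0) (BY i).
  rewrite gmetBl in b1; rewrite gmetBl in b2.
  exact: (norm_three T b1 b2).
have vb : `|v| <= 2%:R * beta + 2%:R^-1 * `|v|.
  by apply: row_norm_le vi; rewrite addr_ge0// mulr_ge0// invr_ge0.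
have beta2 : beta ^+ 2 <= r ^+ 2 / 32%:R.
  rewrite (sqr_sqrtr (mulr_ge0 (ltW eps0) (ltW B0))) -ler_pdivlMr//.
  by rewrite -mulrA -invfM; rewrite ge_min lexx orbT.
have vlt : `|v| < r.
  have v4 : `|v| <= 4%:R * beta := half_absorb vb.
  apply: le_lt_trans v4 _.
  have r0' := ltW r0; rewrite -(@ltr_pXn2r _ 2)// ?nnegrE ?mulr_ge0// exprMn.
  apply: le_lt_trans (ler_wpM2l _ beta2) _; first exact: exprn_ge0.
  exact: half_square (exprn_gt0 2 r0).
pose U' : set V := ball x0 r.
have U'xm : U' xm by rewrite /U' -ball_normE /= -/v distrC.
have oU' : open U' by exact: ball_open.
have U'A z : U' z -> A z by rewrite /U' -ball_normE /= => /ltW.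
have dphi z u : U z -> is_derive z u phi (2%:R * gmet (P z - Q) (dmx P z u)).
  move=> Uz; have [dPz _ _ _] := hd_P hd Uz.
  have D := mxdB (dPz u) (mxd_cst Q z u); rewrite subr0 in D.
  have := mxd_gmet D D; rewrite [gmet (dmx P z u) _]gmetC.
  by rewrite -mulr2n mulr_natl.
have crit u : gmet (Q - P xm) (dmx P xm u) = 0.
  have dU z t : U' z -> derivable phi z t.
    by move=> U'z; have [] := dphi z t (ball_U z (U'A z U'z)).
  have mU z : U' z -> phi xm <= phi z by move=> U'z; apply: minA; exact: U'A.
  have /eqP := critical_min oU' U'xm dU mU (dphi xm u Uxm).
  rewrite mulf_eq0 pnatr_eq0 /= gmetBl subr_eq0 gmetBl => /eqP ->.
  exact: subrr.
exists xm => //; apply/esym; apply: close => //.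
by rewrite -opprB gmetNN (le_lt_trans (minA x0 _))// ?(lt_le_trans phi0)// ?ge_min ?lexx//
  /A /closed_ball_ /= subrr normr0 ltW.
Qed.

End LocalSurjectivity.

(** Divided by 1 + l^2, these are the height of the plane and the derivative of the height along the
    normal. *)
Lemma axis_traces (R : realType) n (P L : 'M[R[i]]_n) e e' f (l : R) :
  frame P L e e' f -> \tr (axis l%:C P L *m P) = (l ^+ 2)%:C /\
  \tr (axis l%:C P L *m L) = (- (2%:R * l))%:C.
Proof.
move=> F; rewrite (axisE (conj_real _) F) 2!dot_tr 2!mulmxBl -2!scalemxAl.
have [[-> _ ->] [-> _ ->]] := frame_act F.
have [[ee _ ff] [[_ ef _] _ fe _]] := frame_dot F.
have D (x y : R[i]) : dot (x *: e + y *: f) (f - l%:C *: e) = y - x * l%:C.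
  rewrite -scaleNr dotDl 2!dotDr !dotZl !dotZr ee ff ef fe rmorphN /= conj_real.
  by rewrite !mulr0 addr0 add0r !mulr1 addrC mulrN.
have -> : 0 - l%:C *: e = (- l%:C) *: e + 0 *: f.
  by rewrite scale0r addr0 sub0r scaleNr.
have -> : e - l%:C *: f = 1 *: e + (- l%:C) *: f by rewrite scale1r scaleNr.
rewrite 2!D; split; first by rewrite sub0r mulNr opprK -rmorphM -expr2.
by rewrite mul1r -rmorphN -rmorphD; congr (_%:C); ring.
Qed.

Lemma height_cauchy_schwarz (R : realType) n (w : 'rV[R[i]]_n) (D : 'M[R[i]]_n) :
  dot w w = 1 -> height w D ^+ 2 <= 4%:R * gmet D D.
Proof.
move=> ww; have WH : (w ^t* *m w) ^t* = w ^t* *m w by rewrite hcM hcK.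
have E1 : gmet D (w ^t* *m w) = height w D / 4%:R.
  by rewrite /gmet WH mxtrace_mulC dot_tr.
have E2 : gmet (w ^t* *m w) (w ^t* *m w) = 4%:R^-1.
  by rewrite /gmet WH dot_tr mulmxA row_dot ww scale1r ww /= mul1r.
have := gmet_cauchy_schwarz D (w ^t* *m w); rewrite E1 E2.
by move: (height w D) (gmet D D) => x y H; nra.
Qed.

Lemma gmet_small (R : realType) n (D : 'M[R[i]]_n) (e : R) :
  (forall i j, `|complex.Re (D i j)| < 2%:R * e /\ `|complex.Im (D i j)| < 2%:R * e) ->
  gmet D D <= 2%:R * (n * n)%:R * e ^+ 2.
Proof.
move=> H; rewrite gmet_sum ler_pdivrMr//.
have sq (x : R) : `|x| < 2%:R * e -> x * x <= 4%:R * e ^+ 2.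
  rewrite ltr_norml => /andP[h1 h2]; nra.
apply: (@le_trans _ _ (\sum_(i < n) \sum_(j < n) 8%:R * e ^+ 2)).
  rewrite ler_sum// => i _; rewrite ler_sum// => j _.
  have [/sq h1 /sq h2] := H i j; move: h1 h2.
  by move: (complex.Re _ * _) (complex.Im _ * _) => x y h1 h2; lra.
rewrite !sumr_const !card_ord -mulrnA -[_ *+ _]mulr_natl.
by rewrite le_eqVlt; apply/orP; left; apply/eqP; ring.
Qed.

Lemma small_radius (R : realType) (c eps : R) : 0 <= c -> 0 < eps ->
  exists2 e : R, 0 < e & c * e ^+ 2 < eps.
Proof.
move=> c0 eps0; exists (Num.min 1 (eps / (c + 1))).
  by rewrite lt_min ltr01 divr_gt0// ltr_wpDl.
set e := Num.min _ _; have e0 : 0 < e by rewrite lt_min ltr01 divr_gt0// ltr_wpDl.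
have e1 : e <= 1 by rewrite ge_min lexx.
have e2 : e <= eps / (c + 1) by rewrite ge_min lexx orbT.
have e3 : (c + 1) * e <= eps by rewrite mulrC -ler_pdivlMr// ltr_wpDl.
move: e0 e1 e3; move: (e) => x h1 h2 h3.
have xx : x ^+ 2 <= x by rewrite expr2 ler_piMr// ltW.
by nra.
Qed.

Lemma near_unit_interval (R : realType) (s x d : R) :
  d <= s -> d <= 1 - s -> `|x - s| < d -> 0 < x < 1.
Proof. by rewrite ltr_norml => h1 h2 /andP[h3 h4]; apply/andP; split; lra. Qed.

Theorem theorem1p6 (R : realType) (m : nat) (M : topologicalType)
    (atl : set (chart R (4 * m).-1 M)) (f N : M -> 'M[R[i]]_m.+2) :
  (3 <= m)%N ->
  real_hypersurface atl f ->
  connected [set: M] ->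
  unit_normal atl f N ->
  shape_preserves_D atl f N ->
  (forall p, Dperp f N p (reeb f N p)) ->
  exists (H : 'M[R[i]]_m.+2) (r : R),
    [/\ \rank H = m.+1, 0 < r < pi / Num.sqrt 8%:R &
        open_part (tube (sub_gr2 H) r) (range f)].
Proof.
move=> m3 hf conn hN hA hX.
have m1 : (1 < m)%N by exact: ltnW.
have m0 : (0 < m)%N by exact: ltnW.
(* M may be empty; its image is then an open part of any tube. *)
have [[p0 _]|noM] := pselect (exists p : M, True); last first.
  pose w : 'rV[R[i]]_m.+2 := delta_mx 0 0.
  have ww : dot w w = 1.
    rewrite dotE mxE (bigD1 0)//= big1 ?addr0.
      by rewrite hcE /w mxE !eqxx mul1r rmorph1.
    by move=> j j0; rewrite /w mxE (negbTE j0) andbF mul0r.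
  exists (perp w), (angle 2%:R^-1); split.
  - exact: rank_perp.
  - by apply: angle_itv; rewrite invr_gt0 ltr0n invf_lt1 ?ltr1n// ltr0n.
  - by split=> [Q [p _ _]|Q [p _ _]]; case: noM; exists p.
have [l [W [l0 HW]]] := axis_global hf hN hA hX p0 m1 conn.
have [e [e' [g F]]] := frame_at hf hN hX p0.
have q0 : 0 < 1 + l ^+ 2 by rewrite ltr_wpDr// sqr_ge0.
(* The vector f - l e has squared length 1 + l^2. *)
pose c : R := (Num.sqrt (1 + l ^+ 2))^-1.
have cc : c * c = (1 + l ^+ 2)^-1.
  by rewrite -expr2 exprVn sqr_sqrtr// ltW.
pose w : 'rV[R[i]]_m.+2 := c%:C *: (g - l%:C *: e).
have WE : w ^t* *m w = ((1 + l ^+ 2)^-1)%:C *: W.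
  rewrite -(HW p0) (axisE (conj_real _) F) /w hcZ conj_real -scalemxAl -scalemxAr.
  by rewrite scalerA -rmorphM cc.
have ww : dot w w = 1.
  have := congr1 (@mxtrace _ _) WE; rewrite -[w ^t* *m w]mulmx1 dot_tr mulmx1 => ->.
  rewrite mxtraceZ -(HW p0) (trace_axis F) -rmorphM -(rmorph1 (real_complex R)).
  by rewrite -rmorphD -rmorphM -expr2 mulVf ?gt_eqF.
have wX (X : 'M[R[i]]_m.+2) : dot (w *m X) w = ((1 + l ^+ 2)^-1)%:C * \tr (W *m X).
  by rewrite -dot_tr WE -scalemxAl mxtraceZ.
pose s : R := l ^+ 2 / (1 + l ^+ 2).
have l2 : 0 < l ^+ 2 by rewrite lt_neqAle eq_sym sqrf_eq0 l0 sqr_ge0.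
have s01 : 0 < s < 1.
  by rewrite divr_gt0//= ltr_pdivrMr// mul1r ltrDr ltr01.
have hs p : height w (f p) = s.
  have [e1 [e1' [g1 F1]]] := frame_at hf hN hX p.
  rewrite /height wX -(HW p); have [-> _] := axis_traces l F1.
  by rewrite -rmorphM /= mulrC.
(* The derivative of the height in the direction of the scaled normal; it is nonzero because l is,
   so the height detects normal displacements. *)
pose k : R[i] := ((1 + l ^+ 2)^-1 * - (2%:R * l))%:C.
have k0 : k != 0.
  rewrite /k fmorph_eq0 mulf_eq0 oppr_eq0 invr_eq0 (gt_eqF q0) /=.
  by rewrite mulf_neq0// pnatr_eq0.
have wL p : w *m half_normal N p *m w ^t* = k%:M.
  have [e1 [e1' [g1 F1]]] := frame_at hf hN hX p.
  rewrite [LHS]mx11_scalar -dotE wX -(HW p); have [_ ->] := axis_traces l F1.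
  by rewrite -rmorphM.
have [_ grf sf _] := hf; have [[_ _ homeo cover _] _ _ _] := hf.
exists (perp w), (angle s); split.
- exact: rank_perp.
- exact: angle_itv.
split=> [_ [p _ <-]|_ [p _ <-]].
  split; first exact: grf.
  by rewrite (rdist_set_perp ww (grf p)) hs.
have [ch ac dp] := cover p; have [_ oU inv _ _] := homeo ch ac.
have Ux : chart_cod ch (chart_map ch p) by exists p.
have dP z : chart_cod ch z -> mx_differentiable (f \o chart_inv ch) z.
  by move=> Uz; apply: smooth_differentiable (sf ch ac) Uz.
have [eps eps0 onto] := locally_onto (chart_hypersurface hf hN hA hX ac) m0 dP ww k0
  (fun z _ => wL (chart_inv ch z)) (fun z _ => hs (chart_inv ch z)) Ux.
rewrite /= (inv p dp) in onto.
(* A height within delta of s lies strictly between 0 and 1, where the distance formula applies to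
   Q; the 4 in the next bound is that of [height_cauchy_schwarz]. *)
pose delta : R := Num.min s (1 - s).
have delta0 : 0 < delta by case/andP: s01 => ? ?; rewrite lt_min subr_gt0; apply/andP.
pose eps' := Num.min eps (delta ^+ 2 / 4%:R).
have eps'0 : 0 < eps' by rewrite lt_min eps0 divr_gt0// exprn_gt0.
have [d d0 Hd] := @small_radius R (2%:R * (m.+2 * m.+2)%:R) eps' (mulr_ge0 (ler0n _ _) (ler0n _ _)) eps'0.
exists d => // Q [gQ tQ] close.
have DD : gmet (Q - f p) (Q - f p) < eps'.
  apply: le_lt_trans Hd; apply: gmet_small => i j; rewrite !mxE cReD cImD cReN cImN.
  exact: rdist_lt_entry.
have hQ : `|height w (Q - f p)| < delta.
  have := height_cauchy_schwarz (Q - f p) ww.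
  have : gmet (Q - f p) (Q - f p) < delta ^+ 2 / 4%:R.
    by apply: lt_le_trans DD _; rewrite ge_min lexx orbT.
  move=> h1 h2; rewrite -(@ltr_pXn2r _ 2)// ?nnegrE// ?(ltW delta0)//.
  rewrite real_normK ?num_real//; apply: le_lt_trans h2 _.
  by rewrite mulrC -ltr_pdivlMr.
have hQE : height w (Q - f p) = height w Q - s.
  by rewrite /height mulmxBr -scaleN1r dotDl dotZl mulN1r cReD cReN -/(height w (f p)) hs.
have hQ01 : 0 < height w Q < 1.
  have d1 : delta <= s by rewrite ge_min lexx.
  have d2 : delta <= 1 - s by rewrite ge_min lexx orbT.
  by rewrite hQE in hQ; exact: (near_unit_interval d1 d2 hQ).
(* Points at equal distance from the planes of the hyperplane have equal height, which brings Q back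
   to the level set. *)
have hQs : height w Q = s.
  apply: angle_inj => //.
  by move: tQ; rewrite (rdist_set_perp ww gQ hQ01) => -[].
have [|x _ xQ] := onto Q gQ hQs.
  by apply: lt_le_trans DD _; rewrite ge_min lexx.
by exists (chart_inv ch x).
Qed.
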